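(* Suppose $f$ and $B_{H,\mu}$ satisfy the standing assumptions stated in the context, $0<\epsilon<2$, $\gamma=2\rho-1+(2-\epsilon)\alpha\cdot\min\{H,1\}$, $\rho>\frac12-\frac{(2-\epsilon)}{2}\alpha\cdot\min\{H,1\}$, and $\|u(0)\|_{L^2(D,\dot U^{\gamma+\alpha})}<\infty$. Let $u^N$ be the unique mild solution of $$\mathrm{d}u^N(t)+A^\alpha_Nu^N(t)\,\mathrm{d}t=f_N(u^N(t))\,\mathrm{d}t+P_N\mathrm{d}B_{H,\mu}(t),\quad t\in(0,T],\qquad u^N(0)=P_Nu(0),$$ and let $z^N(t)=u^N(t)-\int_0^tS_N(t-s)P_N\,\mathrm{d}B_{H,\mu}(s)$, which is the mild solution of $$\frac{\mathrm{d}}{\mathrm{d}t}z^N(t)+A_N^\alpha z^N(t)=f_N(u^N(t)),\quad t\in(0,T],\qquad z^N(0)=u^N(0).$$ Then for $0\le s<t\le T$ $$\left\|A_N^{\frac{\alpha}{2}}\left(z^N(t)-z^N(s)\right)\right\|_{L^2(D,U)}\lesssim(t-s)^{\min\{\frac{\gamma}{2\alpha},1\}}\left(\frac{1}{\min\{\gamma\alpha H,\gamma^2\}}+\|u(0)\|_{L^2(D,\dot U^{\gamma+\alpha})}\right).$$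
   Context: Setting. $D\subset\mathbb{R}^2$ is a bounded domain, $T>0$, $\alpha\in(0,1)$, and $U=L^2(D;\mathbb{R})$ with inner product $\langle\cdot,\cdot\rangle$ and norm $\|\cdot\|$. Let $0<\lambda_1\le\lambda_2\le\cdots$ be the eigenvalues of $-\Delta$ on $D$ with homogeneous Dirichlet boundary condition and $\{\phi_i\}_{i\in\mathbb{N}}$ the corresponding orthonormal basis of $U$ of eigenfunctions. For $\nu\ge0$, $A^{\nu}u=\sum_i\lambda_i^{\nu}\langle u,\phi_i\rangle\phi_i$ (so $A=-\Delta$), and $\dot U^\nu=\mathrm{dom}(A^{\nu/2})=\{u\in U:\sum_i\lambda_i^\nu\langle u,\phi_i\rangle^2<\infty\}$ with norm $\|u\|_\nu=\|A^{\nu/2}u\|$; $\dot U^0=U$. $L^2(D,\dot U^\nu)$ denotes the space of square-integrable $\dot U^\nu$-valued random variables with norm $\|u\|_{L^2(D,\dot U^\nu)}=(\mathrm{E}[\|u\|_\nu^2])^{1/2}$. Galerkin notation. For $N\in\mathbb{N}$, $U^N=\mathrm{span}\{\phi_1,\dots,\phi_N\}$, $P_N\xi=\sum_{i=1}^N\langle\xi,\phi_i\rangle\phi_i$, $A_N^\nu=A^\nu P_N$, $f_N=P_Nf$, and $S_N(t)=\mathrm{e}^{-tA_N^\alpha}$ on $U^N$, applied to $\xi\in U$ through $P_N$: $S_N(t)\xi=\sum_{i=1}^N\mathrm{e}^{-t\lambda_i^\alpha}\langle\xi,\phi_i\rangle\phi_i$. Tempered fractional Brownian motion (tfBm). For $H>0$,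 $H\neq\frac12$, $\mu>0$ and a standard (two-sided) Brownian motion $\beta$, $$\beta_{H,\mu}(t)=\int_{-\infty}^{+\infty}\left[\mathrm{e}^{-\mu(t-y)_+}(t-y)_+^{H-\frac12}-\mathrm{e}^{-\mu(-y)_+}(-y)_+^{H-\frac12}\right]\mathrm{d}\beta(y),$$ where $(y)_+=y$ if $y>0$ and $(y)_+=0$ if $y\le 0$. Stochastic integral. For $H>\frac12$ and $g\in L^2(\mathbb{R};\mathbb{R})$: $\int_{\mathbb{R}}g\,\mathrm{d}\beta_{H,\mu}=\Gamma(H+\frac12)\int_{\mathbb{R}}[\mathbb{I}^{H-\frac12,\mu}g(y)-\mu\mathbb{I}^{H+\frac12,\mu}g(y)]\,\mathrm{d}\beta(y)$, with $\mathbb{I}^{\kappa,\mu}g(y)=\frac{1}{\Gamma(\kappa)}\int_y^{+\infty}g(x)(x-y)^{\kappa-1}\mathrm{e}^{-\mu(x-y)}\mathrm{d}x$. For $0<H<\frac12$ and $g\in W^{\frac12-H,2}(\mathbb{R};\mathbb{R})$: $\int_{\mathbb{R}}g\,\mathrm{d}\beta_{H,\mu}=\Gamma(H+\frac12)\int_{\mathbb{R}}[\mathbb{D}^{\frac12-H,\mu}g(y)-\mu\mathbb{I}^{H+\frac12,\mu}g(y)]\,\mathrm{d}\beta(y)$, with $\mathbb{D}^{\kappa,\mu}g(y)=\mu^{\kappa}g(y)+\frac{\kappa}{\Gamma(1-\kappa)}\int_y^{+\infty}\frac{g(y)-g(x)}{(x-y)^{\kappa+1}}\mathrm{e}^{-\mu(x-y)}\mathrm{d}x$.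 An integral over $[a,b]$ is the integral over $\mathbb{R}$ of the integrand multiplied by the indicator of $[a,b]$. Standing assumptions. (Nonlinearity) $f:U\to U$ satisfies $\|f(u)-f(v)\|\lesssim\|u-v\|$ for $u,v\in U$ and $\|A^{\nu/2}f(u)\|\lesssim 1+\|A^{\nu/2}u\|$ for $u\in\dot U^\nu$, $\nu\ge0$. (Noise) $B_{H,\mu}(t)=\sum_{i=1}^\infty\sigma_i\beta^i_{H,\mu}(t)\phi_i$ (formal series), where $|\sigma_i|\le\lambda_i^{-\rho}$ with $\rho\ge0$, and $\{\beta^i_{H,\mu}\}_{i\in\mathbb{N}}$ are mutually independent real tfBms with the same $H,\mu$. Correspondingly $\int_a^b S_N(t-s)P_N\,\mathrm{d}B_{H,\mu}(s)=\int_a^b S_N(t-s)\,\mathrm{d}B_{H,\mu}(s)=\sum_{i=1}^N\sigma_i\left(\int_a^b\mathrm{e}^{-\lambda_i^\alpha(t-s)}\mathrm{d}\beta^i_{H,\mu}(s)\right)\phi_i$. Mild solutions. $u^N(t)=S_N(t)u(0)+\int_0^tS_N(t-s)f(u^N(s))\,\mathrm{d}s+\int_0^tS_N(t-s)\,\mathrm{d}B_{H,\mu}(s)$ and $z^N(t)=S_N(t)z^N(0)+\int_0^tS_N(t-s)f(u^N(s))\,\mathrm{d}s$, where $u(0)=u_0$ is the (random) initial value. Convention. $a\lesssim b$ means $a\le Cb$ with a constant $C>0$ that may depend on $T,D,f,\mu,H,\rho,\alpha$ but not on $s,t,\epsilon,N,u(0)$ (in the assumption on $f$: not on $u,v,\nu$).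 *)

(* Defs.v *)
From HB Require Import structures.
From mathcomp Require Export all_boot all_order all_algebra.
From mathcomp Require Export all_classical all_reals all_analysis.
Export Order.TTheory GRing.Theory Num.Theory numFieldNormedType.Exports.

Set Implicit Arguments.
Unset Strict Implicit.
Unset Printing Implicit Defensive.

Local Open Scope classical_set_scope.
Local Open Scope ring_scope.

Notation lebesgue2 R :=
  (product_measure1 (@lebesgue_measure R) (@lebesgue_measure R)).

(* U = L^2(D) is represented by honest functions on the plane of which only the
   values on D matter; equality in U is [ae_eq (lebesgue2 R) D]. *)
Section L2_of_domain.
Context {R : realType}.
Implicit Types (D : set (R * R)) (u v g : R * R -> R).

Definition bounded_domain D :=
  [/\ open D, connected D, D !=set0 & bounded_set D].

Definition inU D u := (u \_ D) \in Lfun (lebesgue2 R) 2%:E.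

Definition ip D u v : R := \int[lebesgue2 R]_(z in D) (u z * v z).

Definition normU D u : R := Num.sqrt (ip D u u).

Definition partial1 g : R * R -> R := fun z => 'D_((1, 0) : R * R) g z.

Definition partial2 g : R * R -> R := fun z => 'D_((0, 1) : R * R) g z.

Fixpoint class_C (k : nat) g : Prop :=
  continuous g /\
  if k is m.+1 then
    [/\ forall z, derivable g z ((1, 0) : R * R),
        forall z, derivable g z ((0, 1) : R * R),
        class_C m (partial1 g) & class_C m (partial2 g)]
  else True.

Definition test_function D g :=
  [/\ forall k, class_C k g,
      compact (closure [set z | g z != 0]) &
      closure [set z | g z != 0] `<=` D].

(* g is in H^1_0(D), the H^1-closure of the test functions, and (g1, g2) is its
   weak gradient. *)
Definition H10_grad D g g1 g2 :=
  [/\ inU D g, inU D g1, inU D g2 &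
      exists psi : nat -> R * R -> R,
        [/\ forall n, test_function D (psi n),
            normU D (psi n \- g) @[n --> \oo] --> 0,
            normU D (partial1 (psi n) \- g1) @[n --> \oo] --> 0 &
            normU D (partial2 (psi n) \- g2) @[n --> \oo] --> 0]].

(* -Laplace g = l g on D with g = 0 on the boundary, in the weak sense; D has no
   boundary regularity. *)
Definition dirichlet_eigenpair D (l : R) g :=
  exists g1 g2, H10_grad D g g1 g2 /\
    forall psi, test_function D psi ->
      ip D g1 (partial1 psi) + ip D g2 (partial2 psi) = l * ip D g psi.

End L2_of_domain.

(* The eigenvalue with index i >= 1 is [lam i.-1], and similarly for phi. *)
Record dirichlet_eigenbasis {R : realType} (D : set (R * R)) (lam : nat -> R)
    (phi : nat -> R * R -> R) : Prop := DirichletEigenbasis {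
  eigen_gt0 : 0 < lam 0%N;
  eigen_nondecreasing : forall i, lam i <= lam i.+1;
  eigen_pair : forall i, dirichlet_eigenpair D (lam i) (phi i);
  eigen_orthonormal : forall i j, ip D (phi i) (phi j) = (i == j)%:R;
  eigen_complete : forall u, inU D u ->
    normU D (u \- (fun z => \sum_(i < n) ip D u (phi i) * phi i z))
      @[n --> \oo] --> 0 }.

Section spectral_calculus.
Context {R : realType}.
Variables (D : set (R * R)) (lam : nat -> R) (phi : nat -> R * R -> R).
Implicit Types u v xi : R * R -> R.

Definition dotU (nu : R) u :=
  inU D u /\
  (\sum_(0 <= i <oo) (lam i `^ nu * ip D u (phi i) ^+ 2)%:E < +oo)%E.

Definition is_Apow (nu : R) u v :=
  inU D v /\
  normU D ((fun z => \sum_(i < n) lam i `^ nu * ip D u (phi i) * phi i z) \- v)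
    @[n --> \oo] --> 0.

(* A representative of the sum of the L^2(D)-convergent series; meaningful when
   u is in the domain of A^nu, that is [dotU (2 * nu) u]. *)
Definition Apow (nu : R) u : R * R -> R := xget (cst 0) (is_Apow nu u).

Definition dotnorm (nu : R) u : \bar R :=
  if `[< dotU nu u >] then (normU D (Apow (nu / 2) u))%:E else +oo%E.

Definition PN (N : nat) xi : R * R -> R :=
  fun z => \sum_(i < N) ip D xi (phi i) * phi i z.

Definition ApowN (N : nat) (nu : R) u : R * R -> R := Apow nu (PN N u).

Definition SN (alpha : R) (N : nat) (t : R) xi : R * R -> R :=
  fun z => \sum_(i < N)
    expR (- (t * lam i `^ alpha)) * ip D xi (phi i) * phi i z.

(* Integral over [a, b] of a function with values in the finite-dimensional
   space U^N, in the coordinates given by its orthonormal basis. *)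
Definition intUN (N : nat) (a b : R) (g : R -> R * R -> R) : R * R -> R :=
  fun z => \sum_(i < N)
    (\int[lebesgue_measure]_(s in `[a, b]) ip D (g s) (phi i)) * phi i z.

Record nonlinearity (f : (R * R -> R) -> (R * R -> R)) : Prop := Nonlinearity {
  nonlin_inU : forall u, inU D u -> inU D (f u);
  nonlin_lipschitz : exists2 K : R, 0 < K &
    forall u v, inU D u -> inU D v ->
      normU D (f u \- f v) <= K * normU D (u \- v);
  nonlin_growth : exists2 K : R, 0 < K &
    forall nu u, 0 <= nu -> dotU nu u ->
      dotU nu (f u) /\
      normU D (Apow (nu / 2) (f u)) <= K * (1 + normU D (Apow (nu / 2) u)) }.

End spectral_calculus.

Section tempered_fractional_calculus.
Context {R : realType}.
Implicit Types (kappa mu H s : R) (g : R -> R).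

Definition Gamma (x : R) : R :=
  \int[lebesgue_measure]_(y in `]0, +oo[) (y `^ (x - 1) * expR (- y)).

Definition tempered_int kappa mu g : R -> R := fun y =>
  (Gamma kappa)^-1 *
  \int[lebesgue_measure]_(x in `]y, +oo[)
    (g x * (x - y) `^ (kappa - 1) * expR (- (mu * (x - y)))).

Definition tempered_der kappa mu g : R -> R := fun y =>
  mu `^ kappa * g y +
  kappa / Gamma (1 - kappa) *
  \int[lebesgue_measure]_(x in `]y, +oo[)
    ((g y - g x) / (x - y) `^ (kappa + 1) * expR (- (mu * (x - y)))).

(* W^{s,2}(R), 0 < s < 1, through the Gagliardo seminorm. *)
Definition sobolevW2 s g :=
  g \in Lfun lebesgue_measure 2%:E /\
  (\int[lebesgue2 R]_z
     ((g z.1 - g z.2) ^+ 2 / `|z.1 - z.2| `^ (1 + 2 * s))%:E < +oo)%E.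

(* The convention (0)_+^(H - 1/2) = 0 holds since H != 1/2 and [0 `^ r = 0] for
   r != 0. *)
Definition tfBm_kernel H mu (t : R) : R -> R := fun y =>
  expR (- (mu * Num.max 0 (t - y))) * Num.max 0 (t - y) `^ (H - 2^-1)
  - expR (- (mu * Num.max 0 (- y))) * Num.max 0 (- y) `^ (H - 2^-1).

End tempered_fractional_calculus.

Section noise.
Context {R : realType} {d : measure_display} {Omega : measurableType d}.
Variable P : probability Omega R.

Record two_sided_BM (beta : R -> Omega -> R) : Prop := TwoSidedBM {
  BM_measurable : forall t, measurable_fun setT (beta t);
  BM_at0 : {ae P, forall w, beta 0 w = 0};
  BM_normal : forall s t, s < t -> forall Y : set R, measurable Y ->
    P ((beta t \- beta s) @^-1` Y) = normal_prob 0 (Num.sqrt (t - s)) Y;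
  BM_indep : forall (n : nat) (t : nat -> R) (Y : nat -> set R),
    (forall k, t k <= t k.+1) -> (forall k, measurable (Y k)) ->
    P (\bigcap_(k in `I_n) ((beta (t k.+1) \- beta (t k)) @^-1` Y k)) =
    (\prod_(k < n) P ((beta (t k.+1) \- beta (t k))%R @^-1` Y k))%E;
  BM_continuous : {ae P, forall w, continuous (fun t => beta t w)} }.

Definition step (n : nat) (t c : nat -> R) : R -> R :=
  fun y => \sum_(k < n) c k * \1_(`]t k, t k.+1]) y.

Definition step_int (beta : R -> Omega -> R) (n : nat) (t c : nat -> R) :
    Omega -> R :=
  fun w => \sum_(k < n) c k * (beta (t k.+1) w - beta (t k) w).

(* X is a version of the Wiener integral of g against beta over the line: the
   L^2(Omega)-limit of the integrals of step functions that tend to g in L^2. *)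
Definition wiener_integral (beta : R -> Omega -> R) (g : R -> R)
    (X : Omega -> R) :=
  [/\ g \in Lfun lebesgue_measure 2%:E,
      X \in Lfun P 2%:E &
      exists (n : nat -> nat) (t c : nat -> nat -> R),
        [/\ forall m k, t m k <= t m k.+1,
            'N[lebesgue_measure]_2%:E
              [EFin \o (step (n m) (t m) (c m) \- g)%R]%E @[m --> \oo] --> 0%E &
            'N[P]_2%:E
              [EFin \o (step_int beta (n m) (t m) (c m) \- X)%R]%E
              @[m --> \oo] --> 0%E]].

Definition tfBm (H mu : R) (beta B : R -> Omega -> R) :=
  two_sided_BM beta /\
  forall t, wiener_integral beta (tfBm_kernel H mu t) (B t).

(* X is a version of the integral of g over the line against the tempered
   fractional Brownian motion driven by beta. *)
Definition tfBm_integral (H mu : R) (beta : R -> Omega -> R) (g : R -> R)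
    (X : Omega -> R) :=
  exists Y : Omega -> R,
    (forall w, X w = Gamma (H + 2^-1) * Y w) /\
    if 2^-1 < H then
      g \in Lfun lebesgue_measure 2%:E /\
      wiener_integral beta
        (fun y => tempered_int (H - 2^-1) mu g y
                  - mu * tempered_int (H + 2^-1) mu g y) Y
    else
      sobolevW2 (2^-1 - H) g /\
      wiener_integral beta
        (fun y => tempered_der (2^-1 - H) mu g y
                  - mu * tempered_int (H + 2^-1) mu g y) Y.

Definition tfBm_integral_on (H mu : R) (beta : R -> Omega -> R) (a b : R)
    (g : R -> R) (X : Omega -> R) :=
  tfBm_integral H mu beta (fun s => g s * \1_(`[a, b]) s) X.

(* Mutual independence of the processes B i. Product rules over initial
   segments of indices suffice: put E i := setT to skip an index. *)
Definition independent_processes (B : nat -> R -> Omega -> R) :=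
  forall (n : nat) (E : nat -> set Omega),
    (forall i, <<s [set F | exists t (Y : set R),
                     measurable Y /\ F = B i t @^-1` Y] >> (E i)) ->
    P (\bigcap_(i in `I_n) E i) = (\prod_(i < n) P (E i))%E.

(* The data of the noise sum_i sigma_i beta^i_{H,mu} phi_i: the i-th tempered
   fractional Brownian motion is B i, driven by beta i. *)
Record noise_data (H mu rho : R) (lam sigma : nat -> R)
    (beta B : nat -> R -> Omega -> R) : Prop := NoiseData {
  noise_coef : forall i, `|sigma i| <= lam i `^ (- rho);
  noise_tfBm : forall i, tfBm H mu (beta i) (B i);
  noise_indep : independent_processes B }.

End noise.

Section galerkin.
Context {R : realType} {d : measure_display} {Omega : measurableType d}.
Variables (P : probability Omega R) (D : set (R * R)).
Variables (lam : nat -> R) (phi : nat -> R * R -> R).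
Implicit Types (X : nat -> R -> Omega -> R) (u : R -> Omega -> R * R -> R).

(* Weak measurability, which is Borel measurability as U is separable. *)
Definition random_U (u0 : Omega -> R * R -> R) :=
  (forall w, inU D (u0 w)) /\
  (forall i, measurable_fun setT (fun w => ip D (u0 w) (phi i))).

Definition L2dotnorm (nu : R) (u0 : Omega -> R * R -> R) : \bar R :=
  'N[P]_2%:E [(fun w => dotnorm D lam phi nu (u0 w))]%E.

Definition L2Unorm (v : Omega -> R * R -> R) : \bar R :=
  'N[P]_2%:E [(fun w => (normU D (v w))%:E)]%E.

(* X i t is a version of the integral of exp(- lam_i^alpha (t - s)) over
   0 <= s <= t against the i-th tempered fractional Brownian motion. *)
Definition convolution_coefs (alpha H mu T : R) (beta : nat -> R -> Omega -> R)
    X :=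
  forall i t, 0 <= t <= T ->
    tfBm_integral_on P H mu (beta i) 0 t
      (fun s => expR (- (lam i `^ alpha * (t - s)))) (X i t).

Definition stoch_conv (sigma : nat -> R) X (N : nat) (t : R) (w : Omega) :
    R * R -> R :=
  fun z => \sum_(i < N) sigma i * X i t w * phi i z.

Record mild_solution (alpha T : R) (f : (R * R -> R) -> (R * R -> R))
    (sigma : nat -> R) X (u0 : Omega -> R * R -> R) (N : nat) u :
    Prop := MildSolution {
  mild_inU : forall t w, 0 <= t <= T -> inU D (u t w);
  mild_measurable : forall i,
    measurable_fun (`[0, T] `*` setT : set (measurableTypeR R * Omega))
      (fun p => ip D (u p.1 p.2) (phi i));
  mild_integrable : {ae P, forall w,
    (\int[lebesgue_measure]_(s in `[0%R, T]) (normU D (u s w))%:E < +oo)%E};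
  mild_eq : forall t, 0 <= t <= T ->
    {ae P, forall w, ae_eq (lebesgue2 R) D (u t w)
      (SN D lam phi alpha N t (u0 w)
       \+ intUN D phi N 0 t
            (fun s => SN D lam phi alpha N (t - s) (f (u s w)))
       \+ stoch_conv sigma X N t w)} }.

Definition zN (sigma : nat -> R) X (N : nat) u (t : R) (w : Omega) :
    R * R -> R :=
  u t w \- stoch_conv sigma X N t w.

End galerkin.

(* Main.v *)
Require Import Defs.
From mathcomp Require Import ring lra measurable_realfun lebesgue_integral_under.

Set Implicit Arguments.
Unset Strict Implicit.
Unset Printing Implicit Defensive.

Local Open Scope classical_set_scope.
Local Open Scope ring_scope.

(** Work in coordinates on the eigenbasis, with [a_i = lam_i ^ alpha].

    Noise: the variance of a Wiener integral is at most the squared norm of its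
    kernel, and the kernel obtained from [exp (- a (t - s))] on [0, t] is at most
    [C a^(-q) v^(H - 1/2 - q) exp (- c v)], [v] being the distance to [t] (and, if
    [H < 1/2], the distance to [0] as well). This is square integrable for
    [q < min H 1], which gives the variance bound [C a^(-2q) / (min H 1 - q)]. As
    [lam_i >= c (i + 1)] (Weyl), summing over [i] with [min H 1 - q] proportional to
    [min gamma 1] bounds the second moment of the stochastic convolution in
    [dotU delta] by [C / gamma^2].

    Solution: the growth of [f] on [dotU delta] and Gronwall's lemma carry this bound
    over to [u] and to [f u], uniformly in time.

    Increments: [z_i(t) - z_i(s)] is an initial term plus the integral of
    [f_i(u(r))] against a kernel whose total mass, weighted by
    [lam_i^((alpha - delta)/2)], is at most [C (t - s)^(min (gamma / 2 alpha) 1)];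
    conclude with the Cauchy-Schwarz inequality for the kernel and Tonelli. *)

(** * Square-integrable functions *)

(** The constant is fixed before eps, N and the initial value, so the dependence on gamma has to be
    explicit. It comes from two margins. The exponent q of the kernel bound exchanges decay in the
    eigenvalue for a singularity v^(-q), and integrability of the square then costs 1 / (min H 1 -
    q). Summing eigenvalue powers of exponent -(1 + theta) costs 1 / theta. Both margins are
    proportional to [gap_of], which gives gap^(-2) for the second moment and gap^(-1) for the norm;
    as gamma <= 2 rho + 2 alpha, the latter is at most a constant times 1 / min (gamma alpha H)
    (gamma^2). A positive gap is affordable because integration in time smooths: a kernel carrying
    lam^(3 alpha / 4) is still bounded by the integrable (s - r)^(-3/4). The weight lam^(alpha / 2)
    of the norm and the price lam^(alpha theta) of the factor (t - s)^theta have to fit into lam^(3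
    alpha / 4) and lam^(delta / 2), so delta may stay alpha / 2 below 2 alpha theta. *)

Section square_integrable.
Context {d} {T : measurableType d} {R : realType}.
Variable mu : {measure set T -> \bar R}.
Implicit Types f g h : T -> R.

Lemma Lfun2_measurable f : f \in Lfun mu 2%:E -> measurable_fun setT f.
Proof. by rewrite inE => /andP[/[!inE]]. Qed.

Lemma Lfun2P f : measurable_fun setT f ->
  f \in Lfun mu 2%:E <-> (\int[mu]_x (f x ^+ 2)%:E < +oo)%E.
Proof.
move=> mf; split.
  by move=> /Lfun2_integrable_sqr/integrable_lty; exact.
move=> fi; rewrite inE; apply/andP; split; rewrite inE//=.
rewrite /finite_norm unlock poweR_lty//=.
by under eq_integral do rewrite powR_mulrn// real_normK ?num_real//.
Qed.

Definition dot f g := \int[mu]_x (f x * g x).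

Lemma Lfun2_mul f g : f \in Lfun mu 2%:E -> g \in Lfun mu 2%:E ->
  mu.-integrable setT (EFin \o (f \* g)).
Proof. by move=> lf lg; apply/Lfun1_integrable/Lfun2_mul_Lfun1. Qed.

Lemma Lfun2D f g : f \in Lfun mu 2%:E -> g \in Lfun mu 2%:E ->
  (f \+ g) \in Lfun mu 2%:E.
Proof.
move=> lf lg; have p1 : (1 <= 2%:E :> \bar R)%E by rewrite lee_fin ler1n.
by have [_] := Lfun_submod_closed mu p1 => /(_ 1 _ _ lf lg); rewrite scale1r.
Qed.

Lemma Lfun2Z a f : f \in Lfun mu 2%:E -> (fun x => a * f x) \in Lfun mu 2%:E.
Proof.
move=> lf; have -> : (fun x => a * f x) = (a \o* f).
  by apply/funext => x /=; rewrite mulrC.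
by apply: Lfun_scale => //; rewrite ler1n.
Qed.

Lemma Lfun2N f : f \in Lfun mu 2%:E -> (\- f) \in Lfun mu 2%:E.
Proof.
move=> /(Lfun2Z (-1)) lf; rewrite (_ : \- f = (fun x => -1 * f x))//.
by apply/funext => x; rewrite mulN1r.
Qed.

Lemma Lfun2B f g : f \in Lfun mu 2%:E -> g \in Lfun mu 2%:E ->
  (f \- g) \in Lfun mu 2%:E.
Proof. by move=> lf lg; exact/(Lfun2D lf)/Lfun2N. Qed.

Lemma Lfun20 : (cst 0 : T -> R) \in Lfun mu 2%:E.
Proof.
have p1 : (1 <= 2%:E :> \bar R)%E by rewrite lee_fin ler1n.
by have [] := Lfun_submod_closed mu p1.
Qed.

Lemma Lfun2_sum n (c : nat -> R) (e : nat -> T -> R) :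
  (forall i, (i < n)%N -> e i \in Lfun mu 2%:E) ->
  (fun x => \sum_(i < n) c i * e i x) \in Lfun mu 2%:E.
Proof.
elim: n => [_|n IH le].
  under eq_fun do rewrite big_ord0; exact: Lfun20.
under eq_fun do rewrite big_ord_recr/=.
by apply: Lfun2D; [apply: IH => i /ltnW; exact: le|exact/Lfun2Z/le].
Qed.

Lemma dotC f g : dot f g = dot g f.
Proof. by apply: eq_Rintegral => x _; rewrite mulrC. Qed.

Lemma dot_ge0 f : 0 <= dot f f.
Proof. by apply: Rintegral_ge0 => x _; rewrite -expr2 sqr_ge0. Qed.

Lemma dotDl f g h : f \in Lfun mu 2%:E -> g \in Lfun mu 2%:E ->
  h \in Lfun mu 2%:E -> dot (f \+ g) h = dot f h + dot g h.
Proof.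
move=> lf lg lh; rewrite /dot -RintegralD//; try exact: Lfun2_mul.
by apply: eq_Rintegral => x _; rewrite /= mulrDl.
Qed.

Lemma dotZl a f h : f \in Lfun mu 2%:E -> h \in Lfun mu 2%:E ->
  dot (fun x => a * f x) h = a * dot f h.
Proof.
move=> lf lh; rewrite /dot -RintegralZl//; try exact: Lfun2_mul.
by apply: eq_Rintegral => x _; rewrite /= mulrA.
Qed.

Lemma dotNl f h : f \in Lfun mu 2%:E -> h \in Lfun mu 2%:E ->
  dot (\- f) h = - dot f h.
Proof.
move=> lf lh; rewrite -[RHS]mulN1r -dotZl//.
by apply: eq_Rintegral => x _; rewrite /= mulN1r.
Qed.

Lemma dotBl f g h : f \in Lfun mu 2%:E -> g \in Lfun mu 2%:E ->
  h \in Lfun mu 2%:E -> dot (f \- g) h = dot f h - dot g h.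
Proof.
by move=> lf lg lh; rewrite (_ : f \- g = f \+ \- g)// dotDl ?Lfun2N// dotNl.
Qed.

Lemma dotDr f g h : f \in Lfun mu 2%:E -> g \in Lfun mu 2%:E ->
  h \in Lfun mu 2%:E -> dot h (f \+ g) = dot h f + dot h g.
Proof. by move=> lf lg lh; rewrite dotC dotDl// !(dotC h). Qed.

Lemma dotBr f g h : f \in Lfun mu 2%:E -> g \in Lfun mu 2%:E ->
  h \in Lfun mu 2%:E -> dot h (f \- g) = dot h f - dot h g.
Proof. by move=> lf lg lh; rewrite dotC dotBl// !(dotC h). Qed.

Lemma dotZr a f h : f \in Lfun mu 2%:E -> h \in Lfun mu 2%:E ->
  dot h (fun x => a * f x) = a * dot h f.
Proof. by move=> lf lh; rewrite dotC dotZl// dotC. Qed.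

Lemma dot_suml n (c : nat -> R) (e : nat -> T -> R) f :
  (forall i, (i < n)%N -> e i \in Lfun mu 2%:E) -> f \in Lfun mu 2%:E ->
  dot (fun x => \sum_(i < n) c i * e i x) f = \sum_(i < n) c i * dot (e i) f.
Proof.
elim: n => [_ lf|n IH le lf].
  rewrite big_ord0 /dot; under eq_Rintegral do rewrite big_ord0 mul0r.
  by rewrite /Rintegral integral0.
have le' i : (i < n)%N -> e i \in Lfun mu 2%:E by move/ltnW; exact: le.
under [X in dot X]eq_fun do rewrite big_ord_recr/=.
rewrite big_ord_recr/= -IH// -dotZl ?le// -dotDl ?Lfun2Z ?le//.
exact: Lfun2_sum.
Qed.

Lemma dot_sqr f : f \in Lfun mu 2%:E ->
  (dot f f)%:E = (\int[mu]_x (f x ^+ 2)%:E)%E.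
Proof.
move=> lf; rewrite /dot /Rintegral.
under eq_integral do rewrite -expr2.
by rewrite fineK// integrable_fin_num//; exact: Lfun2_integrable_sqr.
Qed.

Lemma dotDD f g : f \in Lfun mu 2%:E -> g \in Lfun mu 2%:E ->
  dot (f \+ g) (f \+ g) = dot f f + 2 * dot f g + dot g g.
Proof.
by move=> lf lg; rewrite dotDl ?Lfun2D// !dotDr// (dotC g f); ring.
Qed.

Lemma dotBB f g : f \in Lfun mu 2%:E -> g \in Lfun mu 2%:E ->
  dot (f \- g) (f \- g) = dot f f - 2 * dot f g + dot g g.
Proof.
by move=> lf lg; rewrite dotBl ?Lfun2B// !dotBr// (dotC g f); ring.
Qed.

Lemma dot_cauchy_schwarz f g : f \in Lfun mu 2%:E -> g \in Lfun mu 2%:E ->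
  dot f g ^+ 2 <= dot f f * dot g g.
Proof.
move=> lf lg.
have H (t : R) : 0 <= dot f f - 2 * t * dot f g + t ^+ 2 * dot g g.
  have := dot_ge0 (f \- (fun x => t * g x)).
  rewrite dotBB ?Lfun2Z// !dotZr ?dotZl ?Lfun2Z//.
  by congr (_ <= _); ring.
have [g0|g0] := eqVneq (dot g g) 0.
  have [->|fg0] := eqVneq (dot f g) 0.
    by rewrite expr2 mul0r mulr_ge0 ?dot_ge0.
  (* When [dot g g = 0] the quadratic is affine in [t]; at this [t] it would equal -1. *)
  have := H ((dot f f + 1) / (2 * dot f g)).
  rewrite g0 mulr0 addr0.
  have -> : 2 * ((dot f f + 1) / (2 * dot f g)) * dot f g = dot f f + 1.
    by field.
  by rewrite opprD addrA subrr add0r lerNr oppr0 ler10.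
have g1 : 0 < dot g g by rewrite lt_neqAle eq_sym g0 dot_ge0.
have := H (dot f g / dot g g); rewrite -(pmulr_lge0 _ g1) => h0.
rewrite -subr_ge0; apply: (le_trans h0); rewrite le_eqVlt; apply/orP; left.
by apply/eqP; field.
Qed.

Definition nrm f := Num.sqrt (dot f f).

Lemma nrm_ge0 f : 0 <= nrm f. Proof. exact: sqrtr_ge0. Qed.

Lemma nrm_sqr f : nrm f ^+ 2 = dot f f.
Proof. by rewrite sqr_sqrtr ?dot_ge0. Qed.

Lemma normr_dot_le f g : f \in Lfun mu 2%:E -> g \in Lfun mu 2%:E ->
  `|dot f g| <= nrm f * nrm g.
Proof.
move=> lf lg; rewrite -ler_sqr ?nnegrE ?mulr_ge0 ?nrm_ge0//.
by rewrite exprMn !nrm_sqr real_normK ?num_real// dot_cauchy_schwarz.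
Qed.

Lemma nrmD f g : f \in Lfun mu 2%:E -> g \in Lfun mu 2%:E ->
  nrm (f \+ g) <= nrm f + nrm g.
Proof.
move=> lf lg; rewrite -ler_sqr ?nnegrE ?addr_ge0 ?nrm_ge0//.
rewrite nrm_sqr dotDD// sqrrD !nrm_sqr lerD2r lerD2l -[leRHS]mulr_natl ler_pM2l//.
exact: le_trans (ler_norm _) (normr_dot_le _ _).
Qed.

Lemma nrmN f : f \in Lfun mu 2%:E -> nrm (\- f) = nrm f.
Proof.
move=> lf; congr Num.sqrt.
by apply: eq_Rintegral => x _; rewrite /= mulrNN.
Qed.

Lemma ler_dist_nrm f g : f \in Lfun mu 2%:E -> g \in Lfun mu 2%:E ->
  `|nrm f - nrm g| <= nrm (f \- g).
Proof.
move=> lf lg; rewrite ler_norml; apply/andP; split.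
  rewrite -[X in - X](_ : nrm (g \- f) = _).
    rewrite lerNl opprB lerBlDr.
    apply: le_trans (nrmD _ _); rewrite ?Lfun2B//.
    by rewrite le_eqVlt; apply/orP; left; apply/eqP; congr nrm;
      apply/funext => x /=; rewrite subrK.
  rewrite -nrmN ?Lfun2B//; congr nrm; apply/funext => x /=.
  by rewrite opprB.
rewrite lerBlDr; apply: le_trans (nrmD _ _); rewrite ?Lfun2B//.
by rewrite le_eqVlt; apply/orP; left; apply/eqP; congr nrm;
  apply/funext => x /=; rewrite subrK.
Qed.

Lemma Lnorm2_nrm f : f \in Lfun mu 2%:E ->
  ('N[mu]_2%:E [EFin \o f] = (nrm f)%:E)%E.
Proof.
move=> lf; rewrite unlock.
under eq_integral do rewrite /= powR_mulrn// real_normK ?num_real//.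
by rewrite -dot_sqr// poweR_EFin powR12_sqrt// dot_ge0.
Qed.

Lemma Lnorm2_sqr (F : T -> \bar R) :
  ('N[mu]_2%:E [F] `^ 2 = \int[mu]_x (`|F x| `^ 2))%E.
Proof. by rewrite powR_Lnorm. Qed.

Section orthonormal.
Variable e : nat -> T -> R.
Hypothesis le : forall i, e i \in Lfun mu 2%:E.
Hypothesis on : forall i j, dot (e i) (e j) = (i == j)%:R.

Lemma dot_comb_basis n (c : nat -> R) j :
  dot (fun x => \sum_(i < n) c i * e i x) (e j) = if (j < n)%N then c j else 0.
Proof.
rewrite dot_suml//; under eq_bigr do rewrite on.
case: ltnP => jn.
  rewrite (bigD1 (Ordinal jn))//= eqxx mulr1 big1 ?addr0// => i /eqP ij.
  by case: eqP => [eij|]; [exfalso; apply: ij; exact: val_inj|rewrite mulr0].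
rewrite big1// => i _; case: eqP => [eij|]; last by rewrite mulr0.
by have := ltn_ord i; rewrite eij ltnNge jn.
Qed.

Lemma dot_comb n (c : nat -> R) :
  dot (fun x => \sum_(i < n) c i * e i x) (fun x => \sum_(i < n) c i * e i x)
  = \sum_(i < n) c i ^+ 2.
Proof.
rewrite dot_suml//; last exact: Lfun2_sum.
by apply: eq_bigr => i _; rewrite dotC dot_comb_basis ltn_ord expr2.
Qed.

Lemma dot_sub_proj n f : f \in Lfun mu 2%:E ->
  dot (f \- (fun x => \sum_(i < n) dot f (e i) * e i x))
      (f \- (fun x => \sum_(i < n) dot f (e i) * e i x))
  = dot f f - \sum_(i < n) dot f (e i) ^+ 2.
Proof.
move=> lf; rewrite dotBB ?Lfun2_sum//.
have /= -> := @dot_comb n (fun i => dot f (e i)).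
rewrite (dotC f) (@dot_suml n (fun i => dot f (e i)))//.
rewrite [X in 2 * X](eq_bigr (fun i : 'I_n => dot f (e i) ^+ 2)).
  by ring.
  by move=> i _; rewrite dotC -expr2.
exact: (@Lfun2_sum n (fun i => dot f (e i))).
Qed.

Lemma bessel n f : f \in Lfun mu 2%:E ->
  \sum_(i < n) dot f (e i) ^+ 2 <= dot f f.
Proof. by move=> lf; rewrite -subr_ge0 -dot_sub_proj// dot_ge0. Qed.

End orthonormal.

End square_integrable.

(** * Completeness of L^2 *)

Section riesz_fischer.
Context {d} {T : measurableType d} {R : realType}.
Variable mu : {measure set T -> \bar R}.

Lemma fatou_le (f_ : nat -> T -> R) (f : T -> R) (M : \bar R) :
  (forall n, measurable_fun setT (f_ n)) -> (forall n x, 0 <= f_ n x) ->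
  (forall x, f_ n x @[n --> \oo] --> f x) ->
  (\forall n \near \oo, (\int[mu]_x (f_ n x)%:E <= M)%E) ->
  (\int[mu]_x (f x)%:E <= M)%E.
Proof.
move=> mf f0 cf fM.
have mfE n : measurable_fun setT (EFin \o f_ n) by exact/measurable_EFinP.
have f0E n x : setT x -> (0 <= (EFin \o f_ n) x)%E by rewrite /= lee_fin.
have := fatou mu measurableT mfE f0E.
have cE x : (f_ n x)%:E @[n --> \oo] --> (f x)%:E.
  by apply: cvg_EFin; [exact: nearW|exact: cf].
under eq_integral => x _.
  rewrite (is_cvg_limn_einfE (u := fun n => (f_ n x)%:E)); last first.
    by apply/cvg_ex; exists (f x)%:E; exact: cE.
  rewrite (cvg_lim _ (cE x))//; over.
move=> /le_trans; apply.
rewrite limn_einf_lim; apply: lime_le; first exact: is_cvg_einfs.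
case: fM => N _ NP; near=> n.
apply: (@le_trans _ _ (\int[mu]_x (f_ (maxn n N) x)%:E)%E).
  by apply: ereal_inf_lbound => /=; exists (maxn n N) => //=; exact: leq_maxl.
by apply: NP; exact: leq_maxr.
Unshelve. all: by end_near. Qed.

(** A rapidly converging subsequence converges almost everywhere, dominated by a convergent
    geometric series; Fatou's lemma then turns the Cauchy property into convergence in norm. *)
Lemma L2_complete (f : nat -> T -> R) : (forall n, f n \in Lfun mu 2%:E) ->
  (forall e, 0 < e -> exists N, forall n m, (N <= n)%N -> (N <= m)%N ->
    dot mu (f n \- f m) (f n \- f m) <= e) ->
  exists2 g, g \in Lfun mu 2%:E &
    dot mu (f n \- g) (f n \- g) @[n --> \oo] --> 0.
Proof.
move=> lf cauchy.
have mf n := Lfun2_measurable (lf n).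
have /choice[k kP] : forall j : nat, exists N, forall n m,
    (N <= n)%N -> (N <= m)%N ->
    dot mu (f n \- f m) (f n \- f m) <= 16^-1 ^+ j.
  by move=> j; apply: cauchy; rewrite exprn_gt0// invr_gt0.
(* Partial sums make the indices increasing while staying above [k j]. *)
pose K j := (\sum_(i < j.+1) (k i).+1)%N.
have Kk j : (k j <= K j)%N by rewrite /K big_ord_recr/= -addSnnS leq_addl.
have KS j : (K j <= K j.+1)%N by rewrite /K [leqRHS]big_ord_recr leq_addr.
have jK j : (j <= K j)%N.
  by elim: j => // j IH; rewrite /K big_ord_recr/= -/(K j) addnS ltnS
    (leq_trans IH)// leq_addr.
pose D j := f (K j.+1) \- f (K j).
have lD j : D j \in Lfun mu 2%:E by exact: Lfun2B.
have mD j := Lfun2_measurable (lD j).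
(* Squared steps of size 16^(-j), weighted by 4^j, remain summable in the mean; where the sum [G x]
   is finite, [D j x] is at most sqrt (G x) * 2^(-j). *)
pose Dj j x : \bar R := (4 ^+ j * D j x ^+ 2)%:E.
have Dj0 j x : (0 <= Dj j x)%E.
  by rewrite lee_fin mulr_ge0 ?sqr_ge0// exprn_ge0.
have mDj j : measurable_fun setT (Dj j).
  by apply/measurable_EFinP; apply: measurable_funM => //; exact: measurable_funX.
pose G x := (\sum_(j <oo) Dj j x)%E.
have mG : measurable_fun setT G.
  by apply: ge0_emeasurable_sum => // j x _ _; exact: Dj0.
have G0 x : (0 <= G x)%E by apply: nneseries_ge0 => n _ _; exact: Dj0.
have IG : (\int[mu]_x G x < +oo)%E.
  rewrite integral_nneseries//.
  apply: (@le_lt_trans _ _ (\sum_(j <oo) (geometric 1 (4^-1) j)%:E)%E).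
    apply: lee_nneseries => [j _ _|j _]; first exact: integral_ge0.
    rewrite /Dj; under eq_integral do rewrite EFinM.
    have mDs : measurable_fun setT (fun x => (D j x ^+ 2)%:E).
      by apply/measurable_EFinP; exact: measurable_funX.
    rewrite ge0_integralZl ?lee_fin ?exprn_ge0//; last first.
      by move=> x _; rewrite lee_fin sqr_ge0.
    rewrite -dot_sqr// -EFinM lee_fin /= mul1r.
    apply: (@le_trans _ _ (4 ^+ j * 16^-1 ^+ j)).
      rewrite ler_wpM2l ?exprn_ge0//; apply: kP => //.
      exact: leq_trans (KS _).
    by rewrite -exprMn (_ : 4 * 16^-1 = 4^-1 :> R)//; field.
  have : cvgn (series (geometric 1 (4^-1 : R))).
    by apply: is_cvg_geometric_series; rewrite ger0_norm// invf_lt1// ltr1n.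
  move=> /cvg_ex[l hl].
  have : (fun n => (\sum_(0 <= j < n) geometric 1 (4^-1 : R) j)%:E) @ \oo --> l%:E.
    by apply: cvg_EFin; [exact: nearW|].
  under eq_fun do rewrite -sumEFin.
  by move=> /cvg_lim -> //; rewrite ltry.
pose A := [set x | (G x < +oo)%E].
have mA : measurable A by rewrite -[A]setTI; exact: emeasurable_fun_infty_o.
have muA : mu (~` A) = 0%E.
  have iG : mu.-integrable setT G.
    apply/integrableP; split => //.
    by under eq_integral do rewrite gee0_abs//.
  have [N [mN N0 sN]] := integrable_ae measurableT iG.
  apply/eqP; rewrite eq_le measure_ge0 andbT -N0; apply: le_measure.
  - by rewrite inE; exact: measurableC.
  - by rewrite inE.
  - move=> x Ax; apply: sN => /= /(_ I); rewrite ge0_fin_numE//.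
(* Setting the functions to 0 on the null set where [G] is infinite gives convergence at every
   point, hence a measurable limit. *)
pose F j x := f (K j) x * \1_A x.
have mF j : measurable_fun setT (F j) by exact: measurable_funM.
have cF x : cvgn (F ^~ x).
  have [Ax|nAx] := pselect (A x); last first.
    apply: (@is_cvg_near_cst _ _ 0); apply: nearW => j.
    by rewrite /F indicE memNset// mulr0.
  have FE j : F j x = f (K j) x by rewrite /F indicE mem_set// mulr1.
  have Gfin : G x \is a fin_num by rewrite ge0_fin_numE.
  have bnd j : `|telescope (F ^~ x) j| <= geometric (Num.sqrt (fine (G x))) 2^-1 j.
    rewrite /telescope/= !FE -ler_sqr ?nnegrE ?mulr_ge0 ?exprn_ge0 ?sqrtr_ge0//.
    rewrite real_normK ?num_real// exprMn sqr_sqrtr ?fine_ge0//.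
    rewrite -exprM mulnC exprM exprVn -ler_pdivrMr ?invr_gt0 ?exprn_gt0//.
    rewrite exprVn invrK mulrC.
    rewrite (_ : 2 ^+ 2 = 4 :> R); last by rewrite -natrX.
    rewrite -lee_fin fineK//.
    apply: (le_trans _ (@nneseries_lim_ge _ (Dj ^~ x) xpredT 0 j.+1 _)) => //.
    by rewrite big_nat_recr//= leeDr// sume_ge0.
  have : cvgn (series (telescope (F ^~ x))).
    apply: normed_cvg; apply: (series_le_cvg _ _ bnd) => [n|n|].
    - exact: normr_ge0.
    - by rewrite mulr_ge0 ?exprn_ge0// sqrtr_ge0.
    - by apply: is_cvg_geometric_series; rewrite ger0_norm// invf_lt1// ltr1n.
  rewrite telescopeK => cc.
  have -> : F ^~ x = (fun n => (F n x - F 0%N x) + F 0%N x).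
    by apply/funext => n; rewrite subrK.
  by apply: is_cvgD => //; exact: is_cvg_cst.
pose g x := limn (F ^~ x).
have cFg x : F ^~ x @ \oo --> g x by exact: cF.
have mg : measurable_fun setT g by apply: (measurable_fun_cvg mF) => x _.
have fg e : 0 < e -> exists N, forall n, (N <= n)%N ->
    (\int[mu]_x ((f n x - g x) ^+ 2)%:E <= e%:E)%E.
  move=> e0; have [N NP] := cauchy _ e0; exists N => n Nn.
  apply: (@fatou_le (fun j x => (f n x - F j x) ^+ 2)).
  - by move=> j; apply: measurable_funX; exact: measurable_funB.
  - by move=> j x; exact: sqr_ge0.
  - by move=> x; apply: cvgM => //; apply: cvgB => //; exact: cvg_cst.
  - exists N => // j /= Nj.
    rewrite (@ge0_ae_eq_integral _ _ _ mu setT _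
      (fun x => ((f n \- f (K j)) x ^+ 2)%:E))//=.
    + by rewrite -dot_sqr ?Lfun2B// lee_fin NP// (leq_trans Nj).
    + apply/measurable_EFinP; apply: measurable_funX.
      by apply: measurable_funB => //; exact: mf.
    + by apply/measurable_EFinP; apply: measurable_funX; exact: measurable_funB.
    + by move=> x _; rewrite lee_fin sqr_ge0.
    + by move=> x _; rewrite lee_fin sqr_ge0.
    + exists (~` A); split => //; first exact: measurableC.
      move=> x /= nE Ax; apply: nE => _.
      by rewrite /F indicE mem_set// mulr1.
have lfg n : exists m, (n <= m)%N /\ (f m \- g) \in Lfun mu 2%:E.
  have [N NP] := fg _ ltr01; exists (maxn n N); split; first exact: leq_maxl.
  apply/Lfun2P; first exact: measurable_funB.
  by apply: le_lt_trans (ltry 1%R); apply: NP; exact: leq_maxr.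
have lg : g \in Lfun mu 2%:E.
  have [m [_ /(Lfun2B (lf m))]] := lfg 0%N.
  rewrite (_ : f m \- (f m \- g) = g)//.
  by apply/funext => x /=; rewrite opprB addrC subrK.
exists g => //.
apply/cvgrPdist_le => e e0; have [N NP] := fg _ e0.
exists N => // n /= Nn; rewrite sub0r normrN ger0_norm ?dot_ge0//.
by rewrite -lee_fin dot_sqr ?Lfun2B// NP.
Qed.

End riesz_fischer.

Section pointwise_comparison.
Context {d} {T : measurableType d} {R : realType}.
Variable mu : {measure set T -> \bar R}.
Implicit Types f g : T -> R.

Lemma Lfun2_le f g : measurable_fun setT f -> g \in Lfun mu 2%:E ->
  (forall x, `|f x| <= `|g x|) -> f \in Lfun mu 2%:E.
Proof.
move=> mf lg fg; have mg := Lfun2_measurable lg.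
apply/Lfun2P => //; move/(Lfun2P _ mg): lg; apply: le_lt_trans.
apply: ge0_le_integral => //.
- by move=> x _; rewrite lee_fin sqr_ge0.
- by apply/measurable_EFinP; exact: measurable_funX.
- by apply/measurable_EFinP; exact: measurable_funX.
- by move=> x _; rewrite lee_fin -[leLHS]real_normK ?num_real//
    -[leRHS]real_normK ?num_real// ler_sqr ?nnegrE.
Qed.

Lemma dot_self_le f g : g \in Lfun mu 2%:E -> f \in Lfun mu 2%:E ->
  (forall x, `|f x| <= `|g x|) -> dot mu f f <= dot mu g g.
Proof.
move=> lg lf fg; rewrite -lee_fin !dot_sqr//.
have mf := Lfun2_measurable lf; have mg := Lfun2_measurable lg.
apply: ge0_le_integral => //.
- by move=> x _; rewrite lee_fin sqr_ge0.
- by apply/measurable_EFinP; exact: measurable_funX.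
- by apply/measurable_EFinP; exact: measurable_funX.
- by move=> x _; rewrite lee_fin -[leLHS]real_normK ?num_real//
    -[leRHS]real_normK ?num_real// ler_sqr ?nnegrE.
Qed.

End pointwise_comparison.

(** * The space L^2(D) and the powers of the Laplacian *)

Section L2_of_domain_theory.
Context {R : realType}.
Variable D : set (R * R).
Implicit Types u v w : R * R -> R.
Local Notation leb2 := (lebesgue2 R).

Lemma patch_sumE n (c : nat -> R) (e : nat -> R * R -> R) :
  (fun z => \sum_(i < n) c i * e i z) \_ D =
  (fun z => \sum_(i < n) c i * ((e i) \_ D) z).
Proof.
apply/funext => z; rewrite patchE; case: ifPn => zD.
  by apply: eq_bigr => i _; rewrite patchE zD.
by rewrite big1// => i _; rewrite patchE (negbTE zD) mulr0.
Qed.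

Lemma patchD u v : (u \+ v) \_ D = (u \_ D) \+ (v \_ D).
Proof.
by apply/funext => z; rewrite /= !patchE; case: ifPn => // _; rewrite addr0.
Qed.

Lemma patchB u v : (u \- v) \_ D = (u \_ D) \- (v \_ D).
Proof.
by apply/funext => z; rewrite /= !patchE; case: ifPn => // _; rewrite subr0.
Qed.

Lemma patchZ a u : (fun z => a * u z) \_ D = (fun z => a * (u \_ D) z).
Proof.
by apply/funext => z; rewrite /= !patchE; case: ifPn => // _; rewrite mulr0.
Qed.

(** Extension by zero moves every statement on L^2(D) to the whole plane, where the previous part
    applies. *)
Lemma ipE u v : ip D u v = dot leb2 (u \_ D) (v \_ D).
Proof.
rewrite /ip Rintegral_mkcond; apply: eq_Rintegral => z _.
by rewrite !patchE; case: ifPn => // _; rewrite mulr0.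
Qed.

Lemma normUE u : normU D u = nrm leb2 (u \_ D).
Proof. by rewrite /normU ipE. Qed.

Lemma inUD u v : inU D u -> inU D v -> inU D (u \+ v).
Proof. by rewrite /inU patchD; exact: Lfun2D. Qed.

Lemma inUB u v : inU D u -> inU D v -> inU D (u \- v).
Proof. by rewrite /inU patchB; exact: Lfun2B. Qed.

Lemma inUZ a u : inU D u -> inU D (fun z => a * u z).
Proof. by rewrite /inU patchZ; exact: Lfun2Z. Qed.

Lemma inU_sum n (c : nat -> R) (e : nat -> R * R -> R) :
  (forall i, inU D (e i)) -> inU D (fun z => \sum_(i < n) c i * e i z).
Proof.
move=> eU; rewrite /inU patch_sumE.
exact: (@Lfun2_sum _ _ _ leb2 n c (fun i => e i \_ D) (fun i _ => eU i)).
Qed.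

Lemma ipDl u v w : inU D u -> inU D v -> inU D w ->
  ip D (u \+ v) w = ip D u w + ip D v w.
Proof. by move=> *; rewrite !ipE patchD dotDl. Qed.

Lemma ipBl u v w : inU D u -> inU D v -> inU D w ->
  ip D (u \- v) w = ip D u w - ip D v w.
Proof. by move=> *; rewrite !ipE patchB dotBl. Qed.

Lemma normU_ge0 u : 0 <= normU D u.
Proof. by rewrite normUE nrm_ge0. Qed.

Lemma normU_sqr u : normU D u ^+ 2 = ip D u u.
Proof. by rewrite normUE nrm_sqr -ipE. Qed.

Lemma normUD u v : inU D u -> inU D v ->
  normU D (u \+ v) <= normU D u + normU D v.
Proof. by move=> *; rewrite !normUE patchD nrmD. Qed.

Lemma normUBC u v : normU D (u \- v) = normU D (v \- u).
Proof.
congr Num.sqrt; apply: eq_Rintegral => z _ /=.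
by rewrite -(opprB (v z)) mulrNN.
Qed.

Lemma ler_dist_normU u v : inU D u -> inU D v ->
  `|normU D u - normU D v| <= normU D (u \- v).
Proof. by move=> *; rewrite !normUE patchB ler_dist_nrm. Qed.

Lemma normr_ip_le u v : inU D u -> inU D v ->
  `|ip D u v| <= normU D u * normU D v.
Proof. by move=> *; rewrite !normUE ipE normr_dot_le. Qed.

(** The mild equation identifies functions only up to null subsets of [D]; coordinates do not see
    the difference. *)
Lemma ip_ae_eql u u' v : inU D u -> inU D u' -> inU D v ->
  ae_eq leb2 D u u' -> ip D u v = ip D u' v.
Proof.
move=> uU u'U vU uu'; rewrite !ipE /dot /Rintegral; congr fine.
apply: ae_eq_integral => //.
- apply/measurable_EFinP; apply: measurable_funM.
    exact: Lfun2_measurable uU.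
  exact: Lfun2_measurable vU.
- apply/measurable_EFinP; apply: measurable_funM.
    exact: Lfun2_measurable u'U.
  exact: Lfun2_measurable vU.
- apply: filterS uu' => z /= zE _; congr EFin; congr (_ * _).
  by rewrite !patchE; case: ifPn => // /set_mem/zE.
Qed.

Section basis.
Variable phi : nat -> R * R -> R.
Hypothesis mD : measurable (D : set (measurableTypeR R * measurableTypeR R)).
Hypothesis phiU : forall i, inU D (phi i).
Hypothesis phi_on : forall i j, ip D (phi i) (phi j) = (i == j)%:R.

Definition comb n (c : nat -> R) := fun z => \sum_(i < n) c i * phi i z.

Lemma inU_comb n c : inU D (comb n c).
Proof. exact: inU_sum. Qed.

Lemma phi_on_patch i j : dot leb2 (phi i \_ D) (phi j \_ D) = (i == j)%:R.
Proof. by rewrite -ipE. Qed.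

Lemma normU_phi i : normU D (phi i) = 1.
Proof. by rewrite /normU phi_on eqxx sqrtr1. Qed.

Lemma ip_comb n c j : ip D (comb n c) (phi j) = if (j < n)%N then c j else 0.
Proof.
rewrite ipE patch_sumE.
exact: (dot_comb_basis phiU phi_on_patch).
Qed.

Lemma ip_comb_comb n c : ip D (comb n c) (comb n c) = \sum_(i < n) c i ^+ 2.
Proof. by rewrite ipE patch_sumE (dot_comb phiU phi_on_patch). Qed.

Lemma combB n m c z : (n <= m)%N ->
  comb m c z - comb n c z =
  comb m (fun i => if (n <= i)%N then c i else 0) z.
Proof.
move=> nm; rewrite /comb -(subnKC nm) !big_split_ord/= [in LHS]addrC addrK.
rewrite [X in X + _]big1 ?add0r; last first.
  by move=> i _; rewrite leqNgt ltn_ord mul0r.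
by apply: eq_bigr => i _; rewrite leq_addr.
Qed.

(** The squared distance of two partial sums is a block of the convergent series, so they form a
    Cauchy sequence. *)
Lemma comb_cvg c : (\sum_(0 <= i <oo) (c i ^+ 2)%:E < +oo)%E ->
  exists2 v, inU D v & normU D (comb n c \- v) @[n --> \oo] --> 0.
Proof.
move=> cfin.
have S0 i : (0 <= (c i ^+ 2)%:E :> \bar R)%E by rewrite lee_fin sqr_ge0.
pose S := (\sum_(0 <= i <oo) (c i ^+ 2)%:E)%E.
have Sfin : S \is a fin_num by rewrite ge0_fin_numE// nneseries_ge0.
have cS : (fun n => \sum_(0 <= i < n) c i ^+ 2) @ \oo --> fine S.
  have := @is_cvg_nneseries R (fun i => (c i ^+ 2)%:E) xpredT 0%N
    (fun _ _ _ => S0 _).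
  rewrite -/S -[X in _ --> X](fineK Sfin) => /fine_cvg.
  by under eq_fun do rewrite sumEFin.
have tail n m : (n <= m)%N ->
    ip D (comb m c \- comb n c) (comb m c \- comb n c) =
    (\sum_(0 <= i < m) c i ^+ 2) - \sum_(0 <= i < n) c i ^+ 2.
  move=> nm.
  have -> : comb m c \- comb n c = comb m (fun i => if (n <= i)%N then c i else 0).
    by apply/funext => z /=; rewrite combB.
  rewrite ip_comb_comb [in RHS](big_cat_nat (leq0n n) nm)//= [RHS]addrC addKr.
  rewrite -(big_mkord xpredT (fun i => (if (n <= i)%N then c i else 0) ^+ 2)).
  rewrite (big_cat_nat (leq0n n) nm)//= [X in X + _]big_nat big1 ?add0r; last first.
    by move=> i /andP[_ iN]; rewrite leqNgt iN expr0n.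
  by rewrite !big_nat; apply: eq_bigr => i /andP[-> _].
have [g gL gcvg] : exists2 g, g \in Lfun leb2 2%:E &
    dot leb2 ((comb n c) \_ D \- g) ((comb n c) \_ D \- g) @[n --> \oo] --> 0.
  apply: L2_complete => [n|e e0]; first exact: inU_comb.
  have /cvgrPdist_le/(_ (e / 2)) := cS.
  rewrite divr_gt0// => /(_ isT)[N _ NP]; exists N.
  have main n m : (n <= m)%N -> (N <= n)%N ->
      dot leb2 ((comb n c) \_ D \- (comb m c) \_ D)
               ((comb n c) \_ D \- (comb m c) \_ D) <= e.
    move=> nm Nn.
    rewrite -patchB -ipE -normU_sqr normUBC normU_sqr tail//.
    have h1 := NP _ Nn; have h2 := NP _ (leq_trans Nn nm).
    move: h1 h2; rewrite /= !ler_norml => /andP[h1 h2] /andP[h3 h4].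
    lra.
  move=> n m Nn Nm; have [nm|/ltnW mn] := leqP n m; first exact: main.
  rewrite (_ : dot _ _ _ = dot leb2 ((comb m c) \_ D \- (comb n c) \_ D)
               ((comb m c) \_ D \- (comb n c) \_ D)); first exact: main.
  by apply: eq_Rintegral => z _ /=; rewrite -[LHS]mulrNN !opprB.
move: (g : R * R -> R) gL gcvg => {}g gL gcvg.
have gD : (g \_ D) \_ D = g \_ D by apply/funext => z; rewrite !patchE; case: ifP => // ->.
have gDL : (g \_ D) \in Lfun leb2 2%:E.
  apply: (Lfun2_le _ gL).
    apply/(measurable_restrictT _ mD); apply: measurable_funTS.
    exact: Lfun2_measurable gL.
  by move=> z; rewrite patchE; case: ifP => // _; rewrite normr0.
(* The limit lives on the plane. Cutting it off outside [D] does not increase its distance to the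
   combinations, which are extended by zero. *)
exists (g \_ D); first by rewrite /inU gD.
apply/cvgrPdist_le => e e0.
have /cvgrPdist_le/(_ (e ^+ 2)) := gcvg; rewrite exprn_gt0// => /(_ isT).
apply: filterS => n; rewrite !sub0r !normrN !ger0_norm ?dot_ge0 ?normU_ge0//.
move=> he; rewrite -ler_sqr ?nnegrE ?normU_ge0 ?(ltW e0)//.
apply: le_trans he; rewrite normU_sqr ipE patchB gD; apply: dot_self_le.
- exact: (Lfun2B (inU_comb n c) gL).
- exact: (Lfun2B (inU_comb n c) gDL).
- move=> z /=; rewrite !patchE; case: ifP => // _.
  by rewrite subr0 normr0.
Qed.

Lemma comb_cvg_ip c v : inU D v ->
  normU D (comb n c \- v) @[n --> \oo] --> 0 ->
  (\sum_(0 <= i <oo) (c i ^+ 2)%:E)%E = (ip D v v)%:E.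
Proof.
move=> vU cv.
have cN : normU D (comb n c) @[n --> \oo] --> normU D v.
  apply/cvgrPdist_le => e e0; have /cvgrPdist_le/(_ _ e0) := cv.
  apply: filterS => n; rewrite sub0r normrN ger0_norm ?normU_ge0//.
  by apply: le_trans; rewrite distrC ler_dist_normU// inU_comb.
have : (\sum_(0 <= i < n) (c i ^+ 2)%:E)%E @[n --> \oo] --> (ip D v v)%:E.
  apply: cvg_EFin; first by apply: nearW => n; rewrite sumEFin.
  rewrite -normU_sqr expr2; under eq_fun => n.
    rewrite /= sumEFin big_mkord -ip_comb_comb -normU_sqr expr2; over.
  exact: cvgM.
by move/cvg_lim => ->.
Qed.

End basis.
End L2_of_domain_theory.

(** * Norms of powers of the Laplacian in coordinates *)

Section eigenbasis.
Context {R : realType}.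
Variables (D : set (R * R)) (lam : nat -> R) (phi : nat -> R * R -> R).
Hypothesis mD : measurable (D : set (measurableTypeR R * measurableTypeR R)).
Hypothesis hphi : dirichlet_eigenbasis D lam phi.
Implicit Types u v : R * R -> R.

Lemma phiU i : inU D (phi i).
Proof. by have [g1 [g2 [[]]]] := eigen_pair hphi i. Qed.

Lemma phi_on i j : ip D (phi i) (phi j) = (i == j)%:R.
Proof. exact: eigen_orthonormal hphi i j. Qed.

Lemma lam_gt0 i : 0 < lam i.
Proof.
by elim: i => [|i IH]; [exact: eigen_gt0 hphi|
  exact: lt_le_trans IH (eigen_nondecreasing hphi i)].
Qed.

Lemma lam_le i j : (i <= j)%N -> lam i <= lam j.
Proof.
move=> /subnKC <-; elim: (j - i)%N => [|k IH]; first by rewrite addn0.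
by rewrite addnS (le_trans IH)// (eigen_nondecreasing hphi).
Qed.

Lemma comb_proj_cvg u : inU D u ->
  normU D (comb phi n (fun i => ip D u (phi i)) \- u) @[n --> \oo] --> 0.
Proof.
move=> uU; have := eigen_complete hphi uU.
by under eq_fun do rewrite normUBC.
Qed.

Lemma parseval u : inU D u ->
  (\sum_(0 <= i <oo) (ip D u (phi i) ^+ 2)%:E)%E = (ip D u u)%:E.
Proof. by move=> uU; apply: comb_cvg_ip (comb_proj_cvg uU); [exact: phiU|exact: phi_on|]. Qed.

Lemma powR_sqr_half (x nu : R) : (x `^ (nu / 2)) ^+ 2 = x `^ nu.
Proof.
rewrite -powR_mulrn ?powR_ge0// -powRrM; congr (_ `^ _).
by rewrite divfK// pnatr_eq0.
Qed.

Lemma is_Apow_half_norm nu u v : is_Apow D lam phi (nu / 2) u v ->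
  (normU D v ^+ 2)%:E =
  (\sum_(0 <= i <oo) (lam i `^ nu * ip D u (phi i) ^+ 2)%:E)%E.
Proof.
move=> [vU cv]; rewrite normU_sqr -(comb_cvg_ip phiU phi_on vU
  (c := fun i => lam i `^ (nu / 2) * ip D u (phi i)) cv).
by under [in RHS]eq_eseriesr do rewrite -powR_sqr_half -exprMn.
Qed.

Lemma is_Apow_half nu u : dotU D lam phi nu u ->
  is_Apow D lam phi (nu / 2) u (Apow D lam phi (nu / 2) u).
Proof.
move=> [uU ufin].
suff [v hv] : exists v, is_Apow D lam phi (nu / 2) u v.
  by apply: xgetPex; exists v.
have [|v vU cv] := @comb_cvg _ D phi mD phiU phi_on
  (fun i => lam i `^ (nu / 2) * ip D u (phi i)).
  by under eq_eseriesr do rewrite exprMn powR_sqr_half.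
by exists v.
Qed.

Lemma Apow_half_norm nu u : dotU D lam phi nu u ->
  (normU D (Apow D lam phi (nu / 2) u) ^+ 2)%:E =
  (\sum_(0 <= i <oo) (lam i `^ nu * ip D u (phi i) ^+ 2)%:E)%E.
Proof. by move=> /is_Apow_half/is_Apow_half_norm. Qed.

(** Outside the domain of the power both sides are +oo, so the identity needs no regularity of
    [u]. *)
Lemma dotnorm_sqr nu u : inU D u ->
  (dotnorm D lam phi nu u `^ 2)%E =
  (\sum_(0 <= i <oo) (lam i `^ nu * ip D u (phi i) ^+ 2)%:E)%E.
Proof.
move=> uU; rewrite /dotnorm; case: asboolP => [h|nh].
  by rewrite poweR_EFin powR_mulrn ?normU_ge0// Apow_half_norm.
rewrite poweRyr ?pnatr_eq0//; apply/esym/eqP; rewrite -leye_eq leNgt.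
by apply/negP => h; apply: nh.
Qed.

Lemma dotU_finite nu u N : inU D u ->
  (forall i, (N <= i)%N -> ip D u (phi i) = 0) -> dotU D lam phi nu u.
Proof.
move=> uU u0; split => //.
rewrite (nneseries_split 0 N); last by move=> k _; rewrite lee_fin mulr_ge0 ?powR_ge0 ?sqr_ge0.
rewrite [X in (_ + X)%E]eseries0 ?adde0.
  by rewrite sumEFin ltry.
by move=> i Ni _; rewrite add0n in Ni; rewrite u0// expr0n mulr0.
Qed.

Lemma sum_finite nu u N :
  (forall i, (N <= i)%N -> ip D u (phi i) = 0) ->
  (\sum_(0 <= i <oo) (lam i `^ nu * ip D u (phi i) ^+ 2)%:E)%E =
  (\sum_(i < N) lam i `^ nu * ip D u (phi i) ^+ 2)%:E.
Proof.
move=> u0.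
rewrite (nneseries_split 0 N); last by move=> k _; rewrite lee_fin mulr_ge0 ?powR_ge0 ?sqr_ge0.
rewrite [X in (_ + X)%E]eseries0 ?adde0.
  by rewrite add0n big_mkord sumEFin.
by move=> i Ni _; rewrite add0n in Ni; rewrite u0// expr0n mulr0.
Qed.

(** This turns the norm in the theorem into a finite weighted sum of squared coordinates. *)
Lemma ApowN_norm N nu v : inU D v ->
  normU D (ApowN D lam phi N (nu / 2) v) ^+ 2 =
  \sum_(i < N) lam i `^ nu * ip D v (phi i) ^+ 2.
Proof.
move=> vU; rewrite /ApowN.
have PU : inU D (PN D phi N v).
  exact: (inU_comb phiU N (fun i => ip D v (phi i))).
have Pc i : ip D (PN D phi N v) (phi i) = if (i < N)%N then ip D v (phi i) else 0.
  exact: (ip_comb phiU phi_on N (fun i => ip D v (phi i))).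
have P0 i : (N <= i)%N -> ip D (PN D phi N v) (phi i) = 0.
  by move=> Ni; rewrite Pc ltnNge Ni.
apply: EFin_inj; rewrite Apow_half_norm; last exact: dotU_finite P0.
rewrite (sum_finite _ P0); congr EFin; apply: eq_bigr => i _.
by rewrite Pc ltn_ord.
Qed.

End eigenbasis.

(** * Lower bound for the eigenvalues *)

Section plane_measurability.
Context {R : realType}.

(** The product sigma-algebra is generated by rectangles, and an open set is the countable union of
    the boxes with rational corners that it contains. *)
Lemma open_measurable_plane (U : set (R * R)) : open U ->
  measurable (U : set (measurableTypeR R * measurableTypeR R)).
Proof.
move=> oU.
pose box (p : (rat * rat) * (rat * rat)) : set (R * R) :=
  `]ratr p.1.1, ratr p.1.2[%classic `*` `]ratr p.2.1, ratr p.2.2[%classic.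
have -> : U = \bigcup_(p in [set p | box p `<=` U]) box p.
  apply/seteqP; split => [[x y] Uxy|z [p pU pz]]; last exact: pU.
  have := open_nbhs_nbhs (conj oU Uxy).
  move=> [[A B] [/= nA nB] AB].
  have [e1 /= e10 e1A] := nA; have [e2 /= e20 e2B] := nB.
  have ltx : x - e1 < x by rewrite ltrBlDr ltrDl.
  have ltx' : x < x + e1 by rewrite ltrDl.
  have lty : y - e2 < y by rewrite ltrBlDr ltrDl.
  have lty' : y < y + e2 by rewrite ltrDl.
  have [a1 /itvP a1P] := rat_in_itvoo ltx.
  have [b1 /itvP b1P] := rat_in_itvoo ltx'.
  have [a2 /itvP a2P] := rat_in_itvoo lty.
  have [b2 /itvP b2P] := rat_in_itvoo lty'.
  exists ((a1, b1), (a2, b2)); last first.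
    by split => /=; rewrite in_itv/= ?a1P ?b1P ?a2P ?b2P.
  move=> [x' y'] [/= /itvP x'P /itvP y'P]; apply: AB; split => /=.
    apply: e1A; rewrite /ball/= ltr_distlC.
    rewrite (lt_trans _ (_ : ratr a1 < x')) ?a1P ?x'P//=.
    by rewrite (lt_trans (_ : x' < ratr b1)) ?b1P ?x'P.
  apply: e2B; rewrite /ball/= ltr_distlC.
  rewrite (lt_trans _ (_ : ratr a2 < y')) ?a2P ?y'P//=.
  by rewrite (lt_trans (_ : y' < ratr b2)) ?b2P ?y'P.
rewrite bigcup_mkcond; apply: countable_bigcupT_measurable => //.
move=> p; case: ifP => // _; apply: measurableX; exact: measurable_itv.
Qed.

Lemma continuous_measurable_plane (f : R * R -> R) : continuous f ->
  measurable_fun setT (f : measurableTypeR R * measurableTypeR R -> R).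
Proof.
move=> /continuousP cf; apply: (measurability _ (RGenOInfty.measurableE R)).
move=> /= _ [_ [a ->]] <-; apply: measurableI => //.
by apply: open_measurable_plane; apply: cf; exact: interval_open.
Qed.

End plane_measurability.

(** * Poincare's inequality on a square *)

Section poincare.
Context {R : realType}.
Local Notation leb := (@lebesgue_measure R).
Local Notation leb2 := (lebesgue2 R).

(** Expand the integral of (g - m)^2, which is nonnegative, with [m] the mean of [g]. *)
Lemma sqr_integral_le (g : R -> R) (a b : R) : a < b -> continuous g ->
  (((\int[leb]_(s in `[a, b]) g s) ^+ 2)%:E <=
    (b - a)%:E * \int[leb]_(s in `[a, b]) (g s ^+ 2)%:E)%E.
Proof.
move=> ab cg.
have int (f : R -> R) : continuous f -> leb.-integrable `[a, b] (EFin \o f).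
  move=> cf; apply: continuous_compact_integrable; first exact: segment_compact.
  exact: continuous_subspaceT.
have cg2 : continuous (fun s => g s ^+ 2).
  by move=> s; apply: cvgM; exact: cg.
have ba : 0 < b - a by rewrite subr_gt0.
set I := Rintegral _ _ _; pose m := I / (b - a).
have lab : leb `[a, b] = (b - a)%:E.
  by rewrite lebesgue_measure_itv/= lte_fin ab.
have h0 : 0 <= \int[leb]_(s in `[a, b]) ((g s ^+ 2 - 2 * m * g s) + m ^+ 2).
  apply: Rintegral_ge0 => s _.
  by rewrite (_ : _ + _ = (g s - m) ^+ 2) ?sqr_ge0//; ring.
have cmg : continuous (fun s => 2 * m * g s).
  by move=> s; apply: cvgM; [exact: cvg_cst|exact: cg].
have hm : \int[leb]_(s in `[a, b]) (m ^+ 2) = m ^+ 2 * (b - a).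
  by rewrite Rintegral_cst//; congr (_ * _); exact: (congr1 fine lab).
have hz : \int[leb]_(s in `[a, b]) (2 * m * g s) = 2 * m * I.
  by rewrite RintegralZl//; exact: int.
rewrite RintegralD ?RintegralB ?hz ?hm// in h0;
  try exact: int; last 2 first.
- by apply: int => s; apply: cvgB; [exact: cg2|exact: cmg].
- by apply: int => s; exact: cvg_cst.
rewrite -[X in (_ * X)%E]fineK ?integrable_fin_num//; last exact: int.
rewrite -EFinM lee_fin.
move: h0.
rewrite -[fine (integral _ _ _)]/(\int[leb]_(s in `[a, b]) (g s ^+ 2)).
set E := Rintegral _ _ _ => /= h0.
rewrite -subr_ge0 -(pmulr_lge0 _ (_ : 0 < (b - a)^-1)) ?invr_gt0//.
move: h0; congr (_ <= _); rewrite /m; field.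
by rewrite gt_eqF.
Qed.

(** Write the difference as the integral of the derivative and use Cauchy-Schwarz between the two
    points; enlarging the interval makes the bound independent of them. *)
Lemma oscillation_le (f f' : R -> R) (c h x x' : R) : 0 < h ->
  (forall z : R, is_derive z 1 f (f' z)) -> continuous f' ->
  x \in `[c, c + h[ -> x' \in `[c, c + h[ ->
  (((f x - f x') ^+ 2)%:E <= h%:E * \int[leb]_(s in `[c, (c + h)%R[) (f' s ^+ 2)%:E)%E.
Proof.
move=> h0 df cf'.
have df1 z : derivable f z 1 by have := df z => -[].
have cf z : f @ z --> f z.
  by apply: differentiable_continuous; exact/derivable1_diffP.
have mf' : measurable_fun setT (fun s => (f' s ^+ 2)%:E).
  by apply/measurable_EFinP; apply: measurable_funX; exact: continuous_measurable_fun.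
wlog xx' : x x' / x' <= x.
  move=> H; have [|/ltW] := leP x' x; first exact: H.
  by move=> xx' hx hx'; rewrite -opprB sqrrN; exact: H.
move: xx'; rewrite le_eqVlt => /predU1P[->|xx'] xI x'I.
  by rewrite subrr expr0n mule_ge0 ?lee_fin ?(ltW h0)// integral_ge0// => s _;
    rewrite lee_fin sqr_ge0.
have FTC : (\int[leb]_(s in `[x', x]) (f' s)%:E = (f x)%:E - (f x')%:E)%E.
  apply: continuous_FTC2 => //.
  - exact: continuous_subspaceT.
  - split => //.
    + by apply: cvg_at_right_filter; exact: cf.
    + by apply: cvg_at_left_filter; exact: cf.
  - by move=> z _; rewrite derive1E; have := df z => -[].
have := sqr_integral_le xx' cf'; rewrite {1}/Rintegral FTC/= => /le_trans; apply.
apply: (@le_trans _ _ (h%:E * \int[leb]_(s in `[x', x]) (f' s ^+ 2)%:E)%E).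
  apply: lee_wpmul2r.
    by apply: integral_ge0 => s _; rewrite lee_fin sqr_ge0.
  move: xI x'I; rewrite lee_fin !in_itv/= => /andP[_ x1] /andP[x2 _]; lra.
apply: lee_wpmul2l; first by rewrite lee_fin ltW.
apply: ge0_subset_integral => //.
- exact: measurable_funTS.
- by move=> s _; rewrite lee_fin sqr_ge0.
- move=> s /=; move: xI x'I; rewrite !in_itv/= => /andP[_ x1] /andP[x2 _] /andP[s1 s2].
  by apply/andP; split; [exact: le_trans s1|exact: le_lt_trans x1].
Qed.

(** Both orders are needed since the two partial derivatives are integrated along different axes. *)
Lemma tonelli_rectangle (I J : set R) (F : R * R -> \bar R) :
  measurable (I : set (measurableTypeR R)) ->
  measurable (J : set (measurableTypeR R)) ->
  measurable_fun setT (F : measurableTypeR R * measurableTypeR R -> \bar R) ->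
  (forall z, (0 <= F z)%E) ->
  (\int[leb2]_(z in I `*` J) F z = \int[leb]_(x in I) \int[leb]_(y in J) F (x, y))%E
  /\
  (\int[leb2]_(z in I `*` J) F z = \int[leb]_(y in J) \int[leb]_(x in I) F (x, y))%E.
Proof.
move=> mI mJ mF F0.
have mIJ : measurable (I `*` J : set (measurableTypeR R * measurableTypeR R)).
  exact: measurableX.
have mFp : measurable_fun setT
    (F \_ (I `*` J) : measurableTypeR R * measurableTypeR R -> \bar R).
  apply/(measurable_restrictT _ mIJ); exact: measurable_funTS.
have Fp0 z : (0 <= (F \_ (I `*` J)) z)%E by apply: erestrict_ge0.
rewrite integral_mkcond; split.
  transitivity (\int[leb]_x \int[leb]_y (F \_ (I `*` J)) (x, y))%E.
    exact: (fubini_tonelli1 _ mFp Fp0).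
  rewrite [RHS]integral_mkcond; apply: eq_integral => x _.
  rewrite patchE; case: ifPn => xI.
    rewrite [RHS]integral_mkcond; apply: eq_integral => y _.
    rewrite !patchE; congr (if _ then _ else _).
    by rewrite in_setX xI.
  rewrite -[RHS](integral0 leb setT); apply: eq_integral => y _.
  by rewrite patchE in_setX (negbTE xI).
transitivity (\int[leb]_y \int[leb]_x (F \_ (I `*` J)) (x, y))%E.
  exact: (fubini_tonelli2 _ mFp Fp0).
rewrite [RHS]integral_mkcond; apply: eq_integral => y _.
rewrite patchE; case: ifPn => yJ.
  rewrite [RHS]integral_mkcond; apply: eq_integral => x _.
  rewrite !patchE; congr (if _ then _ else _).
  by rewrite in_setX yJ andbT.
rewrite -[RHS](integral0 leb setT); apply: eq_integral => x _.
by rewrite patchE in_setX (negbTE yJ) andbF.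
Qed.

End poincare.

Section poincare_square.
Context {R : realType}.
Local Notation leb := (@lebesgue_measure R).
Local Notation leb2 := (lebesgue2 R).
Local Notation R2 := (measurableTypeR R * measurableTypeR R)%type.

Lemma continuous_line1 (f : R * R -> R) (y : R) : continuous f ->
  continuous (fun x : R => f (x, y)).
Proof.
move=> cf x.
apply: (@continuous_comp _ _ _ (fun x : R => (x, y)) f); last exact: cf.
exact: (@cvg_pair _ _ _ (nbhs x) _ _ _ _ _ (fun x : R => x) (fun=> y)
  cvg_id (cvg_cst y)).
Qed.

Lemma continuous_line2 (f : R * R -> R) (x : R) : continuous f ->
  continuous (fun y : R => f (x, y)).
Proof.
move=> cf y.
apply: (@continuous_comp _ _ _ (fun y : R => (x, y)) f); last exact: cf.
exact: (@cvg_pair _ _ _ (nbhs y) _ _ _ _ _ (fun=> x) (fun y : R => y)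
  (cvg_cst x) cvg_id).
Qed.

Lemma lebesgue_measure_co (c h : R) : 0 < h -> leb `[c, c + h[%classic = h%:E.
Proof.
move=> h0; rewrite lebesgue_measure_itv/= lte_fin ltrDl h0.
by rewrite -EFinD addrAC subrr add0r.
Qed.

Lemma lebesgue2_square (c d h : R) : 0 < h ->
  leb2 (`[c, c + h[%classic `*` `[d, d + h[%classic) = (h ^+ 2)%:E.
Proof.
move=> h0.
transitivity (leb `[c, (c + h)%R[%classic * leb `[d, (d + h)%R[%classic)%E.
  by apply: product_measure1E; exact: measurable_itv.
by rewrite !lebesgue_measure_co// -EFinM.
Qed.

Lemma continuous_square_Lfun2 (f : R * R -> R) (c d h : R) : 0 < h -> continuous f ->
  (f \_ (`[c, c + h[%classic `*` `[d, d + h[%classic)) \in Lfun leb2 2%:E.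
Proof.
move=> h0 cf; set Q := _ `*` _.
have mQ : measurable (Q : set R2) by apply: measurableX; exact: measurable_itv.
have [M MP] : exists M : R, forall z, Q z -> `|f z| <= M.
  have cQ : compact (`[c, c + h]%classic `*` `[d, d + h]%classic : set (R * R)).
    by apply: compact_setX; exact: segment_compact.
  have := @continuous_compact _ _ f _ (continuous_subspaceT cf) cQ.
  move=> /compact_bounded[M0 [_ /(_ (M0 + 1))]]; rewrite ltrDl ltr01 => /(_ isT) H.
  exists (M0 + 1) => -[x y] [/= xI yJ]; apply: H; exists (x, y) => //; split => /=.
    by move: xI; rewrite !in_itv/= => /andP[-> /ltW ->].
  by move: yJ; rewrite !in_itv/= => /andP[-> /ltW ->].
have mf : measurable_fun setT (f \_ Q : R2 -> R).
  by apply/(measurable_restrictT _ mQ); apply: measurable_funTS;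
    exact: continuous_measurable_plane.
apply/Lfun2P => //.
apply: (@le_lt_trans _ _ (\int[leb2]_(z in Q) (M ^+ 2)%:E)%E).
  rewrite [leRHS]integral_mkcond; apply: ge0_le_integral => //.
  - by move=> z _; rewrite lee_fin sqr_ge0.
  - by apply/measurable_EFinP; exact: measurable_funX.
  - by apply/(measurable_restrictT _ mQ).
  - move=> z _; rewrite !patchE; case: ifPn => [/set_mem/MP zM|_].
      rewrite lee_fin -[leLHS]real_normK ?num_real// ler_sqr ?nnegrE//.
      exact: le_trans zM.
    by rewrite expr0n.
rewrite integral_cst//= lte_mul_pinfty ?lee_fin ?sqr_ge0//.
by rewrite [X in (X < _)%E]lebesgue2_square// ltry.
Qed.

Variables (psi p1 p2 : R * R -> R).
Hypotheses (cpsi : continuous psi) (cp1 : continuous p1) (cp2 : continuous p2).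
Hypothesis d1 : forall x y : R, is_derive x 1 (fun s => psi (s, y)) (p1 (x, y)).
Hypothesis d2 : forall x y : R, is_derive y 1 (fun s => psi (x, s)) (p2 (x, y)).

(** Two points of the square are joined by a horizontal and then a vertical segment. Averaging over
    the second point compares psi with its mean, and the last term of the bound is the squared norm
    of that mean. *)
Lemma poincare_square (c d h : R) (Q := `[c, c + h[%classic `*` `[d, d + h[%classic) :
  0 < h ->
  dot leb2 (psi \_ Q) (psi \_ Q) <=
  2 * h ^+ 2 * (dot leb2 (p1 \_ Q) (p1 \_ Q) + dot leb2 (p2 \_ Q) (p2 \_ Q))
  + dot leb2 (psi \_ Q) (\1_Q) ^+ 2 / h ^+ 2.
Proof.
move=> h0; set I : set R := `[c, c + h[%classic in Q *.
set J : set R := `[d, d + h[%classic in Q *.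
have mI : measurable (I : set (measurableTypeR R)) by exact: measurable_itv.
have mJ : measurable (J : set (measurableTypeR R)) by exact: measurable_itv.
have mQ : measurable (Q : set R2) by exact: measurableX.
have h2E : (0 <= (2 * h)%:E)%E by rewrite lee_fin mulr_ge0 ?(ltW h0).
have lI : leb I = h%:E by exact: lebesgue_measure_co.
have lJ : leb J = h%:E by exact: lebesgue_measure_co.
have lQ : leb2 Q = (h ^+ 2)%:E by exact: lebesgue2_square.
have m1 : measurable_fun setT (fun z : R2 => (p1 z ^+ 2)%:E).
  by apply/measurable_EFinP; apply: measurable_funX; exact: continuous_measurable_plane.
have m2 : measurable_fun setT (fun z : R2 => (p2 z ^+ 2)%:E).
  by apply/measurable_EFinP; apply: measurable_funX; exact: continuous_measurable_plane.
have s0 (g : R * R -> R) z : (0 <= (g z ^+ 2)%:E)%E by rewrite lee_fin sqr_ge0.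
(* [A y] is the energy along the horizontal line at height y, [B x] that along the vertical line at
   abscissa x. *)
pose A (y : R) := (\int[leb]_(x in I) (p1 (x, y) ^+ 2)%:E)%E.
pose B (x : R) := (\int[leb]_(y in J) (p2 (x, y) ^+ 2)%:E)%E.
have A0 y : (0 <= A y)%E by apply: integral_ge0 => x _; rewrite lee_fin sqr_ge0.
have B0 y : (0 <= B y)%E by apply: integral_ge0 => x _; rewrite lee_fin sqr_ge0.
have mTI : measurable (setT `*` J : set R2) by exact: measurableX.
have mTJ : measurable (I `*` setT : set R2) by exact: measurableX.
have mA : measurable_fun setT (A : measurableTypeR R -> \bar R).
  pose F := (fun z : R2 => (p1 z ^+ 2)%:E) \_ (I `*` setT).
  have mF : measurable_fun setT F.
    by apply/(measurable_restrictT _ mTJ); exact: measurable_funTS.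
  have F0 z : (0 <= F z)%E by apply: erestrict_ge0 => ? _; exact: s0.
  rewrite (_ : A = fubini_G (@lebesgue_measure R) F).
    exact: measurable_fun_fubini_tonelli_G.
  apply/funext => y; rewrite /A integral_mkcond; apply: eq_integral => x _.
  by rewrite /F !patchE in_setX in_setT andbT.
have mB : measurable_fun setT (B : measurableTypeR R -> \bar R).
  pose F := (fun z : R2 => (p2 z ^+ 2)%:E) \_ (setT `*` J).
  have mF : measurable_fun setT F.
    by apply/(measurable_restrictT _ mTI); exact: measurable_funTS.
  have F0 z : (0 <= F z)%E by apply: erestrict_ge0 => ? _; exact: s0.
  rewrite (_ : B = fubini_F (@lebesgue_measure R) F).
    exact: measurable_fun_fubini_tonelli_F.
  apply/funext => y; rewrite /B integral_mkcond; apply: eq_integral => x _.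
  by rewrite /F !patchE in_setX in_setT.
have mA2 : measurable_fun setT (fun z : R2 => A z.2).
  exact: (measurableT_comp mA measurable_snd).
have mB1 : measurable_fun setT (fun z : R2 => B z.1).
  exact: (measurableT_comp mB measurable_fst).
have dotQ (g : R * R -> R) : continuous g ->
    (dot leb2 (g \_ Q) (g \_ Q))%:E = (\int[leb2]_(z in Q) (g z ^+ 2)%:E)%E.
  move=> cg; rewrite dot_sqr; last exact: continuous_square_Lfun2.
  rewrite [RHS]integral_mkcond; apply: eq_integral => z _.
  by rewrite !patchE; case: ifPn => // _; rewrite expr0n.
have intA : (\int[leb2]_(z in Q) A z.2 = h%:E * (dot leb2 (p1 \_ Q) (p1 \_ Q))%:E)%E.
  rewrite dotQ// (tonelli_rectangle mI mJ m1 (s0 p1)).2.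
  rewrite (tonelli_rectangle mI mJ mA2 (fun z => A0 z.2)).2.
  transitivity (\int[leb]_(y in J) (h%:E * A y))%E.
    apply: eq_integral => y _; transitivity (\int[leb]_(x in I) cst (A y) x)%E => //.
    by rewrite integral_cst// [X in (_ * X)%E]lI muleC.
  rewrite ge0_integralZl ?lee_fin ?(ltW h0)//.
  exact: measurable_funS mA.
have intB : (\int[leb2]_(z in Q) B z.1 = h%:E * (dot leb2 (p2 \_ Q) (p2 \_ Q))%:E)%E.
  rewrite dotQ// (tonelli_rectangle mI mJ m2 (s0 p2)).1.
  rewrite (tonelli_rectangle mI mJ mB1 (fun z => B0 z.1)).1.
  transitivity (\int[leb]_(y in I) (h%:E * B y))%E.
    apply: eq_integral => y _; transitivity (\int[leb]_(x in J) cst (B y) x)%E => //.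
    by rewrite integral_cst// [X in (_ * X)%E]lJ muleC.
  rewrite ge0_integralZl ?lee_fin ?(ltW h0)//.
  exact: measurable_funS mB.
have c1 y := @continuous_line1 p1 y cp1.
have c2 x := @continuous_line2 p2 x cp2.
have osc z z' : Q z -> Q z' ->
    (((psi z - psi z') ^+ 2)%:E <= (2 * h)%:E * A z.2 + (2 * h)%:E * B z'.1)%E.
  case: z => x y; case: z' => x' y' [/= zI zJ] [/= zI' zJ'].
  have h1 := oscillation_le h0 (fun x => d1 x y) (c1 y) zI zI'.
  have h2 := oscillation_le h0 (fun y => d2 x' y) (c2 x') zJ zJ'.
  rewrite (EFinM 2) -!muleA.
  apply: (@le_trans _ _ (2%:E * ((psi (x, y) - psi (x', y)) ^+ 2)%:E +
                         2%:E * ((psi (x', y) - psi (x', y')) ^+ 2)%:E)%E).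
    rewrite -!EFinM -EFinD lee_fin.
    have := sqr_ge0 ((psi (x, y) - psi (x', y)) - (psi (x', y) - psi (x', y'))).
    nra.
  by apply: leeD; apply: lee_wpmul2l.
have oneE : (\1_Q : R * R -> R) = (cst (1 : R)) \_ Q.
  by apply/funext => z; rewrite patchE indicE; case: (z \in Q).
have L1 : (\1_Q : R * R -> R) \in Lfun leb2 2%:E.
  by rewrite oneE; apply: continuous_square_Lfun2 => // z; exact: cvg_cst.
have Lp : psi \_ Q \in Lfun leb2 2%:E by exact: continuous_square_Lfun2.
have d11 : dot leb2 (\1_Q) (\1_Q) = h ^+ 2.
  apply: EFin_inj; rewrite oneE dotQ; last by move=> z; exact: cvg_cst.
  under eq_integral do rewrite expr1n.
  by rewrite integral_cst// [X in (_ * X)%E]lQ mul1e.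
set K := dot leb2 (psi \_ Q) (\1_Q); set S := dot leb2 (psi \_ Q) (psi \_ Q).
set P1 := dot leb2 (p1 \_ Q) _ in intA *; set P2 := dot leb2 (p2 \_ Q) _ in intB *.
have h3 : (0 <= (h ^+ 2)%:E)%E by rewrite lee_fin sqr_ge0.
(* h^2 psi(z) - K is the integral of psi(z) - psi(z') over z' in the square; Cauchy-Schwarz against
   the indicator and [osc] bound its square. *)
have main1 z : Q z -> (((h ^+ 2 * psi z - K) ^+ 2)%:E <=
    (h ^+ 2)%:E * ((2 * h * h ^+ 2)%:E * A z.2 + (2 * h * (h * P2))%:E))%E.
  move=> zQ; pose u := (fun z' => psi z * (\1_Q : R * R -> R) z') \- (psi \_ Q).
  have Lu : u \in Lfun leb2 2%:E by apply: Lfun2B => //; exact: Lfun2Z.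
  have uE : dot leb2 u (\1_Q) = h ^+ 2 * psi z - K.
    by rewrite dotBl ?Lfun2Z// dotZl// d11 mulrC.
  have := dot_cauchy_schwarz Lu L1; rewrite uE d11 -lee_fin => /le_trans; apply.
  rewrite (mulrC (dot leb2 u u)) EFinM; apply: lee_wpmul2l => //.
  rewrite dot_sqr//.
  apply: (@le_trans _ _ (\int[leb2]_(z' in Q)
      ((2 * h)%:E * A z.2 + (2 * h)%:E * B z'.1))%E).
    rewrite [leRHS]integral_mkcond; apply: ge0_le_integral => //.
    - apply/measurable_EFinP; apply: measurable_funX; exact: Lfun2_measurable Lu.
    - apply/(measurable_restrictT _ mQ); apply: measurable_funTS.
      apply: emeasurable_funD; first exact: measurable_cst.
      exact: measurable_funeM.
    - move=> z' _; rewrite patchE /u/= !patchE indicE; case: ifPn => z'Q.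
        by rewrite mulr1; apply: osc => //; exact: set_mem.
      by rewrite mulr0 subrr expr0n.
  rewrite ge0_integralD//; last 3 first.
  - by move=> z' _; exact: mule_ge0.
  - by move=> z' _; exact: mule_ge0.
  - by apply: measurable_funTS; exact: measurable_funeM.
  rewrite (integral_cst _ mQ) [X in (_ * X)%E]lQ.
  rewrite ge0_integralZl//; last exact: measurable_funS mB1.
  by rewrite intB -!EFinM muleAC -EFinM.
have h40 : 0 < h ^+ 4 by exact: exprn_gt0.
(* Integrate [main1] over z. The cross term and the constant term combine because the square has
   area h^2, leaving h^4 S - h^2 K^2. *)
have main2 : (h ^+ 4 * S - h ^+ 2 * K ^+ 2 <= 2 * h ^+ 6 * (P1 + P2)).
  pose v := (fun z => h ^+ 2 * (psi \_ Q) z) \- (fun z => K * (\1_Q : R * R -> R) z).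
  have Lv : v \in Lfun leb2 2%:E by apply: Lfun2B; exact: Lfun2Z.
  have <- : dot leb2 v v = h ^+ 4 * S - h ^+ 2 * K ^+ 2.
    rewrite dotBB ?Lfun2Z// !dotZl ?Lfun2Z// !dotZr// d11 -/K -/S; ring.
  rewrite -lee_fin dot_sqr//.
  apply: (@le_trans _ _ (\int[leb2]_(z in Q)
    ((h ^+ 2)%:E * ((2 * h * h ^+ 2)%:E * A z.2 + (2 * h * (h * P2))%:E)))%E).
    rewrite [leRHS]integral_mkcond; apply: ge0_le_integral => //.
    - apply/measurable_EFinP; apply: measurable_funX; exact: Lfun2_measurable Lv.
    - apply/(measurable_restrictT _ mQ); apply: measurable_funTS.
      apply: measurable_funeM; apply: emeasurable_funD; last exact: measurable_cst.
      exact: measurable_funeM.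
    - move=> z' _; rewrite patchE /v/= !patchE indicE; case: ifPn => z'Q.
        by rewrite mulr1; apply: main1; exact: set_mem.
      by rewrite !mulr0 subrr expr0n.
  have P20 : 0 <= 2 * h * (h * P2).
    by rewrite !mulr_ge0 ?dot_ge0 ?(ltW h0).
  have hh0 : 0 <= 2 * h * h ^+ 2 by rewrite !mulr_ge0 ?sqr_ge0 ?(ltW h0).
  rewrite ge0_integralZl//; last 2 first.
  - apply: measurable_funTS; apply: emeasurable_funD; last exact: measurable_cst.
    exact: measurable_funeM.
  - by move=> z _; rewrite adde_ge0 ?mule_ge0 ?lee_fin.
  rewrite ge0_integralD//; last 2 first.
  - by move=> z' _; rewrite mule_ge0 ?lee_fin.
  - by apply: measurable_funTS; exact: measurable_funeM.
  rewrite (integral_cst _ mQ) [X in (_ + _ * X)%E]lQ ge0_integralZl ?lee_fin//; last first.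
    exact: measurable_funS mA2.
  rewrite intA -!EFinM lee_fin le_eqVlt; apply/orP; left.
  by apply/eqP; ring.
rewrite -lerBlDr -(ler_pM2l h40).
move: main2; congr (_ <= _); last by ring.
by field; rewrite gt_eqF.
Qed.

End poincare_square.

(** * Cutting a box into squares *)

Section tiling.
Context {R : realType}.
Local Notation leb2 := (lebesgue2 R).
Local Notation R2 := (measurableTypeR R * measurableTypeR R)%type.

Lemma sum_indic_itv (a h : R) n (x : R) : 0 <= h ->
  \sum_(j < n) \1_(`[a + j%:R * h, a + j%:R * h + h[) x
  = \1_(`[a, a + n%:R * h[) x :> R.
Proof.
move=> h0; elim: n => [|n IH].
  rewrite big_ord0 indicE mul0r addr0.
  by rewrite (_ : `[a, a[%classic = set0) ?in_set0// set_itv_ge// bnd_simp ltxx.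
rewrite big_ord_recr/= IH !indicE !mem_setE !in_itv/=.
have ah : a <= a + n%:R * h by rewrite lerDl mulr_ge0.
have -> : a + n.+1%:R * h = a + n%:R * h + h.
  by rewrite -[n.+1]addn1 natrD mulrDl mul1r addrA.
have [xa|ax] := ltP x a.
  by rewrite (lt_geF (lt_le_trans xa ah)) addr0.
have [xn|nx] := ltP x (a + n%:R * h); rewrite ?addr0 ?add0r//.
by rewrite (lt_le_trans xn) ?lerDl.
Qed.

Definition tile (L h : R) (j k : nat) : set (R * R) :=
  `[- L + j%:R * h, - L + j%:R * h + h[%classic `*`
  `[- L + k%:R * h, - L + k%:R * h + h[%classic.

Lemma measurable_tile L h j k : measurable (tile L h j k : set R2).
Proof. by apply: measurableX; exact: measurable_itv. Qed.

Lemma tile_cst L h j k :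
  (\1_(tile L h j k) : R * R -> R) = (cst (1 : R)) \_ (tile L h j k).
Proof. by apply/funext => z; rewrite patchE indicE; case: (_ \in _). Qed.

Lemma Lfun2_tile L h j k : 0 < h ->
  (\1_(tile L h j k) : R * R -> R) \in Lfun leb2 2%:E.
Proof.
by move=> h0; rewrite tile_cst; apply: continuous_square_Lfun2 => // z; exact: cvg_cst.
Qed.

Lemma dot_tile L h j k : 0 < h ->
  dot leb2 (\1_(tile L h j k)) (\1_(tile L h j k)) = h ^+ 2.
Proof.
move=> h0; apply: EFin_inj; rewrite dot_sqr ?Lfun2_tile//.
have E z : (\1_(tile L h j k) z) ^+ 2 = \1_(tile L h j k) z :> R.
  by rewrite indicE; case: (_ \in _); rewrite ?expr1n ?expr0n.
under eq_integral do rewrite E.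
by rewrite integral_indic ?setIT//; [exact: lebesgue2_square|exact: measurable_tile].
Qed.

Lemma Lfun2_restrict (A : set R2) (f : R2 -> R) : measurable A ->
  f \in Lfun leb2 2%:E -> f \_ A \in Lfun leb2 2%:E.
Proof.
move=> mA lf; apply: (Lfun2_le _ lf).
  by apply/(measurable_restrictT _ mA); apply: measurable_funTS; exact: Lfun2_measurable lf.
by move=> z; rewrite patchE; case: ifP => // _; rewrite normr0.
Qed.

(** Half-open tiles are disjoint and cover the half-open box, so [f] is the sum of its restrictions
    at every point. *)
Lemma dot_tiles (L h : R) n (f : R * R -> R) : 0 <= h -> - L + n%:R * h = L ->
  f \in Lfun leb2 2%:E ->
  (forall z, f z != 0 -> (`[- L, L[%classic `*` `[- L, L[%classic) z) ->
  dot leb2 f f =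
  \sum_(j < n) \sum_(k < n) dot leb2 (f \_ (tile L h j k)) (f \_ (tile L h j k)).
Proof.
move=> h0 nh lf f0.
have lt j k : f \_ (tile L h j k) \in Lfun leb2 2%:E.
  exact: (Lfun2_restrict (measurable_tile L h j k) lf).
pose E j : R * R -> R := fun z => \sum_(k < n) 1 * (f \_ (tile L h j k)) z.
have fE : f = (fun z => \sum_(j < n) 1 * E j z).
  apply/funext => z /=.
  have [fz0|fz] := eqVneq (f z) 0.
    rewrite fz0 big1// => j _; rewrite mul1r /E big1// => k _.
    by rewrite mul1r patchE fz0; case: ifP.
  have [/= z1 z2] := f0 _ fz.
  have Ez : f z = f z * (\sum_(j < n) \1_(`[- L + j%:R * h, - L + j%:R * h + h[) z.1)
      * (\sum_(k < n) \1_(`[- L + k%:R * h, - L + k%:R * h + h[) z.2).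
    rewrite !sum_indic_itv// nh !indicE !mem_set//= ?mulr1//.
  rewrite [LHS]Ez -mulrA mulr_suml mulr_sumr; apply: eq_bigr => j _.
  rewrite mul1r /E !mulr_sumr; apply: eq_bigr => k _.
  rewrite mul1r patchE /tile in_setX !indicE.
  by case: (_ \in _); case: (_ \in _); rewrite ?mulr1 ?mulr0 ?mul0r.
rewrite {1}fE (@dot_suml _ _ _ leb2 n (fun=> 1) E)//; last first.
  move=> j _; apply: (@Lfun2_sum _ _ _ leb2 n (fun=> 1) (fun k => f \_ (tile L h j k))).
  by move=> k _; exact: lt.
apply: eq_bigr => j _; rewrite mul1r.
rewrite (@dot_suml _ _ _ leb2 n (fun=> 1) (fun k => f \_ (tile L h j k)))//.
apply: eq_bigr => k _; rewrite mul1r; apply: eq_Rintegral => z _.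
by rewrite !patchE; case: ifP => // _; rewrite !mul0r.
Qed.

Lemma poincare_tiles (L h : R) n (psi p1 p2 : R * R -> R) :
  0 < h -> - L + n%:R * h = L ->
  continuous psi -> continuous p1 -> continuous p2 ->
  (forall x y : R, is_derive x 1 (fun s => psi (s, y)) (p1 (x, y))) ->
  (forall x y : R, is_derive y 1 (fun s => psi (x, s)) (p2 (x, y))) ->
  psi \in Lfun leb2 2%:E -> p1 \in Lfun leb2 2%:E -> p2 \in Lfun leb2 2%:E ->
  (forall z, psi z != 0 -> (`[- L, L[%classic `*` `[- L, L[%classic) z) ->
  (forall z, p1 z != 0 -> (`[- L, L[%classic `*` `[- L, L[%classic) z) ->
  (forall z, p2 z != 0 -> (`[- L, L[%classic `*` `[- L, L[%classic) z) ->
  dot leb2 psi psi <= 2 * h ^+ 2 * (dot leb2 p1 p1 + dot leb2 p2 p2) +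
    \sum_(j < n) \sum_(k < n) dot leb2 psi (\1_(tile L h j k)) ^+ 2 / h ^+ 2.
Proof.
move=> h0 nh cpsi cp1 cp2 d1 d2 lpsi lp1 lp2 psi0 p10 p20.
rewrite (dot_tiles (ltW h0) nh lpsi psi0) (dot_tiles (ltW h0) nh lp1 p10).
rewrite (dot_tiles (ltW h0) nh lp2 p20) -big_split/= mulr_sumr -big_split/=.
apply: ler_sum => j _; rewrite -big_split/= mulr_sumr -big_split/=.
apply: ler_sum => k _.
have := poincare_square cpsi cp1 cp2 d1 d2 (- L + j%:R * h) (- L + k%:R * h) h0.
rewrite -/(tile L h j k) => /le_trans; apply.
rewrite lerD2l le_eqVlt; apply/orP; left; apply/eqP; congr (_ ^+ 2 / _).
apply: eq_Rintegral => z _; rewrite patchE indicE.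
by case: (_ \in _) => //; rewrite !mulr0.
Qed.

End tiling.

(** * Test functions and their partial derivatives *)

Section test_functions.
Context {R : realType}.
Local Notation leb2 := (lebesgue2 R).
Local Notation R2 := (measurableTypeR R * measurableTypeR R)%type.
Variable D : set (R * R).
Hypothesis bD : bounded_set D.

Lemma bounded_domain_box : exists2 L : R, 0 < L &
  forall z, D z -> (`[- L, L[%classic `*` `[- L, L[%classic) z.
Proof.
(* The bound is available strictly above M, whence |M| + 1; the further 1 makes the open right end
   strict. *)
have [M [_ MP]] := bD; exists (`|M| + 2); first by rewrite ltr_wpDl.
move=> z Dz; have := MP (`|M| + 1); rewrite (le_lt_trans (ler_norm M)) ?ltrDl//.
move=> /(_ isT z Dz) zM.
have [z1 z2] : `|z.1| <= `|M| + 1 /\ `|z.2| <= `|M| + 1.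
  by move: zM; rewrite /= prod_normE ge_max => /andP[].
split; rewrite /= in_itv/=.
  by move: z1; rewrite ler_norml => /andP[? ?]; apply/andP; split; lra.
by move: z2; rewrite ler_norml => /andP[? ?]; apply/andP; split; lra.
Qed.

(** The difference quotient in the direction (1, 0) is literally that of the restriction to a
    horizontal line. *)
Lemma partial1_is_derive (psi : R * R -> R) (x y : R) :
  derivable psi (x, y) ((1, 0) : R * R) ->
  is_derive x 1 (fun s => psi (s, y)) (partial1 psi (x, y)).
Proof.
have E (h : R) : h *: ((1, 0) : R * R) + (x, y) = (h + x, y).
  by rewrite -[LHS]/(h * 1 + x, h * 0 + y) mulr1 mulr0 add0r.
have FG : (fun h : R => h^-1 *: ((psi \o shift (x, y)) (h *: ((1, 0) : R * R)) - psi (x, y)))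
    = (fun h : R => h^-1 *: (((fun s => psi (s, y)) \o shift x) (h *: (1 : R)) - psi (x, y))).
  have E1 (h : R) : h *: (1 : R) = h by exact: mulr1.
  by apply/funext => h; rewrite /= E E1.
move=> dpsi; apply: DeriveDef.
  by rewrite /derivable -FG; exact: dpsi.
by rewrite /partial1 /derive FG.
Qed.

Lemma partial2_is_derive (psi : R * R -> R) (x y : R) :
  derivable psi (x, y) ((0, 1) : R * R) ->
  is_derive y 1 (fun s => psi (x, s)) (partial2 psi (x, y)).
Proof.
have E (h : R) : h *: ((0, 1) : R * R) + (x, y) = (x, h + y).
  by rewrite -[LHS]/(h * 0 + x, h * 1 + y) mulr1 mulr0 add0r.
have FG : (fun h : R => h^-1 *: ((psi \o shift (x, y)) (h *: ((0, 1) : R * R)) - psi (x, y)))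
    = (fun h : R => h^-1 *: (((fun s => psi (x, s)) \o shift y) (h *: (1 : R)) - psi (x, y))).
  have E1 (h : R) : h *: (1 : R) = h by exact: mulr1.
  by apply/funext => h; rewrite /= E E1.
move=> dpsi; apply: DeriveDef.
  by rewrite /derivable -FG; exact: dpsi.
by rewrite /partial2 /derive FG.
Qed.

Lemma derive_off_support (psi : R * R -> R) (v z : R * R) :
  ~ closure [set z | psi z != 0] z -> 'D_v psi z = 0.
Proof.
move=> nz; have oz : nbhs z (~` closure [set z | psi z != 0]).
  by apply: open_nbhs_nbhs; split => //; apply: closed_openC; exact: closed_closure.
rewrite -[RHS](@derive_cst R (R * R)%type R (0 : R) z v); apply: near_eq_derive.
apply: filterS oz => y ny; apply/eqP/negPn/negP => /= fy; apply: ny.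
exact: subset_closure.
Qed.

Lemma continuous_support_Lfun2 (f : R * R -> R) : continuous f ->
  (forall z, f z != 0 -> D z) -> f \in Lfun leb2 2%:E.
Proof.
move=> cf fD; have [L L0 DL] := bounded_domain_box.
have LL : L = - L + 2 * L by lra.
rewrite (_ : f = f \_ (`[- L, - L + 2 * L[%classic `*` `[- L, - L + 2 * L[%classic)).
  by apply: continuous_square_Lfun2 => //; rewrite mulr_gt0.
apply/funext => z; rewrite patchE -LL; case: ifPn => // zD.
apply/eqP; apply: contraNT zD => /fD/DL ?; exact: mem_set.
Qed.

Lemma patch_support (f : R * R -> R) : (forall z, f z != 0 -> D z) -> f \_ D = f.
Proof.
move=> fD; apply/funext => z; rewrite patchE; case: ifPn => // zD.
by apply/esym/eqP; apply: contraNT zD => /fD; exact: mem_set.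
Qed.

Lemma test_functionP (psi : R * R -> R) : test_function D psi ->
  [/\ continuous psi, continuous (partial1 psi) & continuous (partial2 psi)] /\
  [/\ forall z, psi z != 0 -> D z, forall z, partial1 psi z != 0 -> D z &
      forall z, partial2 psi z != 0 -> D z] /\
  (forall x y : R, is_derive x 1 (fun s => psi (s, y)) (partial1 psi (x, y))) /\
  (forall x y : R, is_derive y 1 (fun s => psi (x, s)) (partial2 psi (x, y))).
Proof.
move=> [/(_ 1%N)[cpsi [d1 d2 [cp1 _] [cp2 _]]] _ suppD]; split => //.
split.
  split=> [z fz|z|z].
  - by apply: suppD; exact: subset_closure.
  - by apply: contra_neqP => zD; apply: derive_off_support => /suppD.
  - by apply: contra_neqP => zD; apply: derive_off_support => /suppD.
by split=> x y; [exact: partial1_is_derive|exact: partial2_is_derive].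
Qed.

End test_functions.

Section dot_convergence.
Context {d} {T : measurableType d} {R : realType}.
Variable mu : {measure set T -> \bar R}.
Variables (f : nat -> T -> R) (g : T -> R).
Hypothesis lf : forall m, f m \in Lfun mu 2%:E.
Hypothesis lg : g \in Lfun mu 2%:E.
Hypothesis fg : nrm mu (f m \- g) @[m --> \oo] --> 0.

Lemma dot_cvgl k : k \in Lfun mu 2%:E -> dot mu (f m) k @[m --> \oo] --> dot mu g k.
Proof.
move=> lk; apply/cvgrPdist_le => e e0.
have /cvgrPdist_le/(_ (e / (nrm mu k + 1))) := fg.
have k1 : 0 < nrm mu k + 1 by rewrite ltr_wpDl// nrm_ge0.
rewrite divr_gt0// => /(_ isT); apply: filterS => m.
rewrite sub0r normrN ger0_norm ?nrm_ge0// ler_pdivlMr// => h.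
rewrite distrC -dotBl//; apply: le_trans (normr_dot_le (Lfun2B (lf m) lg) lk) _.
by apply: le_trans h; rewrite ler_wpM2l ?nrm_ge0// lerDl.
Qed.

Lemma nrm_cvg : nrm mu (f m) @[m --> \oo] --> nrm mu g.
Proof.
apply/cvgrPdist_le => e e0; have /cvgrPdist_le/(_ _ e0) := fg.
apply: filterS => m; rewrite sub0r normrN ger0_norm ?nrm_ge0//.
by apply: le_trans; rewrite distrC ler_dist_nrm.
Qed.

Lemma dot_cvg_sqr : dot mu (f m) (f m) @[m --> \oo] --> dot mu g g.
Proof.
rewrite -nrm_sqr; under eq_fun do rewrite -nrm_sqr.
by rewrite expr2; under eq_fun do rewrite expr2; apply: cvgM; exact: nrm_cvg.
Qed.

End dot_convergence.

Lemma cvg_sum_ord {R : realType} n (u : nat -> nat -> R) (l : nat -> R) :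
  (forall i, u i m @[m --> \oo] --> l i) ->
  \sum_(i < n) u i m @[m --> \oo] --> \sum_(i < n) l i.
Proof.
move=> ul; elim: n => [|n IH].
  by rewrite big_ord0; under eq_fun do rewrite big_ord0; exact: cvg_cst.
rewrite big_ord_recr/=; under eq_fun do rewrite big_ord_recr/=.
by apply: cvgD => //; exact: ul.
Qed.

(* Cut a box containing D into n^2 squares Q of side h. Poincare's inequality on
   each Q gives [1 <= 2 h^2 lam_j + sum_Q <phi_j, 1_Q>^2 / h^2], and by Bessel's
   inequality the last term, summed over j, is at most the number n^2 of squares.
   With h of order [lam_i^(-1/2)] the number of eigenvalues up to [lam_i] is
   therefore at most of order n^2, that is of order [lam_i]. *)
Section weyl.
Context {R : realType}.
Local Notation leb2 := (lebesgue2 R).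
Variables (D : set (R * R)) (lam : nat -> R) (phi : nat -> R * R -> R).
Hypothesis bD : bounded_set D.
Hypothesis hphi : dirichlet_eigenbasis D lam phi.

(** An eigenfunction has only a weak gradient, so Poincare's inequality is applied to the
    approximating test functions and passed to the limit. *)
Lemma eigenfunction_tiles (L h : R) n i :
  0 < h -> - L + n%:R * h = L ->
  (forall z, D z -> (`[- L, L[%classic `*` `[- L, L[%classic) z) ->
  1 <= 2 * h ^+ 2 * lam i +
   \sum_(j < n) \sum_(k < n)
     dot leb2 (phi i \_ D) (\1_(tile L h j k)) ^+ 2 / h ^+ 2.
Proof.
move=> h0 nh DL.
have [g1 [g2 [[pU g1U g2U [psi [tpsi cpsi cp1 cp2]]] weak]]] := eigen_pair hphi i.
have tf m := test_functionP (tpsi m).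
have lpsi m : psi m \in Lfun leb2 2%:E.
  by have [[? ? ?] [[? ? ?] _]] := tf m; exact: (continuous_support_Lfun2 bD).
have lp1 m : partial1 (psi m) \in Lfun leb2 2%:E.
  by have [[? ? ?] [[? ? ?] _]] := tf m; exact: (continuous_support_Lfun2 bD).
have lp2 m : partial2 (psi m) \in Lfun leb2 2%:E.
  by have [[? ? ?] [[? ? ?] _]] := tf m; exact: (continuous_support_Lfun2 bD).
have eD m : (psi m) \_ D = psi m.
  by have [_ [[? ? ?] _]] := tf m; exact: patch_support.
have e1D m : (partial1 (psi m)) \_ D = partial1 (psi m).
  by have [_ [[? ? ?] _]] := tf m; exact: patch_support.
have e2D m : (partial2 (psi m)) \_ D = partial2 (psi m).
  by have [_ [[? ? ?] _]] := tf m; exact: patch_support.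
have c0 : nrm leb2 (psi m \- (phi i \_ D)) @[m --> \oo] --> 0.
  by move: cpsi; under eq_fun do rewrite normUE patchB eD.
have c1 : nrm leb2 (partial1 (psi m) \- (g1 \_ D)) @[m --> \oo] --> 0.
  by move: cp1; under eq_fun do rewrite normUE patchB e1D.
have c2 : nrm leb2 (partial2 (psi m) \- (g2 \_ D)) @[m --> \oo] --> 0.
  by move: cp2; under eq_fun do rewrite normUE patchB e2D.
(* Test the weak equation with the approximants themselves: in the limit the energy of the gradient
   equals the eigenvalue, the eigenfunction having norm 1. *)
have gE : dot leb2 (g1 \_ D) (g1 \_ D) + dot leb2 (g2 \_ D) (g2 \_ D) = lam i.
  have l1 : dot leb2 (partial1 (psi m)) (g1 \_ D) + dot leb2 (partial2 (psi m)) (g2 \_ D)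
      @[m --> \oo] --> dot leb2 (g1 \_ D) (g1 \_ D) + dot leb2 (g2 \_ D) (g2 \_ D).
    apply: cvgD.
      exact: (dot_cvgl lp1 g1U c1 g1U).
    exact: (dot_cvgl lp2 g2U c2 g2U).
  have l2 : lam i * dot leb2 (psi m) (phi i \_ D) @[m --> \oo] --> lam i * 1.
    apply: cvgM; first exact: cvg_cst.
    have <- : dot leb2 (phi i \_ D) (phi i \_ D) = 1.
      by rewrite -ipE (phi_on hphi) eqxx.
    exact: (dot_cvgl lpsi pU c0 pU).
  have eqs : (fun m => dot leb2 (partial1 (psi m)) (g1 \_ D) +
      dot leb2 (partial2 (psi m)) (g2 \_ D)) =
      (fun m => lam i * dot leb2 (psi m) (phi i \_ D)).
    apply/funext => m; have H := weak _ (tpsi m).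
    rewrite !ipE eD e1D e2D in H.
    by rewrite [X in X + _]dotC [X in _ + X]dotC H [in LHS]dotC.
  rewrite eqs in l1; rewrite -[RHS]mulr1; exact: cvg_unique l1 l2.
rewrite -gE; apply: (@ler_cvg_to _ \oo _ _ (fun m => dot leb2 (psi m) (psi m))
  (fun m => 2 * h ^+ 2 * (dot leb2 (partial1 (psi m)) (partial1 (psi m)) +
                          dot leb2 (partial2 (psi m)) (partial2 (psi m))) +
   \sum_(j < n) \sum_(k < n) dot leb2 (psi m) (\1_(tile L h j k)) ^+ 2 / h ^+ 2)).
- have <- : dot leb2 (phi i \_ D) (phi i \_ D) = 1.
    by rewrite -ipE (phi_on hphi) eqxx.
  exact: (dot_cvg_sqr lpsi pU c0).
- apply: cvgD.
    apply: cvgM; first exact: cvg_cst.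
    by apply: cvgD; [exact: (dot_cvg_sqr lp1 g1U c1)|exact: (dot_cvg_sqr lp2 g2U c2)].
  apply: (@cvg_sum_ord _ n (fun j m => \sum_(k < n) dot leb2 (psi m) (\1_(tile L h j k)) ^+ 2 / h ^+ 2)
    (fun j => \sum_(k < n) dot leb2 (phi i \_ D) (\1_(tile L h j k)) ^+ 2 / h ^+ 2)) => j.
  apply: (@cvg_sum_ord _ n (fun k m => dot leb2 (psi m) (\1_(tile L h j k)) ^+ 2 / h ^+ 2)
    (fun k => dot leb2 (phi i \_ D) (\1_(tile L h j k)) ^+ 2 / h ^+ 2)) => k.
  apply: cvgM; last exact: cvg_cst.
  rewrite expr2; under eq_fun do rewrite expr2.
  have lt : (\1_(tile L h j k) : R * R -> R) \in Lfun leb2 2%:E.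
    exact: Lfun2_tile.
  by apply: cvgM; exact: (dot_cvgl lpsi pU c0 lt).
- apply: nearW => m; have [[q1 q2 q3] [[q4 q5 q6] [q7 q8]]] := tf m.
  exact: (poincare_tiles h0 nh q1 q2 q3 q7 q8 (lpsi m) (lp1 m) (lp2 m)
    (fun z hz => DL z (q4 z hz)) (fun z hz => DL z (q5 z hz))
    (fun z hz => DL z (q6 z hz))).
Qed.

Lemma weyl_lower_bound : exists2 c : R, 0 < c & forall i, c * i.+1%:R <= lam i.
Proof.
have [L L0 DL] := bounded_domain_box bD.
have l0 := eigen_gt0 hphi.
(* Below, (i + 1) / 2 <= n^2 <= 32 L^2 lam_i + 2, and the 2 is absorbed by 2 <= (2 / lam_0)
   lam_i. *)
pose c := (2 * (32 * L ^+ 2 + 2 / lam 0%N))^-1.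
have c0 : 0 < 32 * L ^+ 2 + 2 / lam 0%N.
  by rewrite ltr_wpDl ?divr_gt0// mulr_ge0// sqr_ge0.
exists c => [|i]; first by rewrite invr_gt0 mulr_gt0.
have li := lam_gt0 hphi i.
pose s := Num.sqrt (lam i).
have s0 : 0 < s by rewrite sqrtr_gt0.
have s2 : s ^+ 2 = lam i by rewrite sqr_sqrtr// ltW.
(* With n >= 4 L s the gradient term 2 h^2 lam_i is at most 1/2, while n stays of the order of sqrt
   lam_i. *)
pose n := (Num.truncn (4 * L * s)).+1.
have Ls0 : 0 <= 4 * L * s by rewrite !mulr_ge0 ?(ltW L0) ?(ltW s0).
have /andP[n1 n2] := truncn_itv Ls0.
have nE : n%:R = (Num.truncn (4 * L * s))%:R + 1 :> R by rewrite natr1.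
rewrite -/n in n2.
have n0 : 0 < n%:R :> R by rewrite ltr0n.
pose h := 2 * L / n%:R.
have h0 : 0 < h by rewrite divr_gt0// mulr_gt0.
have nh : - L + n%:R * h = L by rewrite /h; field; rewrite gt_eqF.
have h2 : 2 * h ^+ 2 * lam i <= 2^-1.
  rewrite /h -s2 -(@ler_pM2r _ (n%:R ^+ 2)) ?exprn_gt0//.
  rewrite (_ : 2 * (2 * L / n%:R) ^+ 2 * s ^+ 2 * n%:R ^+ 2 = 8 * (L * s) ^+ 2);
    last by field; rewrite gt_eqF.
  have : (4 * (L * s)) ^+ 2 <= n%:R ^+ 2.
    by rewrite ler_sqr ?nnegrE ?mulrA// ltW.
  rewrite exprMn; lra.
(* Sum the tile inequality over j <= i and exchange the sums: on each tile, Bessel's inequality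
   bounds the sum over j by the squared norm h^2 of the indicator, so each tile contributes at most
   1. *)
have kle : i.+1%:R <= i.+1%:R * 2^-1 + n%:R ^+ 2 :> R.
  have tiles (j : 'I_i.+1) : 1 <= 2^-1 + \sum_(j0 < n) \sum_(k < n)
     dot leb2 (phi j \_ D) (\1_(tile L h j0 k)) ^+ 2 / h ^+ 2.
    apply: (le_trans (eigenfunction_tiles j h0 nh DL)).
    rewrite lerD2r; apply: (le_trans _ h2).
    have h20 : 0 < 2 * h ^+ 2 by rewrite mulr_gt0 ?exprn_gt0.
    by rewrite (ler_pM2l h20); apply: (lam_le hphi); rewrite -ltnS.
  have : \sum_(j < i.+1) (1 : R) <= \sum_(j < i.+1) (2^-1 + \sum_(j0 < n) \sum_(k < n)
     dot leb2 (phi j \_ D) (\1_(tile L h j0 k)) ^+ 2 / h ^+ 2).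
    by apply: ler_sum => j _; exact: tiles.
  rewrite big_split/= !sumr_const !card_ord => /le_trans; apply.
  rewrite mulr_natl lerD2l exchange_big/=.
  rewrite (_ : n%:R ^+ 2 = \sum_(j0 < n) \sum_(k < n) 1 :> R); last first.
    by rewrite !sumr_const !card_ord -[RHS]mulr_natr expr2.
  apply: ler_sum => j0 _; rewrite exchange_big/=; apply: ler_sum => k _.
  rewrite -mulr_suml ler_pdivrMr ?exprn_gt0// mul1r.
  have lt : (\1_(tile L h j0 k) : R * R -> R) \in Lfun leb2 2%:E by exact: Lfun2_tile.
  rewrite -(dot_tile L j0 k h0).
  have := @bessel _ _ _ leb2 (fun i => phi i \_ D) (phiU hphi) _ i.+1 _ lt.
  under eq_bigr do rewrite dotC.
  by apply => a b; rewrite -ipE (phi_on hphi).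
rewrite /c mulrC ler_pdivrMr ?mulr_gt0//.
have n4 : n%:R ^+ 2 <= (4 * L * s + 1) ^+ 2.
  by rewrite ler_sqr ?nnegrE ?ler0n ?addr_ge0// nE lerD2r.
have n5 : (4 * L * s + 1) ^+ 2 <= 32 * L ^+ 2 * lam i + 2.
  rewrite -s2; have := sqr_ge0 (4 * L * s - 1); nra.
have l2 : 2 <= 2 / lam 0%N * lam i.
  by rewrite mulrAC ler_pdivlMr// ler_pM2l// (lam_le hphi).
have := le_trans n4 n5; lra.
Qed.

End weyl.

(** * Wiener integrals *)

Section normal_variance.
Context {R : realType}.
Local Notation leb := (@lebesgue_measure R).
Variable s : R.
Hypothesis s0 : 0 < s.
Let p := normal_pdf 0 s.

Let sn : s != 0. Proof. by rewrite gt_eqF. Qed.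

Let pE x : p x = normal_peak s * expR (- x ^+ 2 / (s ^+ 2 *+ 2)).
Proof. by rewrite /p normal_pdfE// /normal_fun subr0. Qed.

Let p0 x : 0 <= p x. Proof. exact: normal_pdf_ge0. Qed.

Let cp : continuous p. Proof. exact: continuous_normal_pdf. Qed.

Let cx2p : continuous (fun x : R => x ^+ 2 * p x).
Proof. by move=> x; apply: cvgM; [exact: exprn_continuous|exact: cp]. Qed.

Lemma normal_pdf_is_derive (x : R) : is_derive x 1 p (- (x / s ^+ 2) * p x).
Proof.
have -> : p = (fun x => normal_peak s * expR (- x ^+ 2 / (s ^+ 2 *+ 2))).
  by apply/funext => y; rewrite pE.
apply: is_derive_eq.
rewrite /GRing.scale/= ?mulr1.
by rewrite -mulr_natr; field.
Qed.

(** A primitive of (x^2 - s^2) p(x): it reduces the second moment to s^2 times the mass, plus a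
    boundary term that vanishes at infinity. *)
Let G x := - s ^+ 2 * (x * p x).

Let dG (x : R) : is_derive x 1 G (x ^+ 2 * p x - s ^+ 2 * p x).
Proof.
have ? := normal_pdf_is_derive x.
apply: is_derive_eq; rewrite /GRing.scale/= ?mulr1.
by field.
Qed.

Lemma normal_variance_itv (b : R) : 0 < b ->
  (\int[leb]_(x in `[0%R, b]) (x ^+ 2 * p x)%:E =
   (s ^+ 2)%:E * \int[leb]_(x in `[0%R, b]) (p x)%:E + (G b)%:E)%E.
Proof.
move=> b0.
have int (f : R -> R) : continuous f -> leb.-integrable `[0, b] (EFin \o f).
  move=> cf; apply: continuous_compact_integrable; first exact: segment_compact.
  exact: continuous_subspaceT.
have cG x : G @ x --> G x.
  by apply: differentiable_continuous; apply/derivable1_diffP; have := dG x => -[].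
have FTC : (\int[leb]_(x in `[0%R, b]) (x ^+ 2 * p x - s ^+ 2 * p x)%:E = (G b)%:E - (G 0%R)%:E)%E.
  apply: continuous_FTC2 => //.
  - apply: continuous_subspaceT => x; apply: cvgB; first exact: cx2p.
    by apply: cvgM; [exact: cvg_cst|exact: cp].
  - split.
    + by move=> x _; have := dG x => -[].
    + by apply: cvg_at_right_filter; exact: cG.
    + by apply: cvg_at_left_filter; exact: cG.
  - by move=> z _; rewrite derive1E; have := dG z => -[].
have cs2p : continuous (fun x : R => s ^+ 2 * p x).
  by move=> x; apply: cvgM; [exact: cvg_cst|exact: cp].
move: FTC; rewrite integralB_EFin//; try exact: int.
rewrite {2}/G mul0r mulr0 sube0.
under [X in (_ - X)%E]eq_integral do rewrite EFinM.
rewrite integralZl//; last exact: int.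
have f1 : (\int[leb]_(x in `[0%R, b]) (p x)%:E)%E \is a fin_num.
  by apply: integrable_fin_num => //; exact: int.
move=> <-; rewrite addeC subeK// fin_numM//.
Qed.

Let G_cvg : G n%:R @[n --> \oo] --> 0.
Proof.
pose C := s ^+ 2 * normal_peak s * (s ^+ 2 *+ 2).
apply/cvgrPdist_le => e e0.
near=> n.
have n0 : 0 < n%:R :> R by rewrite ltr0n; near: n; exists 1%N.
rewrite sub0r normrN /G normrM normrN !ger0_norm ?mulr_ge0 ?sqr_ge0 ?(ltW s0)//.
apply: (@le_trans _ _ (C / n%:R)).
  rewrite pE (_ : C / n%:R = s ^+ 2 * (normal_peak s * ((s ^+ 2 *+ 2) / n%:R))); last first.
    by rewrite /C !mulrA.
  rewrite ler_wpM2l ?sqr_ge0// mulrCA ler_wpM2l ?normal_peak_ge0//.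
  have s20 : 0 < s ^+ 2 *+ 2 by rewrite pmulrn_lgt0// exprn_gt0.
  rewrite mulNr expRN ler_pdivlMr// mulrAC -expr2 ler_pdivrMr ?expR_gt0//.
  rewrite mulrC -ler_pdivrMr//.
  by apply: le_trans (expR_ge1Dx _); rewrite lerDr.
rewrite ler_pdivrMr// mulrC -ler_pdivrMr//.
near: n; apply: nbhs_infty_ger; exact: num_real.
Unshelve. all: by end_near. Qed.

Lemma normal_half : (\int[leb]_(x in `[0%R, +oo[) (p x)%:E = (2^-1)%:E)%E.
Proof.
have := @integral_normal_pdf R 0 s; rewrite -/p ge0_symfun_integralT//; last first.
  by move=> x; rewrite /= !pE sqrrN.
rewrite (_ : [set x : R | 0 <= x] = `[0, +oo[%classic); last first.
  by apply/seteqP; split => x /=; rewrite in_itv/= andbT.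
move=> /(congr1 (fun x => (2^-1)%:E * x)%E); rewrite mule1 muleA -EFinM.
by rewrite mulVf ?mul1e.
Qed.

Lemma normal_variance : (\int[leb]_x (x ^+ 2 * p x)%:E = (s ^+ 2)%:E)%E.
Proof.
have mf : measurable_fun setT (fun x : R => x ^+ 2 * p x) by exact: continuous_measurable_fun.
have mp : measurable_fun setT p by exact: continuous_measurable_fun.
have f0 x : 0 <= x ^+ 2 * p x by rewrite mulr_ge0 ?sqr_ge0.
have l1 := @ge0_cvgn_integral R leb _ f0 mf.
have l2 := @ge0_cvgn_integral R leb _ p0 mp.
rewrite normal_half in l2.
have l3 : (\int[leb]_(x in `[0%R, n%:R]) (x ^+ 2 * p x)%:E @[n --> \oo]
    --> (s ^+ 2)%:E * (2^-1)%:E + 0)%E.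
  have : ((s ^+ 2)%:E * \int[leb]_(x in `[0%R, n%:R]) (p x)%:E + (G n%:R)%:E @[n --> \oo]
    --> (s ^+ 2)%:E * (2^-1)%:E + 0)%E.
    apply: cvgeD => //; first by apply: cvgeZl.
    by apply: cvg_EFin; [exact: nearW|exact: G_cvg].
  apply: cvg_trans; apply: near_eq_cvg.
  by exists 1%N => // n /= n1; rewrite normal_variance_itv// ltr0n.
have half := cvg_unique _ l1 l3.
rewrite ge0_symfun_integralT//; last first.
  by move=> x; rewrite /= !pE sqrrN.
rewrite (_ : [set x : R | 0 <= x] = `[0, +oo[%classic); last first.
  by apply/seteqP; split => x /=; rewrite in_itv/= andbT.
rewrite half//adde0 -!EFinM; congr EFin; by field.
Qed.

End normal_variance.

Lemma monotone_cvg {d} {T : measurableType d} {R : realType}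
    (mu : {measure set T -> \bar R}) (f_ : nat -> T -> \bar R) (f : T -> \bar R) :
  (forall n, measurable_fun setT (f_ n)) -> (forall n x, (0 <= f_ n x)%E) ->
  (forall x, {homo f_ ^~ x : a b / (a <= b)%N >-> (a <= b)%E}) ->
  (forall x, f_ n x @[n --> \oo] --> f x) ->
  (\int[mu]_x f_ n x)%E @[n --> \oo] --> (\int[mu]_x f x)%E.
Proof.
move=> mf f0 nd cf.
rewrite (_ : f = fun x => limn (f_ ^~ x)); last first.
  by apply/funext => x; apply/esym/cvg_lim => //; exact: cf.
apply: cvg_monotone_convergence => // x _; exact: nd.
Qed.

(** * Integration against a measure with a density *)

Section density.
Context {d} {T : measurableType d} {R : realType}.
Variables (mu nu : {measure set T -> \bar R}) (g : T -> R).
Hypothesis g0 : forall x, 0 <= g x.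
Hypothesis mg : measurable_fun setT g.
Hypothesis nuE : forall A, measurable A -> nu A = (\int[mu]_(x in A) (g x)%:E)%E.
Import HBNNSimple.

(** Clear for indicators, hence for simple functions, then by monotone convergence. It serves to
    compute the second moment of a Gaussian increment. *)
Lemma ge0_integral_density (f : T -> R) : (forall x, 0 <= f x) ->
  measurable_fun setT f ->
  (\int[nu]_x (f x)%:E = \int[mu]_x (f x * g x)%:E)%E.
Proof.
move=> f0 mf.
have mfE : measurable_fun setT (EFin \o f) by exact/measurable_EFinP.
pose f_ := nnsfun_approx measurableT mfE.
have fE0 x : setT x -> (0 <= (EFin \o f) x)%E by rewrite /= lee_fin.
have cf x : (f_ n x)%:E @[n --> \oo] --> (f x)%:E.
  by apply: (cvg_nnsfun_approx measurableT mfE fE0).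
have simple n : (\int[nu]_x (f_ n x)%:E = \int[mu]_x (f_ n x * g x)%:E)%E.
  have h0 r x : (0 <= (r * \1_(f_ n @^-1` [set r]) x)%:E)%E by exact: nnfun_muleindic_ge0.
  have mr r : measurable (f_ n @^-1` [set r]) by exact: measurable_sfunP.
  transitivity (\sum_(r \in range (f_ n)) (r%:E * nu (f_ n @^-1` [set r])))%E.
    under eq_integral do rewrite fimfunE -fsumEFin//.
    rewrite ge0_integral_fsum//.
      apply: eq_fsbigr => r _.
      by rewrite (integralZl_indic_nnsfun nu measurableT) integral_indic ?setIT.
    by move=> r; apply/measurable_EFinP; exact: measurable_funM.
  transitivity (\int[mu]_x (\sum_(r \in range (f_ n))
      (r * \1_(f_ n @^-1` [set r]) x * g x)%:E))%E; last first.
    apply: eq_integral => x _; rewrite [in RHS]fimfunE EFinM -fsumEFin//.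
    by rewrite ge0_mule_fsuml.
  rewrite ge0_integral_fsum//; last 2 first.
  - by move=> r; apply/measurable_EFinP; apply: measurable_funM => //; exact: measurable_funM.
  - move=> r x _; rewrite EFinM; apply: mule_ge0; first exact: h0.
    by rewrite lee_fin.
  apply: eq_fsbigr => r /set_mem[x0 _ xr].
  have r0 : 0 <= r by rewrite -xr.
  transitivity (r%:E * \int[mu]_x ((g x)%:E * (\1_(f_ n @^-1` [set r]) x)%:E))%E.
    rewrite nuE// integral_mkcond; congr (_ * _)%E; apply: eq_integral => x _.
    by rewrite patchE indicE; case: (_ \in _); rewrite ?mule1 ?mule0.
  rewrite -ge0_integralZl//.
  - by apply: eq_integral => x _; rewrite -!EFinM -!mulrA; congr (_ * _)%:E; rewrite mulrC.
  - by apply/measurable_EFinP; exact: measurable_funM.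
  - by move=> x _; rewrite mule_ge0 ?lee_fin.
have l1 : (\int[nu]_x (f_ n x)%:E)%E @[n --> \oo] --> (\int[nu]_x (f x)%:E)%E.
  apply: monotone_cvg => //.
  - by move=> n; exact/measurable_EFinP.
  - by move=> n x; rewrite lee_fin.
  - by move=> x a b ab; rewrite lee_fin; exact/lefP/nd_nnsfun_approx.
have l2 : (\int[mu]_x (f_ n x * g x)%:E)%E @[n --> \oo] --> (\int[mu]_x (f x * g x)%:E)%E.
  apply: monotone_cvg => //.
  - by move=> n; apply/measurable_EFinP; exact: measurable_funM.
  - by move=> n x; rewrite lee_fin mulr_ge0.
  - by move=> x a b ab; rewrite lee_fin ler_wpM2r//; exact/lefP/nd_nnsfun_approx.
  - by move=> x; rewrite EFinM; under eq_fun do rewrite EFinM; apply: cvgeZr.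
rewrite (_ : (fun n => \int[nu]_x (f_ n x)%:E)%E = (fun n => \int[mu]_x (f_ n x * g x)%:E)%E) in l1.
  exact: cvg_unique l1 l2.
exact/funext.
Qed.

End density.

Section orthogonal_family.
Context {d} {T : measurableType d} {R : realType}.
Variables (mu : {measure set T -> \bar R}) (e : nat -> T -> R) (v : nat -> R).
Hypothesis le : forall k, e k \in Lfun mu 2%:E.
Hypothesis orth : forall j k, (j < k)%N -> dot mu (e j) (e k) = 0.
Hypothesis sqr : forall k, dot mu (e k) (e k) = v k.

(** Pythagoras' theorem. It is applied to Brownian increments and to indicators of consecutive
    intervals, whose squared norms [v] coincide; this is the isometry on step functions. *)
Lemma dot_orthogonal_comb n (c : nat -> R) :
  dot mu (fun x => \sum_(k < n) c k * e k x) (fun x => \sum_(k < n) c k * e k x)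
  = \sum_(k < n) c k ^+ 2 * v k.
Proof.
elim: n => [|n IH].
  by rewrite big_ord0 dot_suml ?big_ord0//; exact: Lfun2_sum.
rewrite big_ord_recr/= -IH.
have -> : (fun x => \sum_(k < n.+1) c k * e k x) =
    (fun x => \sum_(k < n) c k * e k x) \+ (fun x => c n * e n x).
  by apply/funext => x; rewrite big_ord_recr.
have lS : (fun x => \sum_(k < n) c k * e k x) \in Lfun mu 2%:E by exact: Lfun2_sum.
have z : dot mu (fun x => \sum_(k < n) c k * e k x) (e n) = 0.
  rewrite (@dot_suml _ _ _ mu n c e)//.
  by rewrite big1// => k _; rewrite orth ?mulr0.
rewrite dotDD ?Lfun2Z// dotZr// z !mulr0 addr0.
by rewrite dotZl ?Lfun2Z// dotZr// sqr mulrA -expr2.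
Qed.

End orthogonal_family.

(** * Brownian increments and the Wiener integral *)

Section wiener.
Context {R : realType} {d : measure_display} {Omega : measurableType d}.
Variables (P : probability Omega R) (beta : R -> Omega -> R).
Hypothesis hB : two_sided_BM P beta.
Local Notation leb := (@lebesgue_measure R).
Let V a b := beta b \- beta a.

Let mV a b : measurable_fun setT (V a b).
Proof. by apply: measurable_funB; exact: BM_measurable hB _. Qed.

Lemma BM_increment_sqr a b : a < b ->
  (\int[P]_w (V a b w ^+ 2)%:E = (b - a)%:E)%E.
Proof.
move=> ab; have ba : 0 < b - a by rewrite subr_gt0.
have s0 : 0 < Num.sqrt (b - a) by rewrite sqrtr_gt0.
have msq : measurable_fun setT (fun x : measurableTypeR R => x ^+ 2).
  exact: measurable_funX.
transitivity (\int[pushforward P (V a b : Omega -> measurableTypeR R)]_x (x ^+ 2)%:E)%E.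
  rewrite ge0_integral_pushforward//.
  - exact: mV.
  - exact/measurable_EFinP.
  - by move=> x _; rewrite lee_fin sqr_ge0.
transitivity (\int[normal_prob 0 (Num.sqrt (b - a))]_x (x ^+ 2)%:E)%E.
  apply: eq_measure_integral => [|mVab A mA _]; first exact: mV.
  exact: (BM_normal hB).
rewrite (@ge0_integral_density _ _ _ leb _ (normal_pdf 0 (Num.sqrt (b - a)))).
- by rewrite normal_variance// sqr_sqrtr// ltW.
- by move=> x; exact: normal_pdf_ge0.
- exact: measurable_normal_pdf.
- by [].
- by move=> x; exact: sqr_ge0.
- by [].
Qed.

Lemma BM_increment_Lfun2 a b : V a b \in Lfun P 2%:E.
Proof.
have [ab|ba|<-] := ltgtP a b.
- by apply/Lfun2P => //; rewrite BM_increment_sqr// ltry.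
- apply/Lfun2P => //.
  under eq_integral do rewrite /V/= -opprB sqrrN.
  by rewrite BM_increment_sqr// ltry.
- rewrite (_ : V a a = cst 0) ?Lfun20//.
  by apply/funext => w; rewrite /V/= subrr.
Qed.

Lemma BM_increment_dot a b : a <= b -> dot P (V a b) (V a b) = b - a.
Proof.
rewrite le_eqVlt => /predU1P[<-|ab].
  rewrite subrr /dot; under eq_Rintegral do rewrite /V/= subrr mul0r.
  by rewrite /Rintegral integral0.
by apply: EFin_inj; rewrite dot_sqr ?BM_increment_Lfun2// BM_increment_sqr.
Qed.

(* Only the variances of the increments are needed: they determine the
   covariances by polarization. *)
Lemma BM_increment_orth a b c e : a <= b -> b <= c -> c <= e ->
  dot P (V a b) (V c e) = 0.
Proof.
move=> ab bc ce; have L := BM_increment_Lfun2.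
have ac : V a c = V a b \+ V b c.
  by apply/funext => w; rewrite /V/=; ring.
have be : V b e = V b c \+ V c e.
  by apply/funext => w; rewrite /V/=; ring.
have ae : V a e = (V a b \+ V b c) \+ V c e.
  by apply/funext => w; rewrite /V/=; ring.
have h1 := BM_increment_dot (le_trans ab bc).
have h2 := BM_increment_dot (le_trans bc ce).
have h3 := BM_increment_dot (le_trans (le_trans ab bc) ce).
have h4 := BM_increment_dot ab.
have h5 := BM_increment_dot bc.
have h6 := BM_increment_dot ce.
rewrite ac dotDD// in h1; rewrite be dotDD// in h2.
rewrite ae (dotDD (Lfun2D (L a b) (L b c)) (L c e)) (dotDD (L a b) (L b c))
  (dotDl (L a b) (L b c) (L c e)) in h3.
lra.
Qed.

Section steps.
Variables (n : nat) (t c : nat -> R).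
Hypothesis ht : forall k, t k <= t k.+1.

Let t_le i j : (i <= j)%N -> t i <= t j.
Proof.
move=> /subnKC <-; elim: (j - i)%N => [|k IH]; first by rewrite addn0.
by rewrite addnS (le_trans IH).
Qed.

Lemma step_int_Lfun2 : step_int beta n t c \in Lfun P 2%:E.
Proof.
by apply: (@Lfun2_sum _ _ _ P n c (fun k => V (t k) (t k.+1))) => k _; exact: BM_increment_Lfun2.
Qed.

Lemma step_int_dot : dot P (step_int beta n t c) (step_int beta n t c) =
  \sum_(k < n) c k ^+ 2 * (t k.+1 - t k).
Proof.
apply: (@dot_orthogonal_comb _ _ _ P (fun k => V (t k) (t k.+1)) (fun k => t k.+1 - t k)).
- by move=> k; exact: BM_increment_Lfun2.
- by move=> j k jk; apply: BM_increment_orth => //; exact: t_le.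
- by move=> k; exact: BM_increment_dot.
Qed.

Let I k : R -> R := \1_(`]t k, t k.+1]).

Let I_sqr k : (\int[leb]_x (I k x ^+ 2)%:E = (t k.+1 - t k)%:E)%E.
Proof.
under eq_integral do rewrite /I indicE expr2 -natrM mulnb andbb -indicE.
rewrite integral_indic//= setIT lebesgue_measure_itv/= lte_fin.
by case: ltP => // tk; rewrite (@le_anti _ _ (t k) (t k.+1)) ?ht ?tk// subrr.
Qed.

Let I_L2 k : I k \in Lfun leb 2%:E.
Proof. by apply/Lfun2P; [exact: measurable_indic|rewrite I_sqr ltry]. Qed.

Lemma step_Lfun2 : step n t c \in Lfun leb 2%:E.
Proof. by apply: (@Lfun2_sum _ _ _ leb n c I) => k _; exact: I_L2. Qed.

Lemma step_dot : dot leb (step n t c) (step n t c) =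
  \sum_(k < n) c k ^+ 2 * (t k.+1 - t k).
Proof.
apply: (@dot_orthogonal_comb _ _ _ leb I (fun k => t k.+1 - t k)).
- exact: I_L2.
- move=> j k jk; rewrite /dot.
  transitivity (\int[leb]_x (0 : R)); last by rewrite /Rintegral integral0.
  apply: eq_Rintegral => x _.
  rewrite /I !indicE !mem_setE !in_itv/=.
  have [xj|_] := leP x (t j.+1); last by rewrite andbF mul0r.
  by rewrite (ltNge (t k)) (le_trans xj (t_le jk)) mulr0.
- by move=> k; apply: EFin_inj; rewrite dot_sqr.
Qed.

End steps.

(** For step functions both sides are the same sum, by [step_int_dot] and [step_dot], and both norms
    pass to the limit along the same approximating sequence. *)
Lemma wiener_integral_dot_le g X : wiener_integral P beta g X ->
  dot P X X <= dot leb g g.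
Proof.
move=> [lg lX [n [t [c [ht cg cX]]]]].
rewrite -!nrm_sqr ler_sqr ?nnegrE ?nrm_ge0//.
apply/ler_addgt0Pr => e e0.
have e2 : 0 < e / 2 by rewrite divr_gt0.
have ls m := step_Lfun2 (n m) (c m) (ht m).
have lS m := step_int_Lfun2 (n m) (t m) (c m).
have cg' : nrm leb (step (n m) (t m) (c m) \- g) @[m --> \oo] --> 0.
  move: cg; under eq_fun do rewrite Lnorm2_nrm ?Lfun2B//.
  by move=> /fine_cvg.
have cX' : nrm P (step_int beta (n m) (t m) (c m) \- X) @[m --> \oo] --> 0.
  move: cX; under eq_fun do rewrite Lnorm2_nrm ?Lfun2B//.
  by move=> /fine_cvg.
have /cvgrPdist_le/(_ _ e2)[N1 _ N1P] := cg'.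
have /cvgrPdist_le/(_ _ e2)[N2 _ N2P] := cX'.
pose m := maxn N1 N2.
have := N1P m (leq_maxl _ _); have := N2P m (leq_maxr _ _).
rewrite /= !sub0r !normrN !ger0_norm ?nrm_ge0// => h2 h1.
have h3 := ler_dist_nrm (lS m) lX.
have h4 := ler_dist_nrm (ls m) lg.
have eqn : nrm P (step_int beta (n m) (t m) (c m)) = nrm leb (step (n m) (t m) (c m)).
  by rewrite /nrm step_int_dot// step_dot.
move: h3 h4; rewrite eqn !ler_norml => /andP[h3 h3'] /andP[h4 h4'].
lra.
Qed.

End wiener.

Lemma integral_mkindic {d} {T : measurableType d} {R : realType}
    (mu : {measure set T -> \bar R}) (A : set T) (f : T -> R) :
  (\int[mu]_(x in A) (f x)%:E = \int[mu]_x (f x * \1_A x)%:E)%E.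
Proof.
rewrite integral_mkcond; apply: eq_integral => x _.
by rewrite patchE indicE; case: (_ \in _); rewrite ?mulr1 ?mulr0.
Qed.

(** The bounds M and M / z are the cases q = 0 and q = 1, and the smaller of them lies below every
    intermediate power. The factors (a v)^(-q) in the kernel estimates all originate here. *)
Lemma powR_le_expr {R : realType} (z q x M : R) :
  0 < z -> 0 <= q <= 1 -> x <= M -> x * z <= M -> 0 <= M -> x <= M * z `^ (- q).
Proof.
move=> z0 /andP[q0 q1] xM xzM M0.
have [z1|z1] := leP z 1.
  apply: (le_trans xM); rewrite -[leLHS]mulr1 ler_wpM2l//.
  rewrite powRN -invr1 lef_pV2 ?posrE ?powR_gt0//.
  by rewrite -[leRHS](powRr0 z) ger_powR// z0.
apply: (@le_trans _ _ (M / z)); first by rewrite ler_pdivlMr.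
rewrite ler_wpM2l// powRN lef_pV2 ?posrE ?powR_gt0//.
by apply: ler1_powR => //; exact: ltW.
Qed.

(** * The tempered kernel of an exponential *)

Section improper_integrals.
Context {R : realType}.
Local Notation leb := (@lebesgue_measure R).

(** The integrand may be singular at the ends of [A]: the fundamental theorem is applied on the
    compact intervals [u n, v n] exhausting [A], and Fatou's lemma gives the limit. *)
Lemma integral_le_primitive (A : set R) (u v : nat -> R) (f F : R -> R) (M : R) :
  measurable A -> measurable_fun setT f ->
  (forall n x, u n <= x <= v n -> A x) ->
  (forall x, A x -> \forall n \near \oo, u n <= x <= v n) ->
  (forall x, A x -> {for x, continuous f}) ->
  (forall x, A x -> is_derive x 1 F (f x)) ->
  (forall x, A x -> 0 <= f x) -> (forall x, A x -> 0 <= F x <= M) -> 0 <= M ->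
  (\int[leb]_(x in A) (f x)%:E <= M%:E)%E.
Proof.
move=> mA mf uvA Auv cf dF f0 FM M0.
rewrite integral_mkindic.
apply: (@fatou_le _ _ _ leb (fun n x => f x * \1_(`[u n, v n]) x)).
- by move=> n; apply: measurable_funM => //; exact: measurable_indic.
- move=> n x; rewrite indicE mem_setE in_itv/=.
  by have [xuv|_] := boolP (_ <= _ <= _); rewrite ?mulr0// mulr1 f0//; exact: uvA xuv.
- move=> x; apply: cvg_near_cst.
  have [xA|xA] := asboolP (A x).
    near=> n; rewrite !indicE mem_setE in_itv/= (mem_set xA).
    by have -> : u n <= x <= v n by near: n; exact: Auv.
  apply: nearW => n; rewrite !indicE mem_setE in_itv/= (memNset xA).
  by have [/uvA|] := boolP (_ <= _ <= _).
- apply: nearW => n; rewrite -integral_mkindic.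
  have [uv|vu] := ltP (u n) (v n); last first.
    have [uv|] := eqVneq (u n) (v n).
      by rewrite uv set_itv1 integral_set1 lee_fin.
    move=> neq; rewrite set_itv_ge ?integral_set0 ?lee_fin// bnd_simp -ltNge.
    by rewrite lt_neqAle vu eq_sym neq.
  have inA x : x \in `[u n, v n] -> A x by rewrite in_itv/=; exact: uvA.
  have cF x : A x -> F @ x --> F x.
    by move=> /dF dFx; apply: differentiable_continuous; apply/derivable1_diffP; case: dFx.
  have uA : A (u n) by apply: inA; rewrite in_itv/= lexx ltW.
  have vA : A (v n) by apply: inA; rewrite in_itv/= lexx ltW.
  rewrite (@continuous_FTC2 _ f F)//.
  + rewrite -EFinB lee_fin; have /andP[_ FvM] := FM _ vA; have /andP[Fu _] := FM _ uA.
    by apply: le_trans FvM; rewrite gerBl.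
  + apply: continuous_in_subspaceT => x /set_mem/= xuv; exact/cf/inA.
  + split.
    * move=> x xuv; have xA : A x by apply: inA; apply: subset_itv_oo_cc xuv.
      by have [] := dF _ xA.
    * by apply: cvg_at_right_filter; exact: cF.
    * by apply: cvg_at_left_filter; exact: cF.
  + move=> x xuv; have xA : A x by apply: inA; apply: subset_itv_oo_cc xuv.
    by rewrite derive1E; have [] := dF _ xA.
Unshelve. all: by end_near. Qed.

Let near_lt (x y : R) : x < y -> \forall n \near \oo, x + n.+1%:R^-1 <= y.
Proof.
rewrite -subr_gt0 => xy; near=> n; rewrite -lerBrDl; apply: ltW.
by near: n; exact: near_infty_natSinv_lt (PosNum xy).
Unshelve. all: by end_near. Qed.

Let near_ge (x : R) : \forall n \near \oo, x <= n%:R.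
Proof. by apply: nbhs_infty_ger; exact: num_real. Qed.

Lemma integral_oo_le_primitive (c e : R) (f F : R -> R) (M : R) :
  measurable_fun setT f ->
  (forall x, c < x < e -> {for x, continuous f}) ->
  (forall x, c < x < e -> is_derive x 1 F (f x)) ->
  (forall x, c < x < e -> 0 <= f x) ->
  (forall x, c < x < e -> 0 <= F x <= M) -> 0 <= M ->
  (\int[leb]_(x in `]c, e[) (f x)%:E <= M%:E)%E.
Proof.
move=> mf cf dF f0 FM M0.
apply: (@integral_le_primitive _ (fun n => c + n.+1%:R^-1) (fun n => e - n.+1%:R^-1) f F) => //=.
- move=> n x; rewrite in_itv/= => /andP[cx xe].
  by rewrite (lt_le_trans _ cx) ?(le_lt_trans xe)// ?ltrDl ?ltrBlDr ?ltrDl ?invr_gt0.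
- move=> x; rewrite in_itv/= => /andP[cx xe]; near=> n.
  apply/andP; split; first by near: n; exact: near_lt.
  by rewrite lerBrDr; near: n; exact: near_lt.
Unshelve. all: by end_near. Qed.

Lemma integral_oy_le_primitive (c : R) (f F : R -> R) (M : R) :
  measurable_fun setT f ->
  (forall x, c < x -> {for x, continuous f}) ->
  (forall x, c < x -> is_derive x 1 F (f x)) ->
  (forall x, c < x -> 0 <= f x) ->
  (forall x, c < x -> 0 <= F x <= M) -> 0 <= M ->
  (\int[leb]_(x in `]c, +oo[) (f x)%:E <= M%:E)%E.
Proof.
move=> mf cf dF f0 FM M0.
apply: (@integral_le_primitive _ (fun n => c + n.+1%:R^-1) (fun n => n%:R) f F) => //=.
- move=> n x; rewrite in_itv/= andbT => /andP[cx xe].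
  by rewrite (lt_le_trans _ cx)// ltrDl invr_gt0.
- move=> x; rewrite in_itv/= andbT => cx; near=> n.
  apply/andP; split; first by near: n; exact: near_lt.
  by near: n; exact: near_ge.
- by move=> x; rewrite in_itv/= andbT; exact: cf.
- by move=> x; rewrite in_itv/= andbT; exact: dF.
- by move=> x; rewrite in_itv/= andbT; exact: f0.
- by move=> x; rewrite in_itv/= andbT; exact: FM.
Unshelve. all: by end_near. Qed.

Lemma integral_No_le_primitive (e : R) (f F : R -> R) (M : R) :
  measurable_fun setT f ->
  (forall x, x < e -> {for x, continuous f}) ->
  (forall x, x < e -> is_derive x 1 F (f x)) ->
  (forall x, x < e -> 0 <= f x) ->
  (forall x, x < e -> 0 <= F x <= M) -> 0 <= M ->
  (\int[leb]_(x in `]-oo, e[) (f x)%:E <= M%:E)%E.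
Proof.
move=> mf cf dF f0 FM M0.
apply: (@integral_le_primitive _ (fun n => - n%:R) (fun n => e - n.+1%:R^-1) f F) => //=.
- move=> n x; rewrite in_itv/= => /andP[cx xe].
  by rewrite (le_lt_trans xe)// ltrBlDr ltrDl invr_gt0.
- move=> x; rewrite in_itv/= => xe; near=> n.
  apply/andP; split; first by rewrite lerNl; near: n; exact: near_ge.
  by rewrite lerBrDr; near: n; exact: near_lt.
Unshelve. all: by end_near. Qed.

Lemma is_derive_powR_shift (c p x : R) : c < x ->
  is_derive x 1 (fun y => (y - c) `^ p) (p * (x - c) `^ (p - 1)).
Proof.
move=> cx; have xc : 0 < x - c by rewrite subr_gt0.
have h2 : is_derive x 1 (fun y : R => y - c) 1.
  by apply: is_derive_eq; rewrite subr0.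
have := @is_derive1_comp _ _ (fun y : R => y - c) _ _ _ (is_derive1_powR p xc) h2.
by rewrite mulr1.
Qed.

Lemma is_derive_powR_reflect (c p x : R) : x < c ->
  is_derive x 1 (fun y => (c - y) `^ p) (- (p * (c - x) `^ (p - 1))).
Proof.
move=> cx; have xc : 0 < c - x by rewrite subr_gt0.
have h2 : is_derive x 1 (fun y : R => c - y) (-1).
  by apply: is_derive_eq; rewrite add0r mul1r.
have := @is_derive1_comp _ _ (fun y : R => c - y) _ _ _ (is_derive1_powR p xc) h2.
by rewrite mulrN1.
Qed.

Lemma is_derive_continuous (F : R -> R) (x l : R) : is_derive x 1 F l -> {for x, continuous F}.
Proof. by case=> dF _; apply: differentiable_continuous; exact/derivable1_diffP. Qed.

Lemma measurable_powR_shift (c p : R) : measurable_fun setT (fun y : R => (y - c) `^ p).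
Proof.
apply: (measurableT_comp (measurable_powR p)).
exact: measurable_funB.
Qed.

Lemma measurable_powR_reflect (c p : R) : measurable_fun setT (fun y : R => (c - y) `^ p).
Proof.
apply: (measurableT_comp (measurable_powR p)).
exact: measurable_funB.
Qed.

Lemma integral_powR_shift (c e p : R) : c <= e -> 0 < p ->
  (\int[leb]_(x in `]c, e[) ((x - c) `^ (p - 1))%:E <= ((e - c) `^ p / p)%:E)%E.
Proof.
move=> ce p0; have p0' : 0 <= p^-1 by rewrite invr_ge0 ltW.
have pn : p != 0 by rewrite gt_eqF.
pose F (x : R) := p^-1 * (x - c) `^ p.
have dF (x : R) : c < x < e -> is_derive x 1 F ((x - c) `^ (p - 1)).
  move=> /andP[cx _]; have h := is_derive_powR_shift p cx.
  by apply: is_derive_eq; rewrite /GRing.scale/= mulrA mulVf ?mul1r// gt_eqF.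
have cf (x : R) : c < x < e -> {for x, continuous (fun x => (x - c) `^ (p - 1))}.
  by move=> /andP[cx _]; apply: is_derive_continuous; exact: is_derive_powR_shift.
apply: (integral_oo_le_primitive (measurable_powR_shift c (p - 1)) cf dF).
- by move=> x _; exact: powR_ge0.
- move=> x /andP[cx xe]; rewrite mulr_ge0 ?powR_ge0//=.
  rewrite /F mulrC ler_wpM2r//.
  apply: ge0_ler_powR; rewrite ?nnegrE ?subr_ge0 ?(ltW p0)//; try exact: ltW.
  by rewrite lerD2r ltW.
- by rewrite divr_ge0 ?powR_ge0// ltW.
Qed.

Lemma integral_powR_reflect (c e p : R) : c <= e -> 0 < p ->
  (\int[leb]_(x in `]c, e[) ((e - x) `^ (p - 1))%:E <= ((e - c) `^ p / p)%:E)%E.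
Proof.
move=> ce p0; have p0' : 0 <= p^-1 by rewrite invr_ge0 ltW.
have pn : p != 0 by rewrite gt_eqF.
pose F (x : R) := p^-1 * (e - c) `^ p - p^-1 * (e - x) `^ p.
have dF (x : R) : c < x < e -> is_derive x 1 F ((e - x) `^ (p - 1)).
  move=> /andP[_ xe]; have h := is_derive_powR_reflect p xe.
  by apply: is_derive_eq; rewrite /GRing.scale/=; field.
have cf (x : R) : c < x < e -> {for x, continuous (fun x => (e - x) `^ (p - 1))}.
  by move=> /andP[_ xe]; apply: is_derive_continuous; exact: is_derive_powR_reflect.
apply: (integral_oo_le_primitive (measurable_powR_reflect e (p - 1)) cf dF).
- by move=> x _; exact: powR_ge0.
- move=> x /andP[cx xe].
  rewrite /F subr_ge0 lerBlDr [(_ `^ _) / _]mulrC [X in _ && X]lerDl mulr_ge0 ?powR_ge0// andbT.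
  rewrite ler_wpM2l//.
  apply: ge0_ler_powR; rewrite ?nnegrE ?subr_ge0 ?(ltW p0)//; try exact: ltW.
  by rewrite lerD2l lerN2 ltW.
- by rewrite divr_ge0 ?powR_ge0// ltW.
Qed.

Lemma integral_powR_tail (c e p : R) : c < e -> 0 < p ->
  (\int[leb]_(x in `]e, +oo[) ((x - c) `^ (- p - 1))%:E <= ((e - c) `^ (- p) / p)%:E)%E.
Proof.
move=> ce p0; have p0' : 0 <= p^-1 by rewrite invr_ge0 ltW.
have pn : p != 0 by rewrite gt_eqF.
have x_gt x : e < x -> c < x by exact: lt_trans.
pose F (x : R) := p^-1 * (e - c) `^ (- p) - p^-1 * (x - c) `^ (- p).
have dF (x : R) : e < x -> is_derive x 1 F ((x - c) `^ (- p - 1)).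
  move=> /x_gt cx; have h := is_derive_powR_shift (- p) cx.
  by apply: is_derive_eq; rewrite /GRing.scale/=; field.
have cf (x : R) : e < x -> {for x, continuous (fun x => (x - c) `^ (- p - 1))}.
  by move=> /x_gt cx; apply: is_derive_continuous; exact: is_derive_powR_shift.
apply: (integral_oy_le_primitive (measurable_powR_shift c (- p - 1)) cf dF).
- by move=> x _; exact: powR_ge0.
- move=> x ex; have cx := x_gt _ ex.
  rewrite /F subr_ge0 lerBlDr [(_ `^ _) / _]mulrC [X in _ && X]lerDl mulr_ge0 ?powR_ge0// andbT.
  rewrite ler_wpM2l// !powRN.
  rewrite lef_pV2 ?posrE ?powR_gt0 ?subr_gt0//.
  apply: ge0_ler_powR; rewrite ?nnegrE ?subr_ge0 ?(ltW p0)//; try exact: ltW.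
  by rewrite lerD2r ltW.
- by rewrite divr_ge0 ?powR_ge0// ltW.
Qed.

Lemma is_derive_expR_line (a e x : R) :
  is_derive x 1 (fun y : R => expR (- (a * (e - y)))) (a * expR (- (a * (e - x)))).
Proof.
apply: is_derive_eq; rewrite /GRing.scale/= ?mulr1; ring.
Qed.

Lemma continuous_expR_line (a e : R) : continuous (fun y : R => expR (- (a * (e - y)))).
Proof. by move=> x; apply: is_derive_continuous; exact: is_derive_expR_line. Qed.

Lemma measurable_expR_line (a e : R) :
  measurable_fun setT (fun y : R => expR (- (a * (e - y)))).
Proof. by apply: continuous_measurable_fun; exact: continuous_expR_line. Qed.

Let is_derive_expR_line' (a e x : R) : 0 < a ->
  is_derive x 1 (fun y : R => a^-1 * expR (- (a * (e - y)))) (expR (- (a * (e - x)))).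
Proof.
move=> a0; have h := is_derive_expR_line a e x.
by apply: is_derive_eq; rewrite /GRing.scale/= mulrA mulVf ?mul1r// gt_eqF.
Qed.

Let expR_line_bound (a e x : R) : 0 < a -> x < e ->
  0 <= a^-1 * expR (- (a * (e - x))) <= a^-1.
Proof.
move=> a0 xe; rewrite mulr_ge0 ?expR_ge0 ?invr_ge0 ?(ltW a0)//=.
rewrite ler_piMr ?invr_ge0 ?(ltW a0)// -expR0 ler_expR oppr_le0.
by rewrite mulr_ge0 ?(ltW a0)// subr_ge0 ltW.
Qed.

Lemma integral_expR_itv (c e a : R) : c <= e -> 0 < a ->
  (\int[leb]_(x in `]c, e[) (expR (- (a * (e - x))))%:E <= (Num.min a^-1 (e - c))%:E)%E.
Proof.
move=> ce a0; rewrite minEle; case: ifPn => _.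
- apply: (integral_oo_le_primitive (measurable_expR_line a e)
    (fun x _ => @continuous_expR_line a e x) (fun x _ => is_derive_expR_line' e x a0)).
  + by move=> x _; exact: expR_ge0.
  + by move=> x /andP[_ xe]; exact: expR_line_bound.
  + by rewrite invr_ge0 ltW.
- apply: (@le_trans _ _ (\int[leb]_(x in `]c, e[) (cst 1%E x))%E).
    apply: ge0_le_integral => //.
    + by apply/measurable_EFinP; apply: measurable_funTS; exact: measurable_expR_line.
    + move=> x /=; rewrite in_itv/= => /andP[_ xe].
      rewrite lee_fin -expR0 ler_expR oppr_le0.
      by rewrite mulr_ge0 ?(ltW a0)// subr_ge0 ltW.
  rewrite integral_cst//= mul1e lebesgue_measure_itv/= lte_fin.
  by case: ltP => _; rewrite ?lee_fin// subr_ge0.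
Qed.

Lemma integral_expR_ray (e a : R) : 0 < a ->
  (\int[leb]_(x in `]-oo, e[) (expR (- (a * (e - x))))%:E <= a^-1%:E)%E.
Proof.
move=> a0.
apply: (integral_No_le_primitive (measurable_expR_line a e)
    (fun x _ => @continuous_expR_line a e x) (fun x _ => is_derive_expR_line' e x a0)).
- by move=> x _; exact: expR_ge0.
- by move=> x xe; exact: expR_line_bound.
- by rewrite invr_ge0 ltW.
Qed.

End improper_integrals.

Lemma mulr_powR {R : realType} (x r : R) : 0 < x -> x * x `^ r = x `^ (r + 1).
Proof.
move=> x0; rewrite powRD ?powRr1 1?mulrC ?(ltW x0)//.
by rewrite (gt_eqF x0) implybT.
Qed.

(** * Exponentials against power singularities *)

Section kernel_integrals.
Context {R : realType}.
Local Notation leb := (@lebesgue_measure R).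

Lemma integral_le_comb2 (A : set R) (f h1 h2 : R -> R) (k1 k2 M1 M2 : R) :
  measurable A -> measurable_fun setT f ->
  measurable_fun setT h1 -> measurable_fun setT h2 -> 0 <= k1 -> 0 <= k2 ->
  (forall x, A x -> 0 <= f x) ->
  (forall x, A x -> 0 <= h1 x) -> (forall x, A x -> 0 <= h2 x) ->
  (forall x, A x -> f x <= k1 * h1 x + k2 * h2 x) ->
  (\int[leb]_(x in A) (h1 x)%:E <= M1%:E)%E ->
  (\int[leb]_(x in A) (h2 x)%:E <= M2%:E)%E ->
  (\int[leb]_(x in A) (f x)%:E <= (k1 * M1 + k2 * M2)%:E)%E.
Proof.
move=> mA mf m1 m2 k1p k2p f0 h10 h20 fh i1 i2.
have m1E : measurable_fun A (EFin \o h1) by apply/measurable_EFinP; exact: measurable_funTS.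
have m2E : measurable_fun A (EFin \o h2) by apply/measurable_EFinP; exact: measurable_funTS.
apply: (@le_trans _ _ (\int[leb]_(x in A) (k1%:E * (h1 x)%:E + k2%:E * (h2 x)%:E))%E).
  apply: ge0_le_integral => //.
  - by apply/measurable_EFinP; exact: measurable_funTS.
  - by apply: emeasurable_funD; exact: measurable_funeM.
rewrite ge0_integralD//; last 4 first.
- by move=> x xA; rewrite mule_ge0 ?lee_fin// h10.
- exact: measurable_funeM.
- by move=> x xA; rewrite mule_ge0 ?lee_fin// h20.
- exact: measurable_funeM.
rewrite !ge0_integralZl//.
by rewrite EFinD !EFinM leeD// lee_wpmul2l// lee_fin.
Qed.

(** Monotonicity settles r >= 0, and for r < 0 halving the base costs 2^(-r); the factor 2^n covers
    both cases. *)
Lemma powR_le_half (v s r n : R) : 0 < v -> v / 2 <= s <= v -> 0 <= n -> - n <= r ->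
  s `^ r <= 2 `^ n * v `^ r.
Proof.
move=> v0 /andP[vs sv] n0 nr.
have s0 : 0 < s by apply: lt_le_trans vs; rewrite divr_gt0.
have [r0|r0] := leP 0 r.
  rewrite -[leLHS]mul1r ler_pM ?powR_ge0//.
    by rewrite -[leLHS](powRr0 2) ler_powR// ler1n.
  by apply: ge0_ler_powR; rewrite ?nnegrE// ltW.
apply: (@le_trans _ _ (2 `^ (- r) * v `^ r)); last first.
  by rewrite ler_wpM2r ?powR_ge0// ler_powR ?ler1n// lerNl.
have r0' : 0 <= - r by rewrite oppr_ge0 ltW.
have inv x : x `^ r = (x `^ (- r))^-1 by rewrite powRN invrK.
rewrite (inv s) (inv v) ler_pdivlMr ?powR_gt0// mulrC ler_pdivrMr ?powR_gt0//.
rewrite -powRM ?(ltW s0)//; apply: ge0_ler_powR => //.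
- by rewrite nnegrE ltW.
- by rewrite nnegrE mulr_ge0 ?(ltW s0).
- by rewrite mulrC -ler_pdivrMr.
Qed.

Lemma expR_half_le (z : R) : 0 < z -> expR (- (z / 2)) * z <= 2.
Proof.
move=> z0; rewrite expRN mulrC ler_pdivrMr ?expR_gt0//.
rewrite mulrC -ler_pdivrMr//; apply: le_trans (expR_ge1Dx _).
by rewrite lerDr.
Qed.

Lemma expR_half_sqr_le (z : R) : 0 < z -> expR (- (z / 2)) * z * z <= 16.
Proof.
move=> z0; have -> : - (z / 2) = - (z / 2 / 2) + - (z / 2 / 2) by field.
rewrite expRD; have z2 : 0 < z / 2 by rewrite divr_gt0.
have h := expR_half_le z2; have h0 := expR_ge0 (- (z / 2 / 2)).
set e := expR _ in h h0 *.
have h1 : 0 <= e * (z / 2) by rewrite mulr_ge0// ltW.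
have : (e * (z / 2)) * (e * (z / 2)) <= 2 * 2 by rewrite ler_pM.
nra.
Qed.

Section core.
Variables (a c e q : R).
Hypotheses (a0 : 0 < a) (ce : c < e) (hq : 0 <= q <= 1).
Let v := e - c.
Let v0 : 0 < v. Proof. by rewrite subr_gt0. Qed.
Let av0 : 0 < a * v. Proof. exact: mulr_gt0. Qed.

Let expR_le_half x : x < e -> x - c <= v / 2 ->
  expR (- (a * (e - x))) <= expR (- (a * v / 2)).
Proof.
move=> xe xc; rewrite ler_expR lerN2 -mulrA ler_wpM2l ?(ltW a0)//.
by rewrite /v in xc *; lra.
Qed.

Let min_le : Num.min a^-1 v <= v * (a * v) `^ (- q).
Proof.
rewrite -ler_pdivrMl// mulrC.
rewrite -[leRHS]mul1r; apply: powR_le_expr => //.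
- by rewrite ler_pdivrMr// mul1r ge_min lexx orbT.
- rewrite -mulrA (mulrCA v^-1) mulVf ?gt_eqF// mulr1.
  by rewrite -ler_pdivlMr// mul1r ge_min lexx.
Qed.

(* The integrand is split at the midpoint of ]c, e[: on the left half the
   exponential is at most [exp (- a v / 2)], on the right half the power is
   comparable to its value at [v]. *)
Lemma integral_expR_powR p : 0 < p ->
  (\int[leb]_(x in `]c, e[) (expR (- (a * (e - x))) * (x - c) `^ (p - 1))%:E <=
   ((2 / p + 2 `^ 1) * (v `^ p * (a * v) `^ (- q)))%:E)%E.
Proof.
move=> p0.
pose Z := (a * v) `^ (- q).
have Z0 : 0 <= Z by exact: powR_ge0.
apply: (@le_trans _ _ ((2 * Z) * (v `^ p / p) + (2 `^ 1 * v `^ (p - 1)) * (v * Z))%:E); last first.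
  rewrite lee_fin le_eqVlt; apply/orP; left; apply/eqP.
  by rewrite -/Z -(mulr_powRB1 (ltW v0) p0); field; rewrite gt_eqF.
apply: (@integral_le_comb2 _ _ (fun x => (x - c) `^ (p - 1)) (fun x => expR (- (a * (e - x))))) => //.
- apply: measurable_funM; first exact: measurable_expR_line.
  exact: measurable_powR_shift.
- exact: measurable_powR_shift.
- exact: measurable_expR_line.
- by rewrite mulr_ge0.
- by rewrite mulr_ge0 ?powR_ge0.
- by move=> x _; rewrite mulr_ge0 ?expR_ge0 ?powR_ge0.
- by move=> x _; exact: powR_ge0.
- move=> x /=; rewrite in_itv/= => /andP[cx xe].
  have [xc|xc] := leP (x - c) (v / 2).
    apply: ler_wpDr; first by rewrite !mulr_ge0 ?powR_ge0 ?expR_ge0.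
    rewrite ler_wpM2r ?powR_ge0//; apply: (le_trans (expR_le_half xe xc)).
    apply: powR_le_expr => //; last exact: expR_half_le.
    by rewrite (@le_trans _ _ 1) ?ler1n// -expR0 ler_expR oppr_le0 divr_ge0// ltW.
  apply: ler_wpDl; first by rewrite !mulr_ge0 ?powR_ge0.
  rewrite mulrC ler_wpM2r ?expR_ge0//; apply: powR_le_half => //.
    by rewrite (ltW xc)/= /v lerD2r ltW.
  by rewrite lerBrDr addNr ltW.
- by apply: integral_powR_shift => //; exact: ltW.
- apply: (le_trans (integral_expR_itv (ltW ce) a0)).
  by rewrite lee_fin; exact: min_le.
Qed.

(** The factor 1 - exp (- a (x - c)) <= a (x - c) removes one power of the singularity. On the left
    half of ]c, e[ the extra [a] is absorbed by exp (- a v / 2), with the constant 16; on the right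
    half the factor is bounded by 1. *)
Lemma integral_expR_diff kappa : 0 < kappa < 2^-1 ->
  (\int[leb]_(x in `]c, e[)
     (expR (- (a * (e - x))) * (1 - expR (- (a * (x - c)))) * (x - c) `^ (- kappa - 1))%:E <=
   ((16 / (1 - kappa) + 2 `^ 2) * (v `^ (- kappa) * (a * v) `^ (- q)))%:E)%E.
Proof.
move=> /andP[k0 k1].
pose Z := (a * v) `^ (- q).
have Z0 : 0 <= Z by exact: powR_ge0.
have k1' : 0 < 1 - kappa by lra.
have vk : v `^ (- kappa) = v * v `^ (- kappa - 1).
  by rewrite mulr_powR// subrK.
have vk2 : v `^ (1 - kappa) = v * v `^ (- kappa).
  by rewrite mulr_powR// addrC.
apply: (@le_trans _ _ ((16 * Z / v) * (v `^ (1 - kappa) / (1 - kappa))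
    + (2 `^ 2 * v `^ (- kappa - 1)) * (v * Z))%:E); last first.
  rewrite lee_fin le_eqVlt; apply/orP; left; apply/eqP.
  by rewrite -/Z vk2 vk; field; rewrite !gt_eqF.
have one_sub x : c < x -> 0 <= 1 - expR (- (a * (x - c))) <= a * (x - c).
  move=> cx; rewrite subr_ge0 -{1}expR0 ler_expR oppr_le0 mulr_ge0 ?subr_ge0 ?(ltW cx) ?(ltW a0)//=.
  have := expR_ge1Dx (- (a * (x - c))); lra.
apply: (@integral_le_comb2 _ _ (fun x => (x - c) `^ (1 - kappa - 1)) (fun x => expR (- (a * (e - x))))) => //.
- apply: measurable_funM; last exact: measurable_powR_shift.
  apply: measurable_funM; first exact: measurable_expR_line.
  apply: measurable_funB => //; apply: continuous_measurable_fun => x.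
  have h : is_derive x 1 (fun x : R => expR (- (a * (x - c)))) (- a * expR (- (a * (x - c)))).
    by apply: is_derive_eq; rewrite /GRing.scale/=; ring.
  exact: is_derive_continuous h.
- exact: measurable_powR_shift.
- exact: measurable_expR_line.
- by rewrite !mulr_ge0 ?invr_ge0 ?(ltW v0).
- by rewrite mulr_ge0 ?powR_ge0.
- move=> x /=; rewrite in_itv/= => /andP[cx xe].
  by have /andP[h _] := one_sub _ cx; rewrite !mulr_ge0 ?expR_ge0 ?powR_ge0.
- by move=> x _; exact: powR_ge0.
- move=> x /=; rewrite in_itv/= => /andP[cx xe].
  have /andP[h0 h1] := one_sub _ cx.
  have xc0 : 0 < x - c by rewrite subr_gt0.
  have [xc|xc] := leP (x - c) (v / 2).
    apply: ler_wpDr; first by rewrite !mulr_ge0 ?powR_ge0 ?expR_ge0.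
    have -> : (x - c) `^ (1 - kappa - 1) = (x - c) * (x - c) `^ (- kappa - 1).
      by rewrite mulr_powR// subrK addrAC subrr add0r.
    rewrite mulrA ler_wpM2r ?powR_ge0//.
    apply: (@le_trans _ _ (expR (- (a * v / 2)) * (a * (x - c)))).
      by rewrite ler_pM ?expR_ge0// expR_le_half.
    rewrite mulrA ler_wpM2r ?(ltW xc0)// ler_pdivlMr// -[leLHS]mulrA.
    apply: powR_le_expr => //; last by rewrite expR_half_sqr_le.
    by apply: (le_trans (expR_half_le av0)); rewrite ler_nat.
  apply: ler_wpDl; first by rewrite !mulr_ge0 ?powR_ge0 ?invr_ge0 ?(ltW v0).
  rewrite -mulrA [leRHS]mulrC ler_wpM2l ?expR_ge0//.
  apply: (@le_trans _ _ (1 * (x - c) `^ (- kappa - 1))).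
    by rewrite ler_wpM2r ?powR_ge0// gerBl expR_ge0.
  rewrite mul1r; apply: powR_le_half => //; last lra.
  by rewrite (ltW xc)/= /v lerD2r ltW.
- by apply: integral_powR_shift => //; exact: ltW.
- apply: (le_trans (integral_expR_itv (ltW ce) a0)).
  by rewrite lee_fin; exact: min_le.
Qed.

End core.

(** The ray is split at the right end [t] of the window, beyond which the integrands below take a
    different form. *)
Lemma normr_Rintegral_ray_le (f h1 h2 : R -> R) (y t M1 M2 : R) :
  y < t -> measurable_fun setT f ->
  measurable_fun setT h1 -> measurable_fun setT h2 ->
  (forall x, y < x < t -> `|f x| <= h1 x) ->
  (forall x, t < x -> `|f x| <= h2 x) ->
  (\int[leb]_(x in `]y, t[) (h1 x)%:E <= M1%:E)%E ->
  (\int[leb]_(x in `]t, +oo[) (h2 x)%:E <= M2%:E)%E ->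
  `|\int[leb]_(x in `]y, +oo[) f x| <= M1 + M2.
Proof.
move=> yt mf mh1 mh2 fh1 fh2 i1 i2.
have mfA A : measurable_fun A (fun x => `|(f x)%:E|%E).
  by apply: measurableT_comp => //; apply/measurable_EFinP; exact: measurable_funTS.
have bnd : (\int[leb]_(x in `]y, +oo[) `|(f x)%:E| <= (M1 + M2)%:E)%E.
  rewrite (@itv_bndbnd_setU _ _ _ (BRight t))//= ?bnd_simp; last exact: ltW.
  rewrite ge0_integral_setU//=; last first.
    apply/disj_setPS => x [] /=; rewrite !in_itv/= andbT => /andP[_ xt] tx.
    by move: (le_lt_trans xt tx); rewrite ltxx.
  - by apply/measurable_EFinP; apply: measurableT_comp => //; exact: measurable_funTS.
  rewrite -integral_itv_bndo_bndc// EFinD leeD//.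
    apply: le_trans i1; apply: ge0_le_integral => //.
    + by apply/measurable_EFinP; apply: measurableT_comp => //; exact: measurable_funTS.
    + by apply/measurable_EFinP; exact: measurable_funTS.
  apply: le_trans i2; apply: ge0_le_integral => //.
  + by apply/measurable_EFinP; apply: measurableT_comp => //; exact: measurable_funTS.
  + by apply/measurable_EFinP; exact: measurable_funTS.
  + by move=> x /=; rewrite in_itv/= andbT lee_fin; exact: fh2.
have mfE : measurable_fun `]y, +oo[ (EFin \o f).
  by apply/measurable_EFinP; exact: measurable_funTS.
have := le_trans (le_abse_integral leb (measurable_itv _) mfE) bnd.
have MM : 0 <= M1 + M2.
  by rewrite -lee_fin; apply: le_trans bnd; exact: integral_ge0.
by rewrite /Rintegral /=; case: (integral _ _ _) => [r| |]//=; rewrite normr0.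
Qed.

End kernel_integrals.

(** * Size of the noise kernel *)

Section noise_kernel.
Context {R : realType}.
Local Notation leb := (@lebesgue_measure R).
Variables mu T : R.
Hypotheses (mu0 : 0 < mu) (T0 : 0 < T).

Definition exp_window (a t : R) : R -> R :=
  fun s => expR (- (a * (t - s))) * \1_(`[0, t]) s.

Lemma measurable_exp_window a t : measurable_fun setT (exp_window a t).
Proof. by apply: measurable_funM; [exact: measurable_expR_line|exact: measurable_indic]. Qed.

Lemma exp_windowE a t s : 0 <= s <= t -> exp_window a t s = expR (- (a * (t - s))).
Proof. by move=> h; rewrite /exp_window indicE mem_setE in_itv/= h mulr1. Qed.

Lemma exp_window_gt a t s : t < s -> exp_window a t s = 0.
Proof.
by move=> h; rewrite /exp_window indicE mem_setE in_itv/= [s <= t]leNgt h andbF mulr0.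
Qed.

Lemma exp_window_lt0 a t s : s < 0 -> exp_window a t s = 0.
Proof. by move=> h; rewrite /exp_window indicE mem_setE in_itv/= [0 <= s]leNgt h mulr0. Qed.

Let measurable_expR_mu y : measurable_fun setT (fun x : R => expR (- (mu * (x - y)))).
Proof.
rewrite (_ : (fun x : R => _) = (fun x : R => expR (- (- mu * (y - x))))).
  exact: measurable_expR_line.
by apply/funext => x; congr expR; ring.
Qed.

Let integral_le_scale (A : set R) (h : R -> R) (k M : R) : measurable A ->
  measurable_fun setT h -> 0 <= k -> (forall x, A x -> 0 <= h x) ->
  (\int[leb]_(x in A) (h x)%:E <= M%:E)%E ->
  (\int[leb]_(x in A) (k * h x)%:E <= (k * M)%:E)%E.
Proof.
move=> mA mh k0 h0 hM; rewrite -[X in X%:E]addr0 -[in leRHS](mul0r M).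
apply: (@integral_le_comb2 _ _ _ h h) => //.
- exact: measurable_funM.
- by move=> x xA; rewrite mulr_ge0// h0.
- by move=> x xA; rewrite mul0r addr0.
Qed.

Lemma tempered_int_window_ge kappa a t y : t <= y ->
  tempered_int kappa mu (exp_window a t) y = 0.
Proof.
move=> ty; rewrite /tempered_int.
transitivity ((Gamma kappa)^-1 * \int[leb]_(x in `]y, +oo[) 0).
  congr (_ * _); apply: eq_Rintegral => x; rewrite inE/= in_itv/= andbT => yx.
  by rewrite exp_window_gt ?mul0r// (le_lt_trans ty).
by rewrite /Rintegral integral0 mulr0.
Qed.

(** Only x in [0, t] contributes, where t - x <= T; so the tempering weight in x - y becomes one in
    t - y at the price of exp (mu T), and [integral_expR_powR] does the rest. *)
Lemma tempered_int_window_le kappa a q t y : 0 < kappa -> 0 < a ->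
  0 <= q <= 1 -> 0 <= t <= T -> y < t ->
  `|tempered_int kappa mu (exp_window a t) y| <=
    `|(Gamma kappa)^-1| * (expR (mu * T) * (2 / kappa + 2 `^ 1)) *
    ((t - y) `^ kappa * (a * (t - y)) `^ (- q)) * expR (- (mu * (t - y))).
Proof.
move=> k0 a0 hq /andP[t0 tT] yt.
set W := _ `^ kappa * _.
pose k := expR (mu * T) * expR (- (mu * (t - y))).
have k0' : 0 <= k by rewrite mulr_ge0 ?expR_ge0.
have -> : `|(Gamma kappa)^-1| * (expR (mu * T) * (2 / kappa + 2 `^ 1)) * W
    * expR (- (mu * (t - y))) =
  `|(Gamma kappa)^-1| * (k * ((2 / kappa + 2 `^ 1) * W) + 0).
  by rewrite /k; ring.
rewrite /tempered_int normrM ler_wpM2l//.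
apply: (@normr_Rintegral_ray_le _ _
  (fun x => k * (expR (- (a * (t - x))) * (x - y) `^ (kappa - 1))) (cst 0) y t) => //.
- apply: measurable_funM => //; apply: measurable_funM; last exact: measurable_powR_shift.
  exact: measurable_exp_window.
- apply: measurable_funM => //; apply: measurable_funM; last exact: measurable_powR_shift.
  exact: measurable_expR_line.
- move=> x /andP[yx xt].
  have [x0|x0] := ltP x 0.
    rewrite exp_window_lt0// !mul0r normr0.
    by rewrite !mulr_ge0 ?expR_ge0 ?powR_ge0.
  rewrite exp_windowE ?x0 ?(ltW xt)//.
  rewrite ger0_norm ?mulr_ge0 ?expR_ge0 ?powR_ge0// mulrC ler_wpM2r//.
    by rewrite mulr_ge0 ?expR_ge0 ?powR_ge0.
  rewrite /k -expRD ler_expR.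
  have : mu * (t - x) <= mu * T by rewrite ler_wpM2l ?(ltW mu0)//; lra.
  by lra.
- move=> x tx; rewrite exp_window_gt// !mul0r normr0//.
- apply: integral_le_scale => //.
  + apply: measurable_funM; first exact: measurable_expR_line.
    exact: measurable_powR_shift.
  + by move=> x _; rewrite mulr_ge0 ?expR_ge0 ?powR_ge0.
  + exact: integral_expR_powR.
- by rewrite integral0.
Qed.

Lemma tempered_der_window_gt kappa a t y : t < y ->
  tempered_der kappa mu (exp_window a t) y = 0.
Proof.
move=> ty; rewrite /tempered_der exp_window_gt// mulr0 add0r.
transitivity (kappa / Gamma (1 - kappa) * \int[leb]_(x in `]y, +oo[) 0).
  congr (_ * _); apply: eq_Rintegral => x; rewrite inE/= in_itv/= andbT => yx.
  by rewrite exp_window_gt ?subrr ?mul0r// (lt_trans ty).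
by rewrite /Rintegral integral0 mulr0.
Qed.

Let measurable_der_integrand kappa a t y : measurable_fun setT (fun x : R =>
  (exp_window a t y - exp_window a t x) / (x - y) `^ (kappa + 1) * expR (- (mu * (x - y)))).
Proof.
apply: measurable_funM => //; apply: measurable_funM.
  by apply: measurable_funB => //; exact: measurable_exp_window.
under eq_fun do rewrite -powRN; exact: measurable_powR_shift.
Qed.

Let expR_mu_le1 x y : y < x -> expR (- (mu * (x - y))) <= 1.
Proof.
by move=> yx; rewrite -expR0 ler_expR oppr_le0 mulr_ge0 ?(ltW mu0)// subr_ge0 ltW.
Qed.

Let der_powE (kappa z : R) : (z `^ (kappa + 1))^-1 = z `^ (- kappa - 1).
Proof. by rewrite -powRN opprD. Qed.

(** Three contributions: the local term, where t - y <= T makes up for the missing negative power;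
    the difference of exponentials on ]y, t[; and the jump of the window to 0 after t, whose tail
    gives the term 2 / kappa. *)
Lemma tempered_der_window_le kappa a q t y : 0 < kappa < 2^-1 -> 0 < a ->
  0 <= q <= 1 -> t <= T -> 0 <= y -> y < t ->
  `|tempered_der kappa mu (exp_window a t) y| <=
    (mu `^ kappa * T `^ kappa * 2 + `|kappa / Gamma (1 - kappa)| *
      (16 / (1 - kappa) + 2 `^ 2 + 2 / kappa)) *
    ((t - y) `^ (- kappa) * (a * (t - y)) `^ (- q)).
Proof.
move=> /[dup] hk /andP[k0 k1] a0 hq tT y0 yt.
have v0 : 0 < t - y by rewrite subr_gt0.
have av0 : 0 < a * (t - y) by rewrite mulr_gt0.
set Z := _ `^ (- q); set V := _ `^ (- kappa).
have Z0 : 0 <= Z by exact: powR_ge0.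
have V0 : 0 <= V by exact: powR_ge0.
have eZ : expR (- (a * (t - y))) <= 2 * Z.
  apply: powR_le_expr => //.
    by rewrite (@le_trans _ _ 1) ?ler1n// -expR0 ler_expR oppr_le0 ltW.
  apply: le_trans (expR_half_le av0); rewrite ler_wpM2r ?(ltW av0)//.
  by rewrite ler_expR lerN2 ler_pdivrMr// ler_peMr ?(ltW av0)// ler1n.
rewrite mulrDl; apply: (le_trans (ler_normD _ _)); apply: lerD.
  rewrite exp_windowE ?y0 ?(ltW yt)// ger0_norm ?mulr_ge0 ?powR_ge0 ?expR_ge0//.
  rewrite -!mulrA ler_wpM2l ?powR_ge0//.
  apply: (le_trans eZ).
  rewrite (_ : _ * (2 * (V * Z)) = (T `^ kappa * V) * (2 * Z)); last by ring.
  rewrite ler_peMl ?mulr_ge0// /V powRN ler_pdivlMr ?powR_gt0// mul1r.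
  by apply: ge0_ler_powR; rewrite ?nnegrE ?(ltW k0) ?(ltW v0) ?(ltW T0)//; lra.
rewrite normrM -mulrA ler_wpM2l//.
rewrite (_ : _ * (V * Z) = (16 / (1 - kappa) + 2 `^ 2) * (V * Z) + 2 * Z * (V / kappa)); last first.
  by rewrite mulrDl; congr (_ + _); ring.
apply: (@normr_Rintegral_ray_le _ _
  (fun x => expR (- (a * (t - x))) * (1 - expR (- (a * (x - y)))) * (x - y) `^ (- kappa - 1))
  (fun x => 2 * Z * (x - y) `^ (- kappa - 1)) y t) => //.
- apply: measurable_funM; last exact: measurable_powR_shift.
  apply: measurable_funM; first exact: measurable_expR_line.
  apply: measurable_funB => //; rewrite (_ : (fun x : R => _) = (fun x : R => expR (- (- a * (y - x))))).
    exact: measurable_expR_line.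
  by apply/funext => x; congr expR; ring.
- by apply: measurable_funM => //; exact: measurable_powR_shift.
- move=> x /andP[yx xt].
  rewrite !exp_windowE ?y0 ?(ltW xt) ?(ltW yt) ?(ltW (le_lt_trans y0 yx))//.
  rewrite der_powE !normrM [`|_ `^ _|]ger0_norm ?powR_ge0// [`|expR (- (mu * _))|]ger0_norm ?expR_ge0//.
  apply: (@le_trans _ _ (`|expR (- (a * (t - y))) - expR (- (a * (t - x)))| * (x - y) `^ (- kappa - 1) * 1)).
    by rewrite ler_wpM2l ?expR_mu_le1// mulr_ge0 ?powR_ge0.
  rewrite mulr1 ler_wpM2r ?powR_ge0//.
  rewrite (_ : - (a * (t - y)) = - (a * (t - x)) + - (a * (x - y))); last by ring.
  rewrite expRD distrC -[X in `|X - _|]mulr1 -mulrBr ger0_norm// mulr_ge0 ?expR_ge0// subr_ge0.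
  by rewrite -{1}expR0 ler_expR oppr_le0 mulr_ge0 ?(ltW a0)// subr_ge0 ltW.
- move=> x tx; rewrite exp_windowE ?y0 ?(ltW yt)// exp_window_gt// subr0.
  rewrite der_powE !ger0_norm ?mulr_ge0 ?expR_ge0 ?powR_ge0//.
  apply: (@le_trans _ _ (expR (- (a * (t - y))) * (x - y) `^ (- kappa - 1) * 1)).
    by rewrite ler_wpM2l ?expR_mu_le1 ?(lt_trans yt)// mulr_ge0 ?powR_ge0 ?expR_ge0.
  by rewrite mulr1 ler_wpM2r ?powR_ge0.
- exact: integral_expR_diff.
- apply: integral_le_scale => //.
  + exact: measurable_powR_shift.
  + by rewrite mulr_ge0.
  + by move=> x _; exact: powR_ge0.
  + exact: integral_powR_tail.
Qed.

(* For [y < 0 <= x] the singularity is weakened by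
   [(x - y)^(- kappa - 1) <= (- y)^(- kappa - q) * (x - y)^(q - 1)]. *)
Lemma tempered_der_window_lt0 kappa a q t y : 0 < kappa -> 0 < a ->
  0 < q <= 1 -> 0 <= t -> y < 0 ->
  `|tempered_der kappa mu (exp_window a t) y| <=
    `|kappa / Gamma (1 - kappa)| * (2 / q + 2 `^ 1) *
    ((- y) `^ (- kappa) * (a * (- y)) `^ (- q)) * expR (- (mu * (- y))).
Proof.
move=> k0 a0 /andP[q0 q1] t0 y0.
have yt : y < t by exact: lt_le_trans t0.
have r0 : 0 < - y by rewrite oppr_gt0.
rewrite /tempered_der exp_window_lt0// mulr0 add0r.
pose k := expR (- (mu * (- y))) * (- y) `^ (- kappa - q).
have k0' : 0 <= k by rewrite mulr_ge0 ?expR_ge0 ?powR_ge0.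
have -> : `|kappa / Gamma (1 - kappa)| * (2 / q + 2 `^ 1) *
    ((- y) `^ (- kappa) * (a * (- y)) `^ (- q)) * expR (- (mu * (- y))) =
  `|kappa / Gamma (1 - kappa)| *
    (k * ((2 / q + 2 `^ 1) * ((t - y) `^ q * (a * (t - y)) `^ (- q))) + 0).
  have -> : (t - y) `^ q * (a * (t - y)) `^ (- q) = a `^ (- q).
    rewrite powRM ?(ltW a0) ?subr_ge0 ?(ltW yt)// mulrCA -powRD ?subrr ?powRr0 ?mulr1//.
    by rewrite eqxx /= gt_eqF// subr_gt0.
  rewrite powRM ?(ltW a0) ?(ltW r0)// /k [(- y) `^ (- kappa - q)]powRD ?(gt_eqF r0) ?implybT//.
  by ring.
rewrite normrM ler_wpM2l//.
apply: (@normr_Rintegral_ray_le _ _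
  (fun x => k * (expR (- (a * (t - x))) * (x - y) `^ (q - 1))) (cst 0) y t) => //.
- have := measurable_der_integrand kappa a t y.
  by under eq_fun do rewrite exp_window_lt0//.
- apply: measurable_funM => //; apply: measurable_funM; last exact: measurable_powR_shift.
  exact: measurable_expR_line.
- move=> x /andP[yx xt].
  have [x0|x0] := ltP x 0.
    rewrite exp_window_lt0// subr0 !mul0r normr0.
    by rewrite !mulr_ge0 ?expR_ge0 ?powR_ge0.
  have xy : 0 < x - y by rewrite subr_gt0.
  rewrite exp_windowE ?x0 ?(ltW xt)// sub0r der_powE mulNr mulNr normrN.
  rewrite ger0_norm ?mulr_ge0 ?expR_ge0 ?powR_ge0//.
  rewrite (_ : k * _ = expR (- (a * (t - x))) *
    ((- y) `^ (- kappa - q) * (x - y) `^ (q - 1)) * expR (- (mu * - y))); last first.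
    by rewrite /k; ring.
  apply: ler_pM; rewrite ?mulr_ge0 ?expR_ge0 ?powR_ge0//.
    rewrite ler_wpM2l ?expR_ge0//.
    have -> : - kappa - 1 = (- kappa - q) + (q - 1) by ring.
    rewrite [(x - y) `^ (_ + _)]powRD ?(gt_eqF xy) ?implybT// ler_wpM2r ?powR_ge0//.
    rewrite -opprD !powRN lef_pV2 ?posrE ?powR_gt0//.
    apply: ge0_ler_powR; rewrite ?nnegrE ?addr_ge0 ?(ltW k0) ?(ltW q0) ?(ltW r0) ?(ltW xy)//.
    by lra.
  rewrite ler_expR lerN2 ler_wpM2l ?(ltW mu0)//; lra.
- by move=> x tx; rewrite exp_window_gt// subr0 !mul0r normr0.
- apply: integral_le_scale => //.
  + apply: measurable_funM; first exact: measurable_expR_line.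
    exact: measurable_powR_shift.
  + by move=> x _; rewrite mulr_ge0 ?expR_ge0 ?powR_ge0.
  + by apply: integral_expR_powR; rewrite ?(ltW q0).
- by rewrite integral0.
Qed.

Variable H : R.
Hypotheses (H0 : 0 < H) (H2 : H <> 2^-1).

Definition noise_kernel (a t : R) : R -> R := fun y =>
  (if 2^-1 < H then tempered_int (H - 2^-1) mu (exp_window a t) y
   else tempered_der (2^-1 - H) mu (exp_window a t) y)
  - mu * tempered_int (H + 2^-1) mu (exp_window a t) y.

(** [v] is the distance to a singular point. Only half of the tempering rate is kept: the other half
    pays for the additional power of [v] in the integral of order H + 1/2. *)
Definition kernel_majorant (a q v : R) : R :=
  if 0 < v then v `^ (H - 2^-1) * (a * v) `^ (- q) * expR (- (mu * v / 2)) else 0.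

Lemma kernel_majorant_ge0 a q v : 0 <= kernel_majorant a q v.
Proof. by rewrite /kernel_majorant; case: ifP => // _; rewrite !mulr_ge0 ?powR_ge0 ?expR_ge0. Qed.

Let tempered_int_majorant : exists2 C : R, 0 <= C & forall a q t y, 0 < a ->
  0 <= q <= 1 -> 0 <= t <= T ->
  `|mu * tempered_int (H + 2^-1) mu (exp_window a t) y| <= C * kernel_majorant a q (t - y).
Proof.
have k0 : 0 < H + 2^-1 by rewrite addr_gt0.
pose C := `|(Gamma (H + 2^-1))^-1| * (expR (mu * T) * (2 / (H + 2^-1) + 2 `^ 1)).
have C0 : 0 <= C by rewrite !mulr_ge0 ?expR_ge0// addr_ge0 ?powR_ge0// divr_ge0// ltW.
exists (2 * C) => [|a q t y a0 hq ht]; first by rewrite mulr_ge0.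
rewrite /kernel_majorant subr_gt0; case: ltP => yt; last first.
  by rewrite tempered_int_window_ge// !mulr0 normr0.
have v0 : 0 < t - y by rewrite subr_gt0.
have := tempered_int_window_le k0 a0 hq ht yt; rewrite -/C => h.
rewrite normrM (gtr0_norm mu0).
apply: (le_trans (ler_wpM2l (ltW mu0) h)).
set v := t - y in v0 *; set Z := (a * v) `^ (- q).
rewrite (_ : H + 2^-1 = (H - 2^-1) + 1); last by field.
rewrite -mulr_powR//.
have -> : - (mu * v) = - (mu * v / 2) + - (mu * v / 2) by field.
rewrite expRD.
have := expR_half_le (mulr_gt0 mu0 v0).
set e := expR _ => e2.
rewrite [leLHS](_ : _ = C * (v `^ (H - 2^-1) * Z * e) * (e * (mu * v))); last by ring.
rewrite [leRHS](_ : _ = C * (v `^ (H - 2^-1) * Z * e) * 2); last by ring.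
apply: ler_wpM2l => //; apply: mulr_ge0 => //.
by rewrite !mulr_ge0 ?powR_ge0 ?expR_ge0.
Qed.

Let expR_le_half x : 0 <= x -> expR (- (mu * x)) <= expR (- (mu * x / 2)).
Proof. by move=> x0; rewrite ler_expR lerN2 ler_pdivrMr// ler_peMr ?ler1n// mulr_ge0// ltW. Qed.

(** For H < 1/2 the jump of the window at 0 creates a second singularity, seen from y < 0, with a
    constant 2 / q; the condition H / 2 <= q keeps it below 4 / H. At y = t the fractional
    derivative has a nonzero value while the majorants vanish, so this point is left out. *)
Lemma noise_kernel_le : exists2 C : R, 0 <= C & forall a q t y, 0 < a ->
  0 <= q <= 1 -> (H < 2^-1 -> H / 2 <= q) -> 0 <= t <= T -> y != t ->
  `|noise_kernel a t y| <= C * (kernel_majorant a q (t - y) + kernel_majorant a q (0 - y)).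
Proof.
have [C1 C10 C1P] := tempered_int_majorant.
rewrite /noise_kernel; have [H12|H12] := ltP 2^-1 H.
  have k0 : 0 < H - 2^-1 by rewrite subr_gt0.
  pose C := `|(Gamma (H - 2^-1))^-1| * (expR (mu * T) * (2 / (H - 2^-1) + 2 `^ 1)).
  have C0 : 0 <= C by rewrite !mulr_ge0 ?expR_ge0// addr_ge0 ?powR_ge0// divr_ge0// ltW.
  exists (C + C1) => [|a q t y a0 hq _ ht _]; first by rewrite addr_ge0.
  apply: (@le_trans _ _ ((C + C1) * kernel_majorant a q (t - y))); last first.
    by rewrite ler_wpM2l ?addr_ge0// lerDl kernel_majorant_ge0.
  apply: (le_trans (ler_normB _ _)); rewrite mulrDl; apply: lerD; last exact: C1P.
  rewrite /kernel_majorant subr_gt0; case: ltP => yt; last first.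
    by rewrite tempered_int_window_ge// mulr0 normr0.
  apply: (le_trans (tempered_int_window_le k0 a0 hq ht yt)).
  rewrite -/C [leRHS]mulrA; apply: ler_wpM2l.
    by do 2! apply: mulr_ge0 => //; exact: powR_ge0.
  by apply: expR_le_half; rewrite subr_ge0 ltW.
have {}H12 : H < 2^-1 by rewrite lt_neqAle H12 andbT; apply/eqP.
have k0 : 0 < 2^-1 - H by rewrite subr_gt0.
have k1 : 2^-1 - H < 2^-1 by rewrite gtrBl.
pose G := `|(2^-1 - H) / Gamma (1 - (2^-1 - H))|.
(* For 0 <= y < t the derivative bound carries no tempering; as t - y <= T, the last factor
   compensates for the one in the majorant. *)
pose C := (mu `^ (2^-1 - H) * T `^ (2^-1 - H) * 2 + G *
      (16 / (1 - (2^-1 - H)) + 2 `^ 2 + 2 / (2^-1 - H))) * expR (mu * T / 2).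
pose C2 := G * (4 / H + 2 `^ 1).
have C0 : 0 <= C.
  apply: mulr_ge0; last exact: expR_ge0.
  apply: addr_ge0; first by rewrite !mulr_ge0 ?powR_ge0.
  apply: mulr_ge0; first exact: normr_ge0.
  apply: addr_ge0; last by rewrite divr_ge0// ltW.
  by apply: addr_ge0; [apply: divr_ge0 => //; lra|exact: powR_ge0].
have C20 : 0 <= C2.
  apply: mulr_ge0; first exact: normr_ge0.
  by rewrite addr_ge0 ?powR_ge0// divr_ge0// ltW.
exists (C + C2 + C1) => [|a q t y a0 hq Hq ht yt]; first by rewrite !addr_ge0.
have /andP[q0 q1] := hq.
have q0' : 0 < q by apply: lt_le_trans (Hq H12); rewrite divr_gt0.
have /andP[t0 tT] := ht.
set M1 := kernel_majorant a q (t - y); set M2 := kernel_majorant a q (0 - y).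
have M10 : 0 <= M1 by exact: kernel_majorant_ge0.
have M20 : 0 <= M2 by exact: kernel_majorant_ge0.
suff h : `|tempered_der (2^-1 - H) mu (exp_window a t) y| <= C * M1 + C2 * M2.
  apply: (le_trans (ler_normB _ _)); apply: (le_trans (lerD h (C1P a q t y a0 hq ht))).
  rewrite -/M1; nra.
have HE : H - 2^-1 = - (2^-1 - H) by rewrite opprB.
have [yt'|ty|] := ltgtP y t; last by move/eqP; rewrite (negbTE yt).
  have v0 : 0 < t - y by rewrite subr_gt0.
  have [y0|y0] := ltP y 0.
    apply: ler_wpDl; first by rewrite mulr_ge0.
    rewrite /M2 /kernel_majorant sub0r oppr_gt0 y0 HE.
    have := @tempered_der_window_lt0 (2^-1 - H) a q t y k0 a0 _ t0 y0.
    rewrite q0' q1 => /(_ isT) h; apply: (le_trans h).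
    have r0 : 0 <= - y by rewrite oppr_ge0 ltW.
    rewrite [leRHS]mulrA -/G; apply: ler_pM; rewrite ?mulr_ge0 ?powR_ge0 ?expR_ge0 ?expR_le_half//.
    - exact: normr_ge0.
    - by rewrite addr_ge0 ?powR_ge0// divr_ge0// ltW.
    rewrite ler_wpM2r ?mulr_ge0 ?powR_ge0// /C2 ler_wpM2l ?normr_ge0// lerD2r.
    rewrite ler_pdivrMr// mulrAC ler_pdivlMr//.
    by have := Hq H12; lra.
  apply: ler_wpDr; first by rewrite mulr_ge0.
  rewrite /M1 /kernel_majorant v0 HE.
  have hk : 0 < 2^-1 - H < 2^-1 by rewrite k0.
  apply: (le_trans (tempered_der_window_le hk a0 hq tT y0 yt')).
  rewrite /C -/G -[leRHS]mulrA ler_wpM2l//.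
    have : 0 <= C / expR (mu * T / 2) by rewrite divr_ge0 ?expR_ge0.
    by rewrite /C mulfK// gt_eqF// expR_gt0.
  rewrite mulrCA ler_peMr ?mulr_ge0 ?powR_ge0//.
  rewrite -expRD -[leLHS]expR0 ler_expR.
  have : mu * (t - y) <= mu * T by rewrite ler_wpM2l ?(ltW mu0)//; lra.
  by lra.
rewrite tempered_der_window_gt// normr0 addr_ge0// mulr_ge0//.
Qed.

(** Since ln x <= x, (c v)^(2 H) <= exp (2 H c v); this [c] makes the exponent mu v / 2. *)
Let c := mu / 2 / (2 * H).

Let powR_le_expR v : 0 < v -> v `^ (2 * H) <= c `^ (- (2 * H)) * expR (mu / 2 * v).
Proof.
move=> v0; have c0 : 0 < c by rewrite !divr_gt0// mulr_gt0.
rewrite powRN ler_pdivlMl ?powR_gt0// -powRM ?(ltW v0) ?(ltW c0)//.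
have cv0 : 0 < c * v by rewrite mulr_gt0.
rewrite /powR gt_eqF// ler_expR.
have -> : mu / 2 * v = 2 * H * (c * v).
  by rewrite /c; field; rewrite gt_eqF.
rewrite ler_wpM2l ?mulr_ge0 ?(ltW H0)//.
have := expR_ge1Dx (ln (c * v)); rewrite lnK ?posrE// => h.
by apply: le_trans h; rewrite lerDr.
Qed.

(** The singularity within distance 1 of [e] gives 1 / p. Farther away the power is at most (e -
    y)^(2 H), which half of the exponential absorbs, so that [C] does not depend on [p]. *)
Lemma integral_powR_expR_ray : exists2 C : R, 0 <= C & forall p e, 0 < p <= 2 * H ->
  (\int[leb]_(y in `]-oo, e[) ((e - y) `^ (p - 1) * expR (- (mu * (e - y))))%:E
    <= (1 / p + C)%:E)%E.
Proof.
have mu2 : 0 < mu / 2 by rewrite divr_gt0.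
exists (c `^ (- (2 * H)) * (mu / 2)^-1).
  by rewrite mulr_ge0 ?powR_ge0// invr_ge0 ltW.
move=> p e /andP[p0 pH].
rewrite -[1 / p]mul1r.
apply: (@integral_le_comb2 _ _ _ (fun y => (e - y) `^ (p - 1) * \1_(`]e - 1, e[) y)
  (fun y => expR (- (mu / 2 * (e - y))))) => //.
- by apply: measurable_funM; [exact: measurable_powR_reflect|exact: measurable_expR_line].
- by apply: measurable_funM; [exact: measurable_powR_reflect|exact: measurable_indic].
- exact: measurable_expR_line.
- exact: powR_ge0.
- by move=> x _; rewrite mulr_ge0 ?powR_ge0 ?expR_ge0.
- by move=> x _; rewrite mulr_ge0 ?powR_ge0// indicE.
- move=> y /=; rewrite in_itv/= => ye.
  have v0 : 0 < e - y by rewrite subr_gt0.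
  rewrite mul1r indicE mem_setE in_itv/= ye andbT; have [ey|ey] := ltP (e - 1) y.
    rewrite mulr1 ler_wpDr ?mulr_ge0 ?powR_ge0 ?expR_ge0//.
    rewrite ler_piMr ?powR_ge0// -expR0 ler_expR oppr_le0 mulr_ge0 ?(ltW mu0)// ltW//.
  rewrite mulr0 add0r.
  have -> : - (mu * (e - y)) = - (mu / 2 * (e - y)) + - (mu / 2 * (e - y)) by field.
  rewrite expRD mulrA ler_wpM2r ?expR_ge0//.
  rewrite expRN ler_pdivrMr ?expR_gt0//.
  apply: le_trans (powR_le_expR v0).
  by rewrite ler_powR//; lra.
- rewrite integral_mkindic.
  apply: (@le_trans _ _ (\int[leb]_(y in `](e - 1)%R, e[) ((e - y) `^ (p - 1))%:E)%E).
    rewrite [leRHS]integral_mkindic le_eqVlt; apply/orP; left; apply/eqP.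
    apply: eq_integral => y _; congr EFin; rewrite -mulrA; congr (_ * _).
    by rewrite !indicE !mem_setE !in_itv/= -natrM mulnb; case: (y < e); rewrite ?andbF ?andbT.
  have e1 : e - 1 <= e by rewrite gerBl.
  apply: (le_trans (integral_powR_reflect e1 p0)).
  by rewrite opprB addrC subrK powR1.
- exact: integral_expR_ray.
Qed.

Lemma kernel_majorant_sqr a q v : 0 < a -> 0 < v ->
  kernel_majorant a q v ^+ 2 =
  a `^ (- (2 * q)) * (v `^ (2 * (H - q) - 1) * expR (- (mu * v))).
Proof.
move=> a0 v0; rewrite /kernel_majorant v0.
have sq x r : x `^ r ^+ 2 = x `^ (2 * r) by rewrite -powR_mulrn ?powR_ge0// -powRrM mulrC.
rewrite powRM ?(ltW a0) ?(ltW v0)// !exprMn !sq -expRM_natl.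
rewrite (_ : 2 * (H - q) - 1 = 2 * (H - 2^-1) + 2 * - q); last by field.
rewrite powRD ?(gt_eqF v0) ?implybT// mulrN.
rewrite (_ : 2%:R * - (mu * v / 2) = - (mu * v)); last by field.
by ring.
Qed.

Local Notation m := (Num.min H 1).

(** The squared majorant behaves like v^(2 (H - q) - 1) and integrates to 1 / (2 (H - q)). The
    minimum with 1 appears because the interpolation behind the majorant requires q <= 1. *)
Lemma noise_kernel_dot : exists2 C : R, 0 < C & forall a q t, 0 < a ->
  m / 2 <= q -> q < m -> 0 <= t <= T ->
  noise_kernel a t \in Lfun leb 2%:E ->
  dot leb (noise_kernel a t) (noise_kernel a t) <= C / (m - q) * a `^ (- (2 * q)).
Proof.
have [C C0 CP] := noise_kernel_le.
have [C' C'0 C'P] := integral_powR_expR_ray.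
exists ((2 * C ^+ 2) * (2 * (1 + C')) + 1).
  by rewrite ltr_wpDl// !mulr_ge0 ?sqr_ge0// addr_ge0.
move=> a q t a0 mq qm ht lK.
have m0 : 0 < m by rewrite lt_min H0 ltr01.
have q0 : 0 <= q by apply: le_trans mq; rewrite divr_ge0// ltW.
have q1 : q <= 1 by apply: (le_trans (ltW qm)); rewrite ge_min lexx orbT.
have mH : m <= H by rewrite ge_min lexx.
have mq0 : 0 < m - q by rewrite subr_gt0.
pose W e y := kernel_majorant a q (e - y) ^+ 2.
have W0 e y : 0 <= W e y by exact: sqr_ge0.
pose Z := a `^ (- (2 * q)).
have Z0 : 0 <= Z by exact: powR_ge0.
pose w e y := Z * ((e - y) `^ (2 * (H - q) - 1) * expR (- (mu * (e - y)))) * \1_(`]-oo, e[) y.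
have Ww e y : W e y = w e y.
  rewrite /W /w indicE mem_setE in_itv/=; case: (ltP y e) => ye.
    by rewrite mulr1 kernel_majorant_sqr// subr_gt0.
  by rewrite mulr0 /kernel_majorant subr_gt0 ltNge ye /= expr0n.
have mw e : measurable_fun setT (w e).
  apply: measurable_funM; last exact: measurable_indic.
  by do 2! apply: measurable_funM => //; [exact: measurable_powR_reflect|exact: measurable_expR_line].
have iW e : (\int[leb]_y (W e y)%:E <= (Z * ((1 + C') / (m - q)))%:E)%E.
  under eq_integral do rewrite Ww.
  rewrite -integral_mkindic.
  apply: (@le_trans _ _ (Z * (1 / (2 * (H - q)) + C'))%:E).
    apply: integral_le_scale => //.
    - by apply: measurable_funM; [exact: measurable_powR_reflect|exact: measurable_expR_line].
    - by move=> x _; rewrite mulr_ge0 ?powR_ge0 ?expR_ge0.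
    - by apply: C'P; lra.
  rewrite lee_fin; apply: ler_wpM2l => //; rewrite [leRHS]mulrDl; apply: lerD.
    rewrite !div1r lef_pV2 ?posrE//; lra.
  rewrite ler_pdivlMr// ler_piMr//.
  by apply: le_trans (_ : m <= 1); rewrite ?gerBl// ge_min lexx orbT.
have mK : measurable_fun setT (noise_kernel a t) by exact: Lfun2_measurable lK.
rewrite -lee_fin dot_sqr//.
apply: (@le_trans _ _ (\int[leb]_y (2 * C ^+ 2 * W t y + 2 * C ^+ 2 * W 0 y)%:E)%E).
  apply: ae_ge0_le_integral => //.
  - by move=> y _; rewrite lee_fin sqr_ge0.
  - by apply/measurable_EFinP; exact: measurable_funX.
  - by move=> y _; rewrite lee_fin; apply: addr_ge0; apply: mulr_ge0 => //; rewrite mulr_ge0 ?sqr_ge0.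
  - apply/measurable_EFinP; under eq_fun do rewrite !Ww.
    by apply: measurable_funD; apply: measurable_funM => //; exact: mw.
  exists [set t]; split => //; first exact: lebesgue_measure_set1.
  move=> y /=; apply: contra_notP => /eqP yt _; rewrite lee_fin.
  have q3 : H < 2^-1 -> H / 2 <= q.
    by move=> h; rewrite (_ : H = m) // min_l//; lra.
  have := CP a q t y a0 _ q3 ht yt; rewrite q0 q1 => /(_ isT) h.
  rewrite /W -real_normK ?num_real//.
  set A := kernel_majorant _ _ (t - y) in h *; set B := kernel_majorant _ _ (0 - y) in h *.
  apply: (@le_trans _ _ ((C * (A + B)) ^+ 2)).
    by rewrite ler_sqr ?nnegrE// mulr_ge0// addr_ge0// kernel_majorant_ge0.
  rewrite -subr_ge0 (_ : _ - _ = (C * (A - B)) ^+ 2) ?sqr_ge0//; ring.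
apply: (le_trans (@integral_le_comb2 _ _ _ (W t) (W 0) (2 * C ^+ 2) (2 * C ^+ 2)
  _ _ _ _ _ _ _ _ _ _ _ _ (iW t) (iW 0))) => //.
- under eq_fun do rewrite !Ww.
  by apply: measurable_funD; apply: measurable_funM => //; exact: mw.
- by rewrite (funext (Ww t)).
- by rewrite (funext (Ww 0)).
- by rewrite mulr_ge0 ?sqr_ge0.
- by rewrite mulr_ge0 ?sqr_ge0.
- by move=> x _; apply: addr_ge0; apply: mulr_ge0 => //; rewrite mulr_ge0 ?sqr_ge0.
rewrite lee_fin -/Z [X in _ <= X * Z]mulrDl mulrDl.
rewrite [leLHS](_ : _ = 2 * C ^+ 2 * (2 * (1 + C')) / (m - q) * Z); last by ring.
by rewrite lerDl mulr_ge0// divr_ge0// ltW.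
Qed.

End noise_kernel.

(** * Variance of the convolution coefficients *)

Section stochastic_integral.
Context {R : realType} {d : measure_display} {Omega : measurableType d}.
Variables (P : probability Omega R) (H mu T : R).
Hypotheses (H0 : 0 < H) (H2 : H <> 2^-1) (mu0 : 0 < mu) (T0 : 0 < T).
Local Notation m := (Num.min H 1).

Lemma convolution_dot (C : R) (beta : R -> Omega -> R) :
  (forall a q t, 0 < a -> m / 2 <= q -> q < m -> 0 <= t <= T ->
    noise_kernel mu H a t \in Lfun lebesgue_measure 2%:E ->
    dot lebesgue_measure (noise_kernel mu H a t) (noise_kernel mu H a t)
      <= C / (m - q) * a `^ (- (2 * q))) ->
  two_sided_BM P beta ->
  forall a q t X, 0 < a -> m / 2 <= q -> q < m -> 0 <= t <= T ->
  tfBm_integral_on P H mu beta 0 t (fun s => expR (- (a * (t - s)))) X ->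
  X \in Lfun P 2%:E /\
  dot P X X <= Gamma (H + 2^-1) ^+ 2 * (C / (m - q) * a `^ (- (2 * q))).
Proof.
move=> CP hB a q t X a0 mq qm ht [Y [XY hY]].
have w : wiener_integral P beta (noise_kernel mu H a t) Y.
  by move: hY; rewrite /noise_kernel; case: ifP => _ [].
have [lK lY _] := w.
have -> : X = (fun w => Gamma (H + 2^-1) * Y w) by exact/funext.
split; first exact: Lfun2Z.
rewrite dotZl ?Lfun2Z// dotZr// mulrA -expr2 ler_wpM2l ?sqr_ge0//.
apply: (le_trans (wiener_integral_dot_le hB w)).
exact: CP.
Qed.

End stochastic_integral.

(** * Moments of the Galerkin solution *)

Section measurability_in_U.
Context {R : realType}.
Variables (D : set (R * R)) (lam : nat -> R) (phi : nat -> R * R -> R).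
Hypothesis hphi : dirichlet_eigenbasis D lam phi.

Lemma parseval_cvg u : inU D u ->
  \sum_(i < n) ip D u (phi i) ^+ 2 @[n --> \oo] --> normU D u ^+ 2.
Proof.
move=> uU; have h := parseval hphi uU.
have : (\sum_(0 <= i < n) (ip D u (phi i) ^+ 2)%:E)%E @[n --> \oo] --> (normU D u ^+ 2)%:E.
  rewrite normU_sqr -h; apply: is_cvg_nneseries => i _ _; by rewrite lee_fin sqr_ge0.
move=> /fine_cvg /=; apply: cvg_trans; apply: near_eq_cvg; apply: nearW => n /=.
by rewrite big_mkord sumEFin.
Qed.

(** By Parseval's identity the squared norm is a pointwise limit of sums of squared coordinates. *)
Lemma measurable_normUB {d} {S : measurableType d} (E : set S)
    (U : S -> R * R -> R) v : (forall x, E x -> inU D (U x)) ->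
  (forall i, measurable_fun E (fun x => ip D (U x) (phi i))) -> inU D v ->
  measurable_fun E (fun x => normU D (U x \- v)).
Proof.
move=> UU mU vU.
rewrite (_ : (fun x => _) = (fun x => Num.sqrt (normU D (U x \- v) ^+ 2))); last first.
  by apply/funext => x; rewrite sqrtr_sqr ger0_norm// normU_ge0.
apply: measurableT_comp; first exact: continuous_measurable_fun (@sqrt_continuous R).
apply: (@measurable_fun_cvg _ _ _ _
  (fun n x => \sum_(i < n) (ip D (U x) (phi i) - ip D v (phi i)) ^+ 2)).
  move=> n; apply: measurable_sum => i; apply: measurable_funX.
  exact: measurable_funB.
move=> x Ex; have := parseval_cvg (inUB (UU _ Ex) vU).
apply: cvg_trans; apply: near_eq_cvg; apply: nearW => n /=.
by apply: eq_bigr => i _; rewrite ipBl ?(phiU hphi)// UU.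
Qed.

Definition rat_comb (s : seq rat) := comb phi (size s) (fun i => ratr (nth 0 s i)).

Lemma inU_rat_comb s : inU D (rat_comb s).
Proof. exact/inU_comb/(phiU hphi). Qed.

Lemma rat_comb_dense u (e : R) : inU D u -> 0 < e ->
  exists s, normU D (u \- rat_comb s) <= e.
Proof.
move=> uU e0; have e2 : 0 < e / 2 by rewrite divr_gt0.
have /cvgrPdist_le/(_ _ e2)[n _ /(_ n (leqnn n))] := comb_proj_cvg hphi uU.
rewrite /= sub0r normrN ger0_norm ?normU_ge0// normUBC => un.
(* An error [del] in each of n coordinates has square sum n del^2 <= (e / 2)^2; the successor avoids
   a division by 0. *)
pose del := e / 2 / n.+1%:R.
have del0 : 0 < del by rewrite divr_gt0.
have ex i : exists q : rat, `|ip D u (phi i) - ratr q| < del.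
  have lt : ip D u (phi i) - del < ip D u (phi i) + del by rewrite ltrBlDr -addrA ltrDl addr_gt0.
  have [q] := rat_in_itvoo lt; rewrite in_itv/= => /andP[h1 h2].
  by exists q; rewrite ltr_norml; apply/andP; split; lra.
have [q qP] := choice ex.
exists (mkseq q n).
have -> : rat_comb (mkseq q n) = comb phi n (fun i => ratr (q i)).
  rewrite /rat_comb size_mkseq; apply/funext => z; apply: eq_bigr => i _.
  by rewrite nth_mkseq.
have cU c : inU D (comb phi n c) by exact/inU_comb/(phiU hphi).
have -> : u \- comb phi n (fun i => ratr (q i)) =
  (u \- comb phi n (fun i => ip D u (phi i))) \+
  comb phi n (fun i => ip D u (phi i) - ratr (q i)).
  apply/funext => z /=; rewrite /comb.
  under [X in _ = _ + X]eq_bigr do rewrite mulrBl.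
  by rewrite sumrB; ring.
apply: (le_trans (normUD (inUB uU (cU _)) (cU _))).
rewrite [e]splitr; apply: lerD => //.
rewrite -(@ler_sqr _ (normU _ _)) ?nnegrE ?normU_ge0 ?(ltW e2)// normU_sqr.
rewrite (ip_comb_comb (phiU hphi) (phi_on hphi)).
apply: (@le_trans _ _ (\sum_(i < n) del ^+ 2)).
  apply: ler_sum => i _; rewrite -real_normK ?num_real// ler_sqr ?nnegrE ?(ltW del0)//.
  exact: ltW.
rewrite sumr_const card_ord.
rewrite (_ : _ *+ n = (e / 2) ^+ 2 * (n%:R / n.+1%:R ^+ 2)); last first.
  by rewrite -mulr_natr /del expr_div_n; ring.
rewrite ler_piMr ?sqr_ge0// ler_pdivrMr ?exprn_gt0// mul1r expr2 -natrM ler_nat.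
by rewrite (leq_trans (leqnSn n))// leq_pmull.
Qed.

(* McShane's formula: a Lipschitz functional is the infimum of the functions
   [G v + K * normU (u - v)] over a dense set of points [v]. *)
Lemma measurable_lipschitz_comp {d} {S : measurableType d} (E : set S)
    (U : S -> R * R -> R) (G : (R * R -> R) -> R) (K : R) : 0 <= K ->
  (forall x, E x -> inU D (U x)) ->
  (forall i, measurable_fun E (fun x => ip D (U x) (phi i))) ->
  (forall u v, inU D u -> inU D v -> `|G u - G v| <= K * normU D (u \- v)) ->
  measurable_fun E (fun x => G (U x)).
Proof.
move=> K0 UU mU GK mE.
apply: (measurability _ (RGenInftyO.measurableE R)) => //.
move=> _ [_ [a ->] <-].
pose F s := E `&` (fun x => G (rat_comb s) + K * normU D (U x \- rat_comb s)) @^-1` `]-oo, a[.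
rewrite (_ : _ `&` _ = \bigcup_s F s).
  apply: countable_bigcupT_measurable => // s.
  apply: (measurable_funD (measurable_cst _) (measurable_funM (measurable_cst _) _)) => //.
  by apply: measurable_normUB => //; exact: inU_rat_comb.
apply/seteqP; split => [x [Ex]|x [s _ [Ex]]] /=; rewrite !in_itv/= => Ga.
  (* At distance at most [e], McShane's expression exceeds G (U x) by at most 2 K e, which is less
     than a - G (U x). *)
  pose e := (a - G (U x)) / (2 * K + 1) / 2.
  have e0 : 0 < e by rewrite !divr_gt0 ?subr_gt0// ltr_wpDl// mulr_ge0.
  have [s sP] := rat_comb_dense (UU _ Ex) e0.
  exists s => //; split => //=; rewrite in_itv/=.
  have := GK _ _ (UU _ Ex) (inU_rat_comb s); rewrite ler_norml => /andP[h1 h2].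
  have h3 : K * normU D (U x \- rat_comb s) <= K * e by rewrite ler_wpM2l.
  have h4 : (2 * K + 1) * e = (a - G (U x)) / 2.
    by rewrite /e; field; rewrite gt_eqF// ltr_wpDl// mulr_ge0.
  have : 0 <= K * e by rewrite mulr_ge0// ltW.
  by lra.
split => //; apply: le_lt_trans Ga.
have := GK _ _ (UU _ Ex) (inU_rat_comb s); rewrite ler_norml => /andP[h1 h2].
by lra.
Qed.

End measurability_in_U.

(** * Cauchy-Schwarz for kernels, Tonelli and Gronwall *)

Section kernel_estimates.
Context {R : realType}.
Local Notation leb := (@lebesgue_measure R).

Lemma normr_Rintegral_le (A : set R) (f h : R -> R) (M : R) :
  measurable A -> measurable_fun setT f -> measurable_fun setT h ->
  (forall x, A x -> `|f x| <= h x) ->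
  (\int[leb]_(x in A) (h x)%:E <= M%:E)%E ->
  `|\int[leb]_(x in A) f x| <= M.
Proof.
move=> mA mf mh fh hM.
have mfE : measurable_fun A (EFin \o f) by apply/measurable_EFinP; exact: measurable_funTS.
have bnd : (\int[leb]_(x in A) `|(f x)%:E| <= M%:E)%E.
  apply: le_trans hM; apply: ge0_le_integral => //.
  - exact: measurableT_comp mfE.
  - by apply/measurable_EFinP; exact: measurable_funTS.
have := le_trans (le_abse_integral leb mA mfE) bnd.
have M0 : 0 <= M by rewrite -lee_fin; apply: le_trans bnd; exact: integral_ge0.
by rewrite /Rintegral /=; case: (integral _ _ _) => [r| |]//=; rewrite normr0.
Qed.

(** Cauchy-Schwarz for sqrt k and sqrt k |f|. If the integral on the right is infinite, the
    positivity of [kappa] makes the whole right side infinite. *)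
Lemma Rintegral_kernel_sqr_le (A : set R) (h k f : R -> R) (kappa : R) :
  measurable A -> measurable_fun setT h -> measurable_fun setT k ->
  measurable_fun setT f -> (forall r, A r -> `|h r| <= k r) ->
  (\int[leb]_(r in A) (k r)%:E <= kappa%:E)%E -> 0 < kappa ->
  (((\int[leb]_(r in A) (h r * f r)) ^+ 2)%:E <=
   kappa%:E * \int[leb]_(r in A) (k r * f r ^+ 2)%:E)%E.
Proof.
move=> mA mh mk mf hk kk kappa0.
have k0 r : A r -> 0 <= k r by move=> /hk; exact: le_trans.
have mkf : measurable_fun setT (fun r => k r * f r ^+ 2).
  by apply: measurable_funM => //; exact: measurable_funX.
have [inf|fin] := eqVneq (\int[leb]_(r in A) (k r * f r ^+ 2)%:E)%E +oo%E.
  by rewrite inf gt0_muley ?lte_fin// leey.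
pose p r := Num.sqrt (k r) * \1_A r.
pose q r := Num.sqrt (k r) * `|f r| * \1_A r.
have msk : measurable_fun setT (fun r => Num.sqrt (k r)).
  by apply: measurableT_comp => //; exact: continuous_measurable_fun (@sqrt_continuous R).
have m1 : measurable_fun setT (\1_A : R -> R) by exact: measurable_indic.
have mp : measurable_fun setT p by exact: measurable_funM.
have mq : measurable_fun setT q.
  by apply: measurable_funM => //; apply: measurable_funM => //; exact: measurableT_comp.
have pp : (\int[leb]_r (p r ^+ 2)%:E = \int[leb]_(r in A) (k r)%:E)%E.
  rewrite [RHS]integral_mkindic; apply: eq_integral => r _; congr EFin.
  rewrite /p indicE; have [/set_mem rA|_] := boolP (r \in A); last by rewrite !mulr0 expr0n.
  by rewrite !mulr1 sqr_sqrtr// k0.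
have qq : (\int[leb]_r (q r ^+ 2)%:E = \int[leb]_(r in A) (k r * f r ^+ 2)%:E)%E.
  rewrite [RHS]integral_mkindic; apply: eq_integral => r _; congr EFin.
  rewrite /q indicE; have [/set_mem rA|_] := boolP (r \in A); last by rewrite !mulr0 expr0n.
  by rewrite !mulr1 exprMn sqr_sqrtr ?k0// real_normK ?num_real.
have lp : p \in Lfun leb 2%:E by apply/Lfun2P => //; rewrite pp (le_lt_trans kk)// ltry.
have lq : q \in Lfun leb 2%:E by apply/Lfun2P => //; rewrite qq ltey fin.
have le1 : `|\int[leb]_(r in A) (h r * f r)| <= dot leb p q.
  apply: (@normr_Rintegral_le _ _ (fun r => k r * `|f r|)) => //.
  - exact: measurable_funM.
  - by apply: measurable_funM => //; exact: measurableT_comp.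
  - by move=> r rA; rewrite normrM ler_wpM2r// hk.
  rewrite integral_mkindic /dot /Rintegral fineK; last first.
    by apply: integrable_fin_num => //; exact: Lfun2_mul lp lq.
  rewrite le_eqVlt; apply/orP; left; apply/eqP; apply: eq_integral => r _; congr EFin.
  rewrite /p /q indicE; have [/set_mem rA|_] := boolP (r \in A); last by rewrite !mulr0.
  by rewrite !mulr1 mulrA -expr2 sqr_sqrtr// k0.
rewrite -real_normK ?num_real//.
apply: (@le_trans _ _ (dot leb p p * dot leb q q)%:E).
  rewrite lee_fin; apply: le_trans (dot_cauchy_schwarz lp lq).
  by rewrite ler_sqr ?nnegrE// (le_trans _ le1).
rewrite EFinM !dot_sqr// qq lee_wpmul2r//; last by rewrite pp.
by apply: integral_ge0 => r rA; rewrite lee_fin mulr_ge0 ?sqr_ge0 ?k0.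
Qed.

Section tonelli.
Context {d : measure_display} {Omega : measurableType d}.
Variables (P : probability Omega R) (Phi : measurableTypeR R * Omega -> R).
Hypotheses (mPhi : measurable_fun setT Phi) (Phi0 : forall p, 0 <= Phi p).
Variables (A : set R) (k : R -> R) .
Hypotheses (mA : measurable A) (mk : measurable_fun setT k)
  (k0 : forall r, A r -> 0 <= k r).

Let G (p : measurableTypeR R * Omega) := k p.1 * Phi p * \1_A p.1.

Let G0 p : 0 <= G p.
Proof.
rewrite /G indicE; have [/set_mem pA|_] := boolP (_ \in _); last by rewrite mulr0.
by rewrite mulr1 mulr_ge0// k0.
Qed.

Let mG : measurable_fun setT (EFin \o G).
Proof.
apply/measurable_EFinP; apply: measurable_funM; last first.
  by apply: (measurableT_comp (measurable_indic _) measurable_fst).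
by apply: measurable_funM => //; exact: (measurableT_comp mk measurable_fst).
Qed.

Let GE w : (\int[leb]_(r in A) (k r * Phi (r, w))%:E = \int[leb]_r (G (r, w))%:E)%E.
Proof. by rewrite integral_mkindic. Qed.

Lemma measurable_kernel_integral :
  measurable_fun setT (fun w => \int[leb]_(r in A) (k r * Phi (r, w))%:E)%E.
Proof.
under eq_fun do rewrite GE.
have GE0 p : (0 <= (EFin \o G) p)%E by rewrite lee_fin.
exact: (measurable_fun_fubini_tonelli_G (m1 := leb) _ mG GE0).
Qed.

Lemma measurable_expectation : measurable_fun setT (fun r => \int[P]_w (Phi (r, w))%:E)%E.
Proof.
have mPE : measurable_fun setT (EFin \o Phi) by exact/measurable_EFinP.
have PE0 p : (0 <= (EFin \o Phi) p)%E by rewrite lee_fin.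
exact: (measurable_fun_fubini_tonelli_F (m2 := P) _ mPE PE0).
Qed.

Lemma expectation_kernel_integral :
  (\int[P]_w \int[leb]_(r in A) (k r * Phi (r, w))%:E =
   \int[leb]_(r in A) ((k r)%:E * \int[P]_w (Phi (r, w))%:E))%E.
Proof.
under eq_integral do rewrite GE.
rewrite -(fubini_tonelli (m1 := leb) (m2 := P) _ mG); last by move=> p /=; rewrite lee_fin.
rewrite [RHS]integral_mkcond; apply: eq_integral => r _ /=.
rewrite patchE; case: ifPn => [/set_mem rA|rA].
  rewrite -ge0_integralZl//.
  - by apply: eq_integral => w _; rewrite /G indicE mem_set// mulr1 EFinM.
  - by apply/measurable_EFinP; exact: (measurable_fun_pair2 r mPhi).
  - by move=> w _; rewrite lee_fin.
  - by rewrite lee_fin k0.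
rewrite integral0_eq// => w _.
by rewrite /G indicE (negbTE rA) mulr0.
Qed.

Lemma expectation_kernel_integral_le (kappa M : R) :
  (\int[leb]_(r in A) (k r)%:E <= kappa%:E)%E -> 0 <= M ->
  (forall r, A r -> (\int[P]_w (Phi (r, w))%:E <= M%:E)%E) ->
  (\int[P]_w \int[leb]_(r in A) (k r * Phi (r, w))%:E <= (kappa * M)%:E)%E.
Proof.
move=> kk M0 PM; rewrite expectation_kernel_integral.
apply: (@le_trans _ _ (\int[leb]_(r in A) ((k r)%:E * M%:E))%E).
  have mkE : measurable_fun A (EFin \o k) by apply/measurable_EFinP; exact: measurable_funTS.
  apply: ge0_le_integral => //.
  - move=> r rA; rewrite mule_ge0 ?lee_fin ?k0//.
    by apply: integral_ge0 => w _; rewrite lee_fin.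
  - by apply: emeasurable_funM => //; apply: measurable_funTS; exact: measurable_expectation.
  - exact: emeasurable_funM.
  - by move=> r rA; rewrite lee_wpmul2l ?lee_fin ?k0// PM.
rewrite ge0_integralZr//.
- by rewrite EFinM lee_wpmul2r.
- by apply/measurable_EFinP; exact: measurable_funTS.
Qed.

End tonelli.

(** Let S be the supremum of exp (- 2 B t) h(t). The rate 2 B makes the integral term at most S / 2
    after weighting, hence S <= A + S / 2. The bound [M] makes S finite and does not enter the
    conclusion; no continuity of [h] is involved. *)
Lemma gronwall (T A B M : R) (h : R -> R) : 0 <= T -> 0 <= A -> 0 < B ->
  measurable_fun setT h -> (forall t, 0 <= t <= T -> 0 <= h t <= M) ->
  (forall t, 0 <= t <= T ->
    ((h t)%:E <= A%:E + B%:E * \int[leb]_(r in `[0%R, t]) (h r)%:E)%E) ->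
  forall t, 0 <= t <= T -> h t <= 2 * A * expR (2 * B * T).
Proof.
move=> T0 A0 B0 mh hM hint.
pose W := [set x : R | exists2 t, 0 <= t <= T & x = expR (- (2 * B * t)) * h t].
have B2 : 0 < 2 * B by rewrite mulr_gt0.
have e1 t : 0 <= t -> expR (- (2 * B * t)) <= 1.
  by move=> t0; rewrite -[leRHS]expR0 ler_expR oppr_le0 mulr_ge0 ?(ltW B2).
have W0 : W (expR (- (2 * B * 0)) * h 0) by exists 0; rewrite ?lexx.
have Wub : has_sup W.
  split; first by exists (expR (- (2 * B * 0)) * h 0).
  exists M => _ [t ht ->]; have /andP[h0 hm] := hM _ ht.
  have /andP[t0 _] := ht.
  by apply: le_trans hm; rewrite ler_piMl// e1.
have hS t : 0 <= t <= T -> h t <= sup W * expR (2 * B * t).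
  move=> ht; rewrite -ler_pdivrMr ?expR_gt0// -expRN mulrC.
  by apply: sup_upper_bound => //; exists t.
have S0 : 0 <= sup W.
  apply: le_trans (sup_upper_bound Wub W0).
  have ht0 : 0 <= (0 : R) <= T by rewrite lexx.
  by rewrite mulr_ge0 ?expR_ge0//; have /andP[] := hM 0 ht0.
have S2 : sup W <= 2 * A.
  suff : sup W <= A + sup W / 2 by lra.
  apply: ge_sup; first by case: Wub.
  move=> _ [t /[dup] ht /andP[t0 tT] ->].
  have int : (\int[leb]_(r in `[0%R, t]) (h r)%:E <= (sup W * expR (2 * B * t) / (2 * B))%:E)%E.
    have mhE : measurable_fun `[0, t[ (EFin \o h) by apply/measurable_EFinP; exact: measurable_funTS.
    rewrite -integral_itv_bndo_bndc//.
    pose e r := expR (- (2 * B * (t - r))).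
    have me : measurable_fun `[0, t[ (EFin \o e).
      by apply/measurable_EFinP; apply: measurable_funTS; exact: measurable_expR_line.
    apply: (@le_trans _ _ (\int[leb]_(r in `[0%R, t[) ((sup W * expR (2 * B * t))%:E * (e r)%:E))%E).
      apply: ge0_le_integral => //.
      - move=> r /=; rewrite in_itv/= => /andP[r0 rt]; rewrite lee_fin.
        have hr : 0 <= r <= T by rewrite r0 (le_trans (ltW rt)).
        by have /andP[] := hM r hr.
      - exact: emeasurable_funM.
      - move=> r /=; rewrite in_itv/= => /andP[r0 rt].
        rewrite -EFinM lee_fin (_ : _ * e r = sup W * expR (2 * B * r)); last first.
          by rewrite /e -[LHS]mulrA -expRD; congr (_ * expR _); ring.
        by apply: hS; rewrite r0 (le_trans (ltW rt)).
    rewrite ge0_integralZl//; last 2 first.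
    - by move=> r _; rewrite lee_fin expR_ge0.
    - by rewrite lee_fin mulr_ge0 ?expR_ge0.
    rewrite [leRHS]EFinM lee_wpmul2l ?lee_fin ?mulr_ge0 ?expR_ge0//.
    apply: le_trans (integral_expR_ray t B2); apply: ge0_subset_integral => //.
    - by apply/measurable_EFinP; apply: measurable_funTS; exact: measurable_expR_line.
    - by move=> r _; rewrite lee_fin expR_ge0.
    - by move=> r /=; rewrite !in_itv/= => /andP[].
  have := hint _ ht; move=> /le_trans.
  move=> /(_ (A%:E + B%:E * (sup W * expR (2 * B * t) / (2 * B))%:E)%E).
  have B0' : (0 <= B%:E)%E by rewrite lee_fin ltW.
  move=> /(_ (leeD (lexx _) (lee_wpmul2l B0' int))).
  rewrite -EFinM -EFinD lee_fin (_ : B * _ = sup W / 2 * expR (2 * B * t)); last first.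
    by field; rewrite gt_eqF.
  move=> h1.
  rewrite expRN mulrC ler_pdivrMr ?expR_gt0// (le_trans h1)// [leRHS]mulrDl lerD2r.
  by rewrite ler_peMr// -[leLHS]expR0 ler_expR mulr_ge0 ?(ltW B2).
move=> t /[dup] ht /andP[t0 tT]; apply: (le_trans (hS t ht)).
apply: ler_pM; rewrite ?expR_ge0//.
by rewrite ler_expR ler_wpM2l ?(ltW B2).
Qed.

End kernel_estimates.

Lemma sqr_add3_le {R : realType} (x y z : R) :
  (x + y + z) ^+ 2 <= 3 * (x ^+ 2 + y ^+ 2 + z ^+ 2).
Proof.
have := sqr_ge0 (x - y); have := sqr_ge0 (y - z); have := sqr_ge0 (x - z).
nra.
Qed.

(** One majorant [k] common to all indices lets the weighted sum pass under the integral, with a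
    constant free of [n]. *)
Lemma sum_Rintegral_kernel_sqr_le {R : realType} (A : set R) (n : nat)
    (c : nat -> R) (h f : nat -> R -> R) (k : R -> R) (kappa : R) :
  measurable A -> (forall i, 0 <= c i) -> (forall i, measurable_fun setT (h i)) ->
  measurable_fun setT k -> (forall i, measurable_fun setT (f i)) ->
  (forall i r, (i < n)%N -> A r -> `|h i r| <= k r) -> (forall r, A r -> 0 <= k r) ->
  (\int[lebesgue_measure]_(r in A) (k r)%:E <= kappa%:E)%E -> 0 < kappa ->
  ((\sum_(i < n) c i * (\int[lebesgue_measure]_(r in A) (h i r * f i r)) ^+ 2)%:E <=
   kappa%:E * \int[lebesgue_measure]_(r in A) (k r * \sum_(i < n) c i * f i r ^+ 2)%:E)%E.
Proof.
move=> mA c0 mh mk mf hk k0 kk kappa0.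
pose g i r := k r * f i r ^+ 2.
have mg i : measurable_fun A (EFin \o g i).
  apply/measurable_EFinP; apply: measurable_funTS; apply: measurable_funM => //.
  exact: measurable_funX.
have g0 i r : A r -> (0 <= (g i r)%:E)%E by move=> rA; rewrite lee_fin mulr_ge0 ?sqr_ge0 ?k0.
have -> : (\int[lebesgue_measure]_(r in A) (k r * \sum_(i < n) c i * f i r ^+ 2)%:E)%E =
    (\sum_(i < n) (c i)%:E * \int[lebesgue_measure]_(r in A) (g i r)%:E)%E.
  transitivity (\int[lebesgue_measure]_(r in A) (\sum_(i < n) ((c i)%:E * (g i r)%:E)))%E.
    apply: eq_integral => r _; rewrite mulr_sumr -sumEFin; apply: eq_bigr => i _.
    by rewrite -EFinM /g mulrCA.
  rewrite ge0_integral_sum//.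
  - apply: eq_bigr => i _; rewrite ge0_integralZl//; try exact: (mg i); try exact: g0; rewrite lee_fin//.
  - by move=> i; apply: emeasurable_funM => //; exact: (mg i).
  - by move=> i r rA; rewrite mule_ge0 ?lee_fin ?g0// -lee_fin g0.
rewrite -sumEFin ge0_sume_distrr; last first.
  by move=> i _; rewrite mule_ge0 ?lee_fin// integral_ge0// => r; exact: g0.
apply: lee_sum => i _; rewrite EFinM muleCA lee_wpmul2l ?lee_fin//.
by apply: Rintegral_kernel_sqr_le => // r rA; apply: hk.
Qed.

(** * Moment bound for a system of scalar mild equations *)

Section moment_bound.
Context {R : realType} {d : measure_display} {Omega : measurableType d}.
Local Notation leb := (@lebesgue_measure R).
Variables (P : probability Omega R) (N : nat) (T K A1 A2 : R) (c a : nat -> R).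
Variables (U F : nat -> measurableTypeR R * Omega -> R).
Variables (x : nat -> Omega -> R) (W : nat -> R -> Omega -> R).
Hypotheses (T0 : 0 < T) (K0 : 0 < K) (A10 : 0 <= A1) (A20 : 0 <= A2).
Hypotheses (c0 : forall i, 0 <= c i) (a0 : forall i, 0 <= a i).
Hypotheses (mU : forall i, measurable_fun setT (U i)).
Hypotheses (mF : forall i, measurable_fun setT (F i)).
Hypotheses (mx : forall i, measurable_fun setT (x i)).
Hypotheses (mW : forall i t, 0 <= t <= T -> measurable_fun setT (W i t)).
Hypothesis mild : forall t, 0 <= t <= T -> {ae P, forall w, forall i, (i < N)%N ->
  U i (t, w) = expR (- (t * a i)) * x i w
    + \int[leb]_(r in `[0, t]) (expR (- ((t - r) * a i)) * F i (r, w)) + W i t w}.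
Let Su p := \sum_(i < N) c i * U i p ^+ 2.
Let Sf p := \sum_(i < N) c i * F i p ^+ 2.
Let Sx w := \sum_(i < N) c i * x i w ^+ 2.
Let SW t w := \sum_(i < N) c i * W i t w ^+ 2.
Hypothesis growth : forall r, 0 <= r <= T ->
  {ae P, forall w, Sf (r, w) <= K * (1 + Su (r, w))}.
Hypothesis integ : {ae P, forall w, forall i, (i < N)%N ->
  (\int[leb]_(r in `[0%R, T]) `|F i (r, w)|%:E < +oo)%E}.
Hypothesis hx : (\int[P]_w (Sx w)%:E <= A1%:E)%E.
Hypothesis hW : forall t, 0 <= t <= T -> (\int[P]_w (SW t w)%:E <= A2%:E)%E.

Let ssum_ge0 (f : nat -> R) : 0 <= \sum_(i < N) c i * f i ^+ 2.
Proof. by apply: sumr_ge0 => i _; rewrite mulr_ge0 ?sqr_ge0. Qed.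

Let ssum_measurable {d'} {S : measurableType d'} (f : nat -> S -> R) :
  (forall i, measurable_fun setT (f i)) ->
  measurable_fun setT (fun p => \sum_(i < N) c i * f i p ^+ 2).
Proof.
move=> mf; apply: measurable_sum => i; apply: measurable_funM => //.
exact: measurable_funX.
Qed.

(* No moment of [U] is known to be finite at the start. Gronwall's lemma is
   therefore applied to the moments on the event [Om n], where the time integrals
   of [F] are at most [n]; they are bounded there, by a constant depending on [n],
   but the resulting estimate does not depend on [n]. *)
Let Gi w := (\sum_(i < N) \int[leb]_(r in `[0%R, T]) (cst 1 r * `|F i (r, w)|)%:E)%E.

Let mabsF i : measurable_fun setT (fun p => `|F i p|).
Proof. exact: measurableT_comp. Qed.

Let mGi : measurable_fun setT Gi.
Proof.
apply: emeasurable_sum => i.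
apply: (measurable_kernel_integral (Phi := fun p => `|F i p|)) => //.
Qed.

Let Om n := [set w | (Gi w <= n%:R%:E)%E].

Let mOm n : measurable (Om n).
Proof. by have := emeasurable_fun_infty_c measurableT mGi n%:R%:E; rewrite setTI. Qed.

Let I n (w : Omega) : R := \1_(Om n) w.

Let I01 n w : (I n w = 1 /\ Om n w) \/ I n w = 0.
Proof.
by rewrite /I indicE; have [/set_mem h|_] := boolP (w \in Om n); [left|right].
Qed.

Let mI n : measurable_fun setT (I n). Proof. exact: measurable_indic. Qed.

Let PU n (p : measurableTypeR R * Omega) := I n p.2 * Su p.
Let PF n (p : measurableTypeR R * Omega) := I n p.2 * Sf p.

Let mSu : measurable_fun setT Su. Proof. exact: ssum_measurable. Qed.
Let mSf : measurable_fun setT Sf. Proof. exact: ssum_measurable. Qed.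
Let mSx : measurable_fun setT Sx. Proof. exact: ssum_measurable. Qed.
Let mSW t : 0 <= t <= T -> measurable_fun setT (SW t).
Proof. by move=> ht; exact: (ssum_measurable (fun i => mW i ht)). Qed.
Let Sx0 w : 0 <= Sx w. Proof. exact: (ssum_ge0 (fun i => x i w)). Qed.
Let SW0 t w : 0 <= SW t w. Proof. exact: (ssum_ge0 (fun i => W i t w)). Qed.
Let I_ge0 n w : 0 <= I n w. Proof. by case: (I01 n w) => [[->]|->]. Qed.

Let mPU n : measurable_fun setT (PU n).
Proof. by apply: measurable_funM => //; exact: measurableT_comp (mI n) measurable_snd. Qed.
Let mPF n : measurable_fun setT (PF n).
Proof. by apply: measurable_funM => //; exact: measurableT_comp (mI n) measurable_snd. Qed.

Let PU0 n p : 0 <= PU n p.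
Proof. by apply: mulr_ge0; [exact: I_ge0|exact: (ssum_ge0 (fun i => U i p))]. Qed.
Let PF0 n p : 0 <= PF n p.
Proof. by apply: mulr_ge0; [exact: I_ge0|exact: (ssum_ge0 (fun i => F i p))]. Qed.

Let mline i t : measurable_fun setT (fun r : R => expR (- ((t - r) * a i))).
Proof.
by under eq_fun do rewrite mulrC; exact: measurable_expR_line.
Qed.

Let mFw i w : measurable_fun setT (fun r : R => F i (r, w)).
Proof. exact: (measurable_fun_pair1 w (mF i)). Qed.

Let line_le1 i t r : r <= t -> `|expR (- ((t - r) * a i))| <= 1.
Proof.
move=> rt; rewrite ger0_norm ?expR_ge0// -expR0 ler_expR oppr_le0.
by rewrite mulr_ge0// subr_ge0.
Qed.

Let J i t w := \int[leb]_(r in `[0, t]) (expR (- ((t - r) * a i)) * F i (r, w)).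

Let Su_le t : 0 <= t <= T -> {ae P, forall w,
  Su (t, w) <= 3 * (Sx w + SW t w) + 3 * \sum_(i < N) c i * J i t w ^+ 2}.
Proof.
move=> /[dup] ht /andP[t0 tT]; apply: filterS (mild ht) => w h.
rewrite /Su /Sx /SW -mulrDr -!big_split/= mulr_sumr; apply: ler_sum => i _.
rewrite h// [leRHS](_ : _ = c i * (3 * (x i w ^+ 2 + W i t w ^+ 2 + J i t w ^+ 2))); last by ring.
rewrite ler_wpM2l//.
apply: (le_trans (sqr_add3_le _ _ _)); rewrite ler_wpM2l//.
rewrite addrAC lerD2r lerD2r exprMn ler_piMl ?sqr_ge0//.
rewrite expr_le1 ?expR_ge0// -[leRHS]expR0 ler_expR oppr_le0.
by rewrite mulr_ge0.
Qed.

Let J_le n t w i : (i < N)%N -> 0 <= t <= T -> Om n w -> `|J i t w| <= n%:R.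
Proof.
move=> iN /andP[t0 tT] hw.
apply: (@normr_Rintegral_le _ _ _ (fun r => `|F i (r, w)|)) => //.
- by apply: measurable_funM.
- by apply: measurableT_comp.
- move=> r /=; rewrite in_itv/= => /andP[_ rt].
  by rewrite normrM ler_piMl// line_le1.
apply: le_trans hw; rewrite /Gi (bigD1 (Ordinal iN))//=.
apply: le_trans (leeDl _ _); last first.
  by apply: sume_ge0 => j _; apply: integral_ge0 => r _; rewrite mul1r lee_fin.
under [in leRHS]eq_integral do rewrite mul1r.
apply: ge0_subset_integral => //.
- apply/measurable_EFinP; apply: measurable_funTS; apply: measurableT_comp => //; exact: mFw.
- by move=> r /=; rewrite !in_itv/= => /andP[-> /=] /le_trans; apply.
Qed.

Let mSS t : 0 <= t <= T -> measurable_fun setT (fun w => 3 * (Sx w + SW t w)).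
Proof. by move=> ht; apply: measurable_funM => //; apply: measurable_funD => //; exact: mSW. Qed.

Let int_cstP r : (\int[P]_w r%:E = r%:E)%E.
Proof.
rewrite (integral_cst P measurableT r%:E) [X in (_ * X)%E](_ : _ = 1%E) ?mule1//.
exact: probability_setT.
Qed.

Let base_le t M : 0 <= t <= T -> 0 <= M ->
  (\int[P]_w (3 * (Sx w + SW t w) + M)%:E <= (3 * (A1 + A2) + M)%:E)%E.
Proof.
move=> ht M0; have mW' := mSW ht.
under eq_integral do rewrite EFinD EFinM [(Sx _ + SW _ _)%:E]EFinD.
rewrite ge0_integralD//; last 2 first.
- by move=> w _; rewrite mule_ge0// adde_ge0// lee_fin.
- by apply: emeasurable_funM => //; apply: emeasurable_funD; exact/measurable_EFinP.
rewrite int_cstP [leRHS]EFinD leeD2r//.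
rewrite ge0_integralZl//; last 2 first.
- by apply: emeasurable_funD; apply/measurable_EFinP.
- by move=> w _; rewrite adde_ge0// lee_fin.
rewrite EFinM lee_wpmul2l// ge0_integralD//.
- by rewrite EFinD leeD// hW.
- by move=> w _; rewrite lee_fin.
- exact/measurable_EFinP.
- by move=> w _; rewrite lee_fin.
- exact/measurable_EFinP.
Qed.

Let PU_bounded n t : 0 <= t <= T ->
  (\int[P]_w (PU n (t, w))%:E <=
   (3 * (A1 + A2) + 3 * \sum_(i < N) c i * n%:R ^+ 2)%:E)%E.
Proof.
move=> ht.
have M0 : 0 <= 3 * \sum_(i < N) c i * n%:R ^+ 2.
  by rewrite mulr_ge0// (ssum_ge0 (fun=> n%:R)).
apply: le_trans (base_le ht M0).
apply: ae_ge0_le_integral => //.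
- by move=> w _; rewrite lee_fin.
- by apply/measurable_EFinP; exact: (measurable_fun_pair2 t (mPU n)).
- by move=> w _; rewrite lee_fin addr_ge0// mulr_ge0// addr_ge0.
- by apply/measurable_EFinP; apply: measurable_funD => //; exact: mSS.
- apply: filterS (Su_le ht) => w h _; rewrite lee_fin /PU/=.
  have [[-> hw]|->] := I01 n w; last by rewrite mul0r addr_ge0// mulr_ge0// addr_ge0.
  rewrite mul1r (le_trans h)// lerD2l ler_wpM2l//; apply: ler_sum => i _.
  by rewrite ler_wpM2l// -real_normK ?num_real// ler_sqr ?nnegrE//; exact: J_le.
Qed.

(** The 3 comes from squaring a sum of three terms, [T] from Cauchy-Schwarz in time and [K] from the
    growth of the nonlinearity; the constant 1 in the growth condition contributes B T to [A]. *)
Let B := 3 * T * K.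
Let A := 3 * (A1 + A2) + B * T.

Let itv_cst t : 0 <= t <= T ->
  (\int[leb]_(r in `[0%R, t]) (cst 1 r)%:E <= T%:E)%E.
Proof.
move=> /andP[t0 tT]; rewrite (integral_cst leb _ 1%E)//= mul1e lebesgue_measure_itv/= lte_fin.
by case: ltP => _; rewrite ?lee_fin ?subr0// ltW.
Qed.

Let PF_le n r : 0 <= r <= T ->
  (\int[P]_w (PF n (r, w))%:E <= K%:E + K%:E * \int[P]_w (PU n (r, w))%:E)%E.
Proof.
move=> hr.
have mPU' : measurable_fun setT (fun w => (PU n (r, w))%:E).
  by apply/measurable_EFinP; exact: (measurable_fun_pair2 r (mPU n)).
apply: (@le_trans _ _ (\int[P]_w (K%:E + K%:E * (PU n (r, w))%:E))%E).
  apply: ae_ge0_le_integral => //.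
  - by move=> w _; rewrite lee_fin.
  - by apply/measurable_EFinP; exact: (measurable_fun_pair2 r (mPF n)).
  - by move=> w _; rewrite adde_ge0 ?mule_ge0 ?lee_fin// ltW.
  - by apply: emeasurable_funD => //; exact: emeasurable_funM.
  - apply: filterS (growth hr) => w h _; rewrite -EFinM -EFinD lee_fin /PF /PU/=.
    have [[-> _]|->] := I01 n w; first by rewrite !mul1r (le_trans h)// mulrDr mulr1.
    by rewrite !mul0r mulr0 addr0 ltW.
rewrite ge0_integralD//.
- rewrite int_cstP leeD2l// ge0_integralZl// ?lee_fin ?ltW//.
  by move=> w _; rewrite lee_fin.
- by move=> w _; rewrite lee_fin ltW.
- by move=> w _; rewrite mule_ge0 ?lee_fin// ltW.
- exact: emeasurable_funM.
Qed.

Let gronwall_hyp n t : 0 <= t <= T ->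
  (\int[P]_w (PU n (t, w))%:E <=
   A%:E + B%:E * \int[leb]_(r in `[0%R, t]) \int[P]_w (PU n (r, w))%:E)%E.
Proof.
move=> /[dup] ht /andP[t0 tT].
pose Q w := (\int[leb]_(r in `[0%R, t]) (cst 1 r * PF n (r, w))%:E)%E.
have mQ : measurable_fun setT Q.
  by apply: (measurable_kernel_integral (Phi := PF n)).
have Q0 w : (0 <= Q w)%E.
  by apply: integral_ge0 => r _; rewrite lee_fin mul1r.
have TQ0 w : (0 <= (3 * T)%:E * Q w)%E.
  by rewrite mule_ge0// lee_fin mulr_ge0// ltW.
apply: (@le_trans _ _ (\int[P]_w ((3 * (Sx w + SW t w) + 0)%:E + (3 * T)%:E * Q w))%E).
  apply: ae_ge0_le_integral => //.
  - by move=> w _; rewrite lee_fin.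
  - by apply/measurable_EFinP; exact: (measurable_fun_pair2 t (mPU n)).
  - by move=> w _; rewrite adde_ge0// lee_fin addr0 mulr_ge0// addr_ge0.
  - apply: emeasurable_funD; last exact: emeasurable_funM.
    by apply/measurable_EFinP; apply: measurable_funD => //; exact: mSS.
  - apply: filterS (Su_le ht) => w h _; rewrite /PU/= addr0.
    have [[e _]|->] := I01 n w; last first.
      by rewrite mul0r adde_ge0// lee_fin mulr_ge0// addr_ge0.
    rewrite e mul1r; apply: (@le_trans _ _ (3 * (Sx w + SW t w) + 3 * \sum_(i < N) c i * J i t w ^+ 2)%:E).
      by rewrite lee_fin.
    rewrite EFinD leeD2l// EFinM [(3 * T)%:E]EFinM -muleA lee_wpmul2l//.
    rewrite /Q /PF /= e; under [in leRHS]eq_integral do rewrite [1 * Sf _]mul1r.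
    apply: (@sum_Rintegral_kernel_sqr_le _ _ _ _ (fun i r => expR (- ((t - r) * a i)))
      (fun i r => F i (r, w)) (cst 1)) => //.
    + by move=> i r _ /=; rewrite in_itv/= => /andP[_ rt]; exact: line_le1.
    + exact: itv_cst.
rewrite ge0_integralD//; last 3 first.
- by move=> w _; rewrite addr0 lee_fin mulr_ge0// addr_ge0.
- by apply/measurable_EFinP; apply: measurable_funD => //; exact: mSS.
- exact: emeasurable_funM.
rewrite ge0_integralZl// ?lee_fin ?mulr_ge0 ?(ltW T0)//.
rewrite /Q (expectation_kernel_integral P (mPF n) (PF0 n))//.
pose H r := (\int[P]_w (PU n (r, w))%:E)%E.
have H0 r : (0 <= H r)%E by apply: integral_ge0 => w _; rewrite lee_fin.
have mH : measurable_fun `[0, t] H.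
  by apply: measurable_funTS; exact: (measurable_expectation P (mPU n) (PU0 n)).
have hH : (\int[leb]_(r in `[0%R, t]) ((cst 1 r)%:E * \int[P]_w (PF n (r, w))%:E) <=
    (K * T)%:E + K%:E * \int[leb]_(r in `[0%R, t]) H r)%E.
  apply: (@le_trans _ _ (\int[leb]_(r in `[0%R, t]) (K%:E * (cst 1 r)%:E + K%:E * H r))%E).
    apply: ge0_le_integral => //.
    - by move=> r _; rewrite mule_ge0// integral_ge0// => w _; rewrite lee_fin.
    - apply: emeasurable_funM; first by apply/measurable_EFinP; exact: measurable_cst.
      by apply: measurable_funTS; exact: (measurable_expectation P (mPF n) (PF0 n)).
    - apply: emeasurable_funD; apply: emeasurable_funM => //.
      by apply/measurable_EFinP; exact: measurable_cst.
    - move=> r /=; rewrite in_itv/= => /andP[r0 rt]; rewrite mul1e mule1.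
      by apply: PF_le; rewrite r0 (le_trans rt).
  have m1 : measurable_fun `[0, t] (EFin \o (cst 1 : R -> R)).
    by apply/measurable_EFinP; exact: measurable_cst.
  rewrite ge0_integralD//;
    try by [apply: emeasurable_funM | move=> r _; rewrite mule_ge0 ?lee_fin// ltW].
  rewrite !ge0_integralZl// ?lee_fin ?(ltW K0)//.
  by rewrite leeD2r// EFinM lee_wpmul2l ?lee_fin ?(ltW K0)// itv_cst.
apply: (@le_trans _ _ ((3 * (A1 + A2) + 0)%:E + (3 * T)%:E *
    ((K * T)%:E + K%:E * \int[leb]_(r in `[0%R, t]) H r))%E).
  apply: leeD; first exact: base_le.
  by rewrite lee_wpmul2l// lee_fin mulr_ge0// ltW.
rewrite ge0_muleDr; last 2 first.
- by rewrite lee_fin mulr_ge0 ?(ltW K0) ?(ltW T0).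
- by rewrite mule_ge0 ?lee_fin ?(ltW K0)// integral_ge0.
rewrite addeA -EFinM -EFinD muleA -EFinM addr0.
by rewrite /A /B [3 * T * (K * T)]mulrA.
Qed.

Let PU_le n t : 0 <= t <= T ->
  (\int[P]_w (PU n (t, w))%:E <= (2 * A * expR (2 * B * T))%:E)%E.
Proof.
move=> ht.
pose H r := (\int[P]_w (PU n (r, w))%:E)%E.
have H0 r : (0 <= H r)%E by apply: integral_ge0 => w _; rewrite lee_fin.
have Hfin r : 0 <= r <= T -> H r \is a fin_num.
  move=> hr; rewrite ge0_fin_numE//; apply: le_lt_trans (PU_bounded n hr) _; exact: ltry.
have B0 : 0 < B by rewrite !mulr_gt0.
have A0 : 0 <= A.
  by apply: addr_ge0; apply: mulr_ge0; rewrite ?addr_ge0// ltW.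
have := @gronwall _ T A B (3 * (A1 + A2) + 3 * \sum_(i < N) c i * n%:R ^+ 2)
  (fine \o H) (ltW T0) A0 B0.
move=> g; rewrite -/(H t) -(fineK (Hfin _ ht)) lee_fin; apply: g => //.
- apply: measurableT_comp => //; exact: (measurable_expectation P (mPU n) (PU0 n)).
- move=> r hr; rewrite fine_ge0//= -lee_fin fineK ?Hfin//.
  exact: PU_bounded.
- move=> r /[dup] hr /andP[r0 rT]; rewrite /= fineK ?Hfin//.
  rewrite (@eq_integral _ _ _ leb _ H (EFin \o (fine \o H))); first exact: gronwall_hyp.
  move=> s /set_mem/=; rewrite in_itv/= => /andP[s0 sr].
  by rewrite fineK// Hfin// s0 (le_trans sr).
Qed.

(** The events [Om n] increase to an event of full probability, because the time integrals of [F]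
    are almost surely finite; Fatou's lemma removes the localization. *)
Lemma moment_bound t : 0 <= t <= T ->
  (\int[P]_w (\sum_(i < N) c i * U i (t, w) ^+ 2)%:E <=
   (2 * (3 * (A1 + A2) + 3 * T * K * T) * expR (2 * (3 * T * K) * T))%:E)%E.
Proof.
move=> ht.
have mUt : measurable_fun setT (fun w => Su (t, w)) by exact: (measurable_fun_pair2 t mSu).
pose J0 w : R := \1_(\bigcup_n Om n) w.
have mJ0 : measurable_fun setT J0.
  by apply: measurable_indic; exact: bigcupT_measurable.
have aeJ : {ae P, forall w, J0 w = 1}.
  apply: filterS integ => w hw.
  rewrite /J0 indicE mem_set//.
  have Gfin : (Gi w < +oo)%E.
    apply: lte_sum_pinfty => i _; under eq_integral do rewrite mul1r; exact: hw.
  have G0 : (0 <= Gi w)%E.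
    by apply: sume_ge0 => i _; apply: integral_ge0 => r _; rewrite mul1r lee_fin.
  have Gf : Gi w \is a fin_num by rewrite ge0_fin_numE.
  exists (Num.bound (fine (Gi w))) => //; rewrite /Om/= -(fineK Gf) lee_fin.
  by apply: ltW; apply: archi_boundP; exact: fine_ge0.
rewrite (@ge0_ae_eq_integral _ _ _ P setT _ (fun w => (Su (t, w) * J0 w)%:E))//; last 5 first.
- exact/measurable_EFinP.
- by apply/measurable_EFinP; exact: measurable_funM.
- by move=> w _; rewrite lee_fin (ssum_ge0 (fun i => U i (t, w))).
- move=> w _; rewrite lee_fin mulr_ge0 ?(ssum_ge0 (fun i => U i (t, w)))//.
- by apply: filterS aeJ => w e _; rewrite e mulr1.
apply: (@fatou_le _ _ _ P (fun n w => PU n (t, w))).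
- by move=> n; exact: (measurable_fun_pair2 t (mPU n)).
- by move=> n w.
- move=> w; apply: cvg_near_cst; rewrite /PU /J0 /I/=.
  have [[n _ wn]|nw] := pselect ((\bigcup_n Om n) w).
    exists n => // k /= nk; rewrite !indicE !mem_set ?mul1r ?mulr1//; first by exists n.
    by apply: le_trans wn _; rewrite lee_fin ler_nat.
  apply: nearW => n; rewrite !indicE !memNset ?mul0r ?mulr0// => wn.
  by apply: nw; exists n.
- by apply: nearW => n; exact: PU_le.
Qed.

End moment_bound.

(** * Sums of powers of the eigenvalues *)

Section power_sums.
Context {R : realType}.

(** An eigenvalue may lie below 1, where a larger exponent gives a smaller power. The lower bound
    [b] pays for this, uniformly over exponents differing by at most [p]. *)
Lemma powR_le_shift (b lam x y p : R) : 0 < b <= 1 -> b <= lam -> x <= y <= x + p ->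
  lam `^ x <= b `^ (- p) * lam `^ y.
Proof.
move=> /[dup] hb /andP[b0 b1] bl /andP[xy yp].
have l0 : 0 < lam by exact: lt_le_trans bl.
have yx : 0 <= y - x by rewrite subr_ge0.
have -> : x = - (y - x) + y by ring.
rewrite powRD ?(gt_eqF l0) ?implybT// ler_wpM2r ?powR_ge0//.
apply: (@le_trans _ _ (b `^ (- (y - x)))).
  rewrite !powRN lef_pV2 ?posrE ?powR_gt0//.
  by apply: ge0_ler_powR; rewrite ?nnegrE ?(ltW b0) ?(ltW l0).
by apply: ger_powR => //; lra.
Qed.

(** A discrete integral test: the induction carries the remainder theta^(-1) k^(-theta) of the
    integral. *)
Lemma sum_powR_le (theta : R) n : 0 < theta ->
  \sum_(i < n) i.+1%:R `^ (- (1 + theta)) <= 1 + theta^-1.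
Proof.
move=> th0.
suff h k : \sum_(i < k.+1) i.+1%:R `^ (- (1 + theta)) <=
    1 + theta^-1 - theta^-1 * k.+1%:R `^ (- theta).
  case: n => [|n]; first by rewrite big_ord0 addr_ge0// invr_ge0 ltW.
  apply: (le_trans (h n)); rewrite gerBl mulr_ge0 ?powR_ge0// invr_ge0 ltW//.
elim: k => [|k IH]; first by rewrite big_ord_recr big_ord0/= !powR1 add0r mulr1 addrK.
rewrite big_ord_recr/=; apply: (le_trans (lerD IH (lexx _))).
set x : R := k.+1%:R; set y : R := k.+2%:R.
have x0 : 0 < x by rewrite ltr0n.
have y0 : 0 < y by rewrite ltr0n.
have yx : y = x + 1 by rewrite /x /y -natr1.
have yth : y `^ (- (1 + theta)) = y `^ (- theta) / y.
  by rewrite opprD powRD ?(gt_eqF y0) ?implybT// powR_inv1 ?(ltW y0)// mulrC.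
(* One induction step amounts to this inequality, which follows from exp z >= 1 + z and ln y - ln x
   >= 1 / y. *)
suff h : y `^ (- theta) * (1 + theta / y) <= x `^ (- theta).
  rewrite yth -subr_ge0 (_ : _ - _ = theta^-1 * (x `^ (- theta) - y `^ (- theta) * (1 + theta / y))).
    by rewrite mulr_ge0 ?subr_ge0// invr_ge0 ltW.
  by field; rewrite !gt_eqF.
rewrite /powR !gt_eqF//.
have -> : - theta * ln x = - theta * ln y + theta * (ln y - ln x) by ring.
rewrite expRD ler_wpM2l ?expR_ge0//.
apply: le_trans (expR_ge1Dx _); rewrite lerD2l ler_wpM2l ?(ltW th0)//.
have xy0 : 0 < x / y by rewrite divr_gt0.
have -> : ln y - ln x = - ln (x / y) by rewrite ln_div ?posrE// opprB.
have := expR_ge1Dx (ln (x / y)); rewrite lnK ?posrE//.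
have -> : x / y = 1 - y^-1 by rewrite yx; field; rewrite gt_eqF// -yx.
by rewrite lerD2l lerNr.
Qed.

(** In the exponent of [b], [p] pays for moving to the exponent -(1 + theta) and 2 for the factor
    b^(-(1 + theta)), as theta <= 1. *)
Lemma sum_eigen_powR_le (lam : nat -> R) (b theta p e : R) n : 0 < b <= 1 ->
  (forall i, b * i.+1%:R <= lam i) -> 0 < theta <= 1 ->
  e <= - (1 + theta) <= e + p ->
  \sum_(i < n) lam i `^ e <= b `^ (- (p + 2)) * (1 + theta^-1).
Proof.
move=> /[dup] hb /andP[b0 b1] bl /andP[th0 th1] he.
apply: (@le_trans _ _ (b `^ (- (p + 2)) * \sum_(i < n) i.+1%:R `^ (- (1 + theta)))); last first.
  by rewrite ler_wpM2l ?powR_ge0// sum_powR_le.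
rewrite mulr_sumr; apply: ler_sum => i _.
have bi : b <= b * i.+1%:R by rewrite ler_peMr ?(ltW b0)// ler1n.
apply: (le_trans (powR_le_shift hb (le_trans bi (bl i)) he)).
rewrite (opprD p) powRD ?(gt_eqF b0) ?implybT// -mulrA ler_wpM2l ?powR_ge0//.
have bi0 : 0 < b * i.+1%:R by rewrite mulr_gt0// ltr0n.
apply: (@le_trans _ _ ((b * i.+1%:R) `^ (- (1 + theta)))).
  rewrite !powRN lef_pV2 ?posrE ?powR_gt0//; last by apply: lt_le_trans (bl i).
  apply: ge0_ler_powR; rewrite ?nnegrE ?(ltW bi0)//; first by rewrite addr_ge0// ltW.
  exact: le_trans (ltW bi0) (bl i).
rewrite powRM ?(ltW b0)// ler_wpM2r ?powR_ge0//.
by apply: ger_powR => //; lra.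
Qed.

End power_sums.

(** * Choice of the exponents *)

Section exponents.
Context {R : realType}.
Variables (alpha m gamma : R).

(* The solution is controlled in [dotU delta]; [delta] is chosen as large as the
   temporal regularity requires, and strictly below the threshold [gamma] at
   which the noise leaves [dotU delta], with margin [gap]. *)
Definition delta_of := Num.max (Num.min gamma (2 * alpha) - alpha / 2) 0.
Definition gap_of := Num.min gamma (alpha * m / 2).
Definition theta_of := Num.min (gamma / (2 * alpha)) 1.

Hypotheses (alpha0 : 0 < alpha) (m0 : 0 < m) (m1 : m <= 1) (gamma0 : 0 < gamma).

Lemma delta_ge0 : 0 <= delta_of. Proof. by rewrite le_max lexx orbT. Qed.

Lemma gap_gt0 : 0 < gap_of. Proof. by rewrite lt_min gamma0 divr_gt0// mulr_gt0. Qed.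

Lemma gap_le : gap_of <= alpha * m / 2. Proof. by rewrite ge_min lexx orbT. Qed.

Lemma gap_le_gamma : gap_of <= gamma. Proof. by rewrite ge_min lexx. Qed.

(** The alpha / 2 subtracted in [delta_of] leaves room for gap <= alpha m / 2; where [delta_of] is
    0, gap <= gamma suffices. *)
Lemma delta_gap_le : delta_of + gap_of <= gamma.
Proof.
have am : alpha * m <= alpha by rewrite ler_piMr// ltW.
have h1 := gap_le; have h2 := gap_le_gamma.
have mg : Num.min gamma (2 * alpha) <= gamma by rewrite ge_min lexx.
by rewrite -lerBrDr /delta_of ge_max; apply/andP; split; lra.
Qed.

Lemma delta_le_gamma : delta_of <= gamma.
Proof. by have := delta_gap_le; have := gap_gt0; lra. Qed.

Lemma theta_ge0 : 0 <= theta_of.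
Proof. by rewrite le_min ler01 andbT divr_ge0 ?mulr_ge0// ltW. Qed.

Lemma theta_le1 : theta_of <= 1. Proof. by rewrite ge_min lexx orbT. Qed.

Lemma theta_alpha_le : 2 * alpha * theta_of <= gamma.
Proof.
have a2 : 0 < 2 * alpha by rewrite mulr_gt0.
by rewrite mulrC -ler_pdivlMr// ge_min lexx.
Qed.

(** Equivalently (alpha - delta) / 2 + alpha theta <= 3 alpha / 4, the power of the eigenvalue that
    the semigroup can absorb. *)
Lemma delta_theta : 2 * alpha * theta_of - alpha / 2 <= delta_of.
Proof.
rewrite le_max; apply/orP; left; rewrite lerD2r le_min theta_alpha_le.
by rewrite ler_piMr ?theta_le1// mulr_ge0// ltW.
Qed.

Lemma delta_theta_le : delta_of <= 2 * alpha * theta_of.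
Proof.
have a2 : 0 < 2 * alpha by rewrite mulr_gt0.
have th : 2 * alpha * theta_of = Num.min gamma (2 * alpha).
  rewrite /theta_of !minEle ler_pdivrMr// mul1r.
  by case: ifP => _; [rewrite mulrC divfK// gt_eqF|rewrite mulr1].
rewrite ge_max mulr_ge0 ?(ltW a2) ?theta_ge0// andbT th.
by rewrite gerBl divr_ge0// ltW.
Qed.

End exponents.

(** * Second moment of the stochastic convolution *)

Section noise_moment.
Context {R : realType}.
Variables (D : set (R * R)) (T alpha H mu rho : R) (lam : nat -> R).
Variable phi : nat -> R * R -> R.
Hypotheses (hD : bounded_domain D) (T0 : 0 < T) (halpha : 0 < alpha < 1).
Hypotheses (H0 : 0 < H) (H2 : H <> 2^-1) (mu0 : 0 < mu).
Hypothesis hphi : dirichlet_eigenbasis D lam phi.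
Local Notation m := (Num.min H 1).

Lemma eigen_lower_bound : exists2 b : R, 0 < b <= 1 &
  forall i, b * i.+1%:R <= lam i.
Proof.
have [_ _ _ bD] := hD.
have [c c0 cP] := weyl_lower_bound bD hphi.
exists (Num.min c 1); first by rewrite lt_min c0 ltr01 ge_min lexx orbT.
move=> i; apply: le_trans (cP i); rewrite ler_wpM2r// ge_min lexx//.
Qed.

Lemma noise_moment : exists2 C : R, 0 < C &
  forall (d : measure_display) (Omega : measurableType d) (P : probability Omega R)
    (sigma : nat -> R) (beta B : nat -> R -> Omega -> R) (X : nat -> R -> Omega -> R)
    (eps gamma t : R) (N : nat),
  noise_data P H mu rho lam sigma beta B ->
  convolution_coefs P lam alpha H mu T beta X ->
  0 < eps < 2 -> gamma = 2 * rho - 1 + (2 - eps) * alpha * m -> 0 < gamma ->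
  0 <= t <= T ->
  (forall i, X i t \in Lfun P 2%:E) /\
  (\int[P]_w (\sum_(i < N) lam i `^ delta_of alpha gamma * (sigma i * X i t w) ^+ 2)%:E
    <= (C / gap_of alpha m gamma ^+ 2)%:E)%E.
Proof.
have /andP[alpha0 alpha1] := halpha.
have [b hb bl] := eigen_lower_bound.
have /andP[b0 b1] := hb.
have [Ck Ck0 CkP] := noise_kernel_dot mu0 T0 H0 H2.
have m0 : 0 < m by rewrite lt_min H0 ltr01.
have m1 : m <= 1 by rewrite ge_min lexx orbT.
(* Bounds, uniformly in eps, how far the eigenvalue exponent can lie below -(1 + g / 2). *)
pose p := 2 * rho + 4 * alpha.
pose G2 := Gamma (H + 2^-1) ^+ 2.
have G20 : 0 <= G2 by exact: sqr_ge0.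
pose C := G2 * Ck * (4 * alpha) * b `^ (- (p + 2)) * 3.
have GC0 : 0 <= G2 * Ck by exact: mulr_ge0 G20 (ltW Ck0).
have Cp0 : 0 <= G2 * Ck * (4 * alpha) * b `^ (- (p + 2)).
  apply: mulr_ge0; last exact: powR_ge0.
  by apply: mulr_ge0 => //; rewrite mulr_ge0// ltW.
have C0 : 0 <= C by exact: mulr_ge0.
exists (C + 1); first by rewrite ltr_wpDl.
move=> d Omega P sigma beta B X eps gamma t N hn hX heps gE gamma0 ht.
have g0 := gap_gt0 alpha0 m0 gamma0.
have gm := gap_le alpha m gamma.
have gg := gap_le_gamma alpha m gamma.
have dg := delta_gap_le gamma alpha0 m1.
have de0 := delta_ge0 alpha gamma.
set g := gap_of alpha m gamma in g0 gm gg dg *.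
set de := delta_of alpha gamma in dg de0 *.
(* Half of the gap is spent here, since 2 alpha q = 2 alpha m - g / 2; the other half makes the
   series converge. *)
pose q := m - g / (4 * alpha).
have a4 : 0 < 4 * alpha by rewrite mulr_gt0.
have mq : m - q = g / (4 * alpha) by rewrite /q; ring.
have mq0 : 0 < m - q by rewrite mq divr_gt0.
have qm : q < m by rewrite -subr_gt0.
have mq2 : m / 2 <= q.
  have : g / (4 * alpha) <= m / 2.
    rewrite ler_pdivrMr// (le_trans gm)// -subr_ge0.
    rewrite (_ : _ - _ = 3 / 2 * (alpha * m)); last by field.
    by rewrite mulr_ge0// mulr_ge0 ?(ltW alpha0) ?(ltW m0).
  by rewrite /q; lra.
have lam0 i : 0 < lam i by apply: lt_le_trans (bl i); rewrite mulr_gt0.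
have hXi i : X i t \in Lfun P 2%:E /\
    dot P (X i t) (X i t) <= G2 * (Ck / (m - q) * (lam i `^ alpha) `^ (- (2 * q))).
  apply: (convolution_dot CkP (noise_tfBm hn i).1 (powR_gt0 _ (lam0 i)) mq2 qm ht).
  exact: hX.
split=> [i|]; first by have [] := hXi i.
have lX i := (hXi i).1.
under eq_integral do rewrite -sumEFin.
rewrite ge0_integral_sum//; last 2 first.
- move=> i; apply/measurable_EFinP; apply: measurable_funM => //.
  apply: measurable_funX; apply: measurable_funM => //; exact: Lfun2_measurable (lX i).
- by move=> i w _; rewrite lee_fin mulr_ge0 ?powR_ge0 ?sqr_ge0.
have term i : (\int[P]_w (lam i `^ de * (sigma i * X i t w) ^+ 2)%:E <=
    (G2 * Ck / (m - q) * lam i `^ (de - 2 * rho - 2 * alpha * q))%:E)%E.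
  have -> : (\int[P]_w (lam i `^ de * (sigma i * X i t w) ^+ 2)%:E =
      (lam i `^ de * sigma i ^+ 2 * dot P (X i t) (X i t))%:E)%E.
    rewrite EFinM dot_sqr// -ge0_integralZl//.
    - by apply: eq_integral => w _; rewrite -EFinM exprMn mulrA.
    - by apply/measurable_EFinP; apply: measurable_funX; exact: Lfun2_measurable (lX i).
    - by move=> w _; rewrite lee_fin sqr_ge0.
    - by rewrite lee_fin mulr_ge0 ?powR_ge0 ?sqr_ge0.
  rewrite lee_fin.
  have s2 : sigma i ^+ 2 <= lam i `^ (- (2 * rho)).
    rewrite -real_normK ?num_real// (_ : lam i `^ _ = (lam i `^ (- rho)) ^+ 2).
      by rewrite ler_sqr ?nnegrE ?powR_ge0// (noise_coef hn).
    by rewrite -powR_mulrn ?powR_ge0// -powRrM; congr (_ `^ _); ring.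
  apply: (@le_trans _ _ (lam i `^ de * lam i `^ (- (2 * rho)) *
      (G2 * (Ck / (m - q) * (lam i `^ alpha) `^ (- (2 * q)))))).
    apply: ler_pM.
    - by rewrite mulr_ge0 ?powR_ge0 ?sqr_ge0.
    - exact: dot_ge0.
    - by rewrite ler_wpM2l ?powR_ge0.
    - by have [] := hXi i.
  rewrite -powRrM le_eqVlt; apply/orP; left; apply/eqP.
  rewrite (_ : de - 2 * rho - 2 * alpha * q = de + - (2 * rho) + alpha * - (2 * q)); last by ring.
  by rewrite !powRD ?(gt_eqF (lam0 i)) ?implybT//; ring.
apply: (@le_trans _ _ (\sum_(i < N)
    (G2 * Ck / (m - q) * lam i `^ (de - 2 * rho - 2 * alpha * q))%:E)%E).
  by apply: lee_sum => i _; exact: term.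
rewrite sumEFin lee_fin -mulr_sumr.
have hg2 : 0 < g / 2 <= 1.
  rewrite divr_gt0//=; have : alpha * m <= 1 by rewrite mulr_ile1// ltW.
  by lra.
have am0 : 0 <= alpha * m by rewrite mulr_ge0// ltW.
have am : alpha * m <= alpha by rewrite ler_piMr// ltW.
have eam : 0 <= eps * (alpha * m) <= 2 * (alpha * m).
  have /andP[e0 e2] := heps.
  by rewrite mulr_ge0 ?(ltW e0)//= ler_wpM2r// ltW.
(* By the formula for gamma, the exponent equals delta - gamma - 1 + g / 2 - eps alpha m, and delta
   + g <= gamma. *)
have he : de - 2 * rho - 2 * alpha * q <= - (1 + g / 2) <= de - 2 * rho - 2 * alpha * q + p.
  have -> : 2 * alpha * q = 2 * (alpha * m) - g / 2.
    by rewrite /q; field; rewrite gt_eqF.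
  have gE' : gamma = 2 * rho - 1 + 2 * (alpha * m) - eps * (alpha * m) by rewrite gE; ring.
  by rewrite /p; apply/andP; split; lra.
have hs := sum_eigen_powR_le N hb bl hg2 he.
apply: (@le_trans _ _ (G2 * Ck / (m - q) * (b `^ (- (p + 2)) * (1 + (g / 2)^-1)))).
  by apply: ler_wpM2l => //; apply: divr_ge0 => //; exact: ltW.
(* One factor 1 / g comes from m - q, the other from the series; the remaining g + 2 is at most
   3. *)
have -> : G2 * Ck / (m - q) * (b `^ (- (p + 2)) * (1 + (g / 2)^-1)) =
    G2 * Ck * (4 * alpha) * b `^ (- (p + 2)) * (g + 2) / g ^+ 2.
  by rewrite mq; field; rewrite !gt_eqF.
rewrite ler_wpM2r ?invr_ge0 ?sqr_ge0//.
apply: (@le_trans _ _ C); last by rewrite lerDl.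
by rewrite /C ler_wpM2l//; lra.
Qed.

End noise_moment.

(** * The nonlinearity and the initial value in coordinates *)

Section spectral_bounds.
Context {R : realType}.
Variables (D : set (R * R)) (lam : nat -> R) (phi : nat -> R * R -> R).
Variable f : (R * R -> R) -> (R * R -> R).
Hypothesis mD : measurable (D : set (measurableTypeR R * measurableTypeR R)).
Hypothesis hphi : dirichlet_eigenbasis D lam phi.
Hypothesis hf : nonlinearity D lam phi f.

Lemma inU0 : inU D (cst 0).
Proof.
have := inUZ 0 (phiU hphi 0).
by rewrite (_ : (fun z => 0 * phi 0%N z) = cst 0)//; apply/funext => z; rewrite mul0r.
Qed.

(** A function with finitely many coordinates lies in every [dotU nu], so the growth condition
    applies at any level; the coordinates of f(u) beyond N are dropped. *)
Lemma nonlin_growth_coefs : exists2 K : R, 0 < K & forall nu u N, 0 <= nu -> inU D u ->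
  (forall i, (N <= i)%N -> ip D u (phi i) = 0) ->
  \sum_(i < N) lam i `^ nu * ip D (f u) (phi i) ^+ 2 <=
  K * (1 + \sum_(i < N) lam i `^ nu * ip D u (phi i) ^+ 2).
Proof.
have [K K0 KP] := nonlin_growth hf.
exists (2 * K ^+ 2) => [|nu u N nu0 uU u0]; first by rewrite mulr_gt0// exprn_gt0.
have du := dotU_finite lam nu uU u0.
have [dfu fuK] := KP nu u nu0 du.
have key (y z : R) : 0 <= y -> 0 <= z -> z <= K * (1 + y) ->
    z ^+ 2 <= 2 * K ^+ 2 * (1 + y ^+ 2).
  move=> y0 z0 zy; apply: (@le_trans _ _ ((K * (1 + y)) ^+ 2)).
    by rewrite ler_sqr ?nnegrE// (le_trans z0).
  rewrite -subr_ge0 (_ : _ - _ = (K * (1 - y)) ^+ 2) ?sqr_ge0//; ring.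
have eu : \sum_(i < N) lam i `^ nu * ip D u (phi i) ^+ 2 =
    normU D (Apow D lam phi (nu / 2) u) ^+ 2.
  by apply: EFin_inj; rewrite (Apow_half_norm mD hphi du) (sum_finite lam nu u0).
have fu_le : \sum_(i < N) lam i `^ nu * ip D (f u) (phi i) ^+ 2 <=
    normU D (Apow D lam phi (nu / 2) (f u)) ^+ 2.
  rewrite -lee_fin (Apow_half_norm mD hphi dfu) -sumEFin.
  rewrite -[leLHS](big_mkord xpredT (fun i => (lam i `^ nu * ip D (f u) (phi i) ^+ 2)%:E)).
  by apply: nneseries_lim_ge => i _ _; rewrite lee_fin mulr_ge0 ?powR_ge0 ?sqr_ge0.
rewrite eu; apply: (le_trans fu_le).
exact: (key _ _ (normU_ge0 _ _) (normU_ge0 _ _) fuK).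
Qed.

(** Comparing f(u) with f(0) gives linear growth in the norm of U. This serves the integrability of
    single paths, not the moments. *)
Lemma nonlin_coef_le : exists2 K : R, 0 < K & forall u i, inU D u ->
  `|ip D (f u) (phi i)| <= K * (1 + normU D u).
Proof.
have [K K0 KP] := nonlin_lipschitz hf.
have f0 := nonlin_inU hf inU0.
exists (K + normU D (f (cst 0))) => [|u i uU]; first by rewrite ltr_wpDr ?normU_ge0.
have fuU := nonlin_inU hf uU.
apply: (le_trans (normr_ip_le fuU (phiU hphi i))).
rewrite (normU_phi (phi_on hphi)) mulr1.
have h := KP _ _ uU inU0.
have h2 := ler_dist_normU fuU f0.
have e : u \- cst 0 = u by apply/funext => z /=; rewrite subr0.
rewrite e in h; move: h2; rewrite ler_norml => /andP[_ h2].
have := normU_ge0 D (f (cst 0)); have := normU_ge0 D u.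
nra.
Qed.

Lemma measurable_nonlin_coef {d} {S : measurableType d} (E : set S)
    (U : S -> R * R -> R) j : (forall x, E x -> inU D (U x)) ->
  (forall i, measurable_fun E (fun x => ip D (U x) (phi i))) ->
  measurable_fun E (fun x => ip D (f (U x)) (phi j)).
Proof.
move=> UU mU; have [K K0 KP] := nonlin_lipschitz hf.
apply: (measurable_lipschitz_comp (G := fun u => ip D (f u) (phi j)) hphi (ltW K0) UU mU).
move=> u v uU vU; have fuU := nonlin_inU hf uU; have fvU := nonlin_inU hf vU.
have pU := phiU hphi j.
rewrite -ipBl//; apply: (le_trans (normr_ip_le (inUB fuU fvU) pU)).
by rewrite (normU_phi (phi_on hphi)) mulr1; exact: KP.
Qed.

Section initial_value.
Context {d : measure_display} {Omega : measurableType d}.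
Variable P : probability Omega R.

Lemma L2dotnorm_coefs nu (u0 : Omega -> R * R -> R) N : random_U D phi u0 ->
  (L2dotnorm P D lam phi nu u0 < +oo)%E ->
  (\int[P]_w (\sum_(i < N) lam i `^ nu * ip D (u0 w) (phi i) ^+ 2)%:E <=
   (fine (L2dotnorm P D lam phi nu u0) ^+ 2)%:E)%E.
Proof.
move=> [uU mu0] fin.
have n0 : (0 <= L2dotnorm P D lam phi nu u0)%E by exact: Lnorm_ge0.
have nf : L2dotnorm P D lam phi nu u0 \is a fin_num by rewrite ge0_fin_numE.
have -> : (fine (L2dotnorm P D lam phi nu u0) ^+ 2)%:E = (L2dotnorm P D lam phi nu u0 `^ 2)%E.
  by rewrite -[X in (X `^ 2)%E](fineK nf) poweR_EFin powR_mulrn// fine_ge0.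
rewrite /L2dotnorm Lnorm2_sqr.
have term0 i w : (0 <= (lam i `^ nu * ip D (u0 w) (phi i) ^+ 2)%:E)%E.
  by rewrite lee_fin mulr_ge0 ?powR_ge0 ?sqr_ge0.
have mterm i : measurable_fun setT (fun w => (lam i `^ nu * ip D (u0 w) (phi i) ^+ 2)%:E).
  apply/measurable_EFinP; apply: measurable_funM => //; exact: measurable_funX.
have normE w : (`|dotnorm D lam phi nu (u0 w)| `^ 2 =
    \sum_(0 <= i <oo) (lam i `^ nu * ip D (u0 w) (phi i) ^+ 2)%:E)%E.
  rewrite gee0_abs; first exact: dotnorm_sqr.
  by rewrite /dotnorm; case: ifP => // _; rewrite lee_fin normU_ge0.
under [in leRHS]eq_integral do rewrite normE.
apply: ge0_le_integral => //.
- by move=> w _; rewrite lee_fin sumr_ge0// => i _; rewrite mulr_ge0 ?powR_ge0 ?sqr_ge0.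
- under eq_fun do rewrite -sumEFin; exact: emeasurable_sum.
- by apply: ge0_emeasurable_sum.
- move=> w _; rewrite -sumEFin.
  rewrite -[leLHS](big_mkord xpredT (fun i => (lam i `^ nu * ip D (u0 w) (phi i) ^+ 2)%:E)).
  exact: nneseries_lim_ge.
Qed.

End initial_value.
End spectral_bounds.

(** * Coordinates of the mild solution *)

Section mild_coordinates.
Context {R : realType} {d : measure_display} {Omega : measurableType d}.
Variables (P : probability Omega R) (D : set (R * R)).
Variables (lam : nat -> R) (phi : nat -> R * R -> R) (alpha T : R).
Variable f : (R * R -> R) -> (R * R -> R).
Variables (sigma : nat -> R) (X : nat -> R -> Omega -> R).
Variables (u0 : Omega -> R * R -> R) (N : nat) (u : R -> Omega -> R * R -> R).
Hypothesis mD : measurable (D : set (measurableTypeR R * measurableTypeR R)).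
Hypothesis hphi : dirichlet_eigenbasis D lam phi.
Hypothesis hf : nonlinearity D lam phi f.
Hypothesis hu : mild_solution P D lam phi alpha T f sigma X u0 N u.

Definition time_space : set (measurableTypeR R * Omega) := `[0, T] `*` setT.

(** Extension by zero outside [0, T] makes the coordinates measurable on the whole product space, as
    the Tonelli lemmas require. *)
Definition coef_u i : measurableTypeR R * Omega -> R :=
  (fun p => ip D (u p.1 p.2) (phi i)) \_ time_space.

Definition coef_f i : measurableTypeR R * Omega -> R :=
  (fun p => ip D (f (u p.1 p.2)) (phi i)) \_ time_space.

Let mE : measurable time_space. Proof. exact: measurableX. Qed.

Lemma coef_uE i t w : 0 <= t <= T -> coef_u i (t, w) = ip D (u t w) (phi i).
Proof. by move=> ht; rewrite /coef_u patchE mem_set//; split => //=; rewrite in_itv. Qed.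

Lemma coef_fE i t w : 0 <= t <= T -> coef_f i (t, w) = ip D (f (u t w)) (phi i).
Proof. by move=> ht; rewrite /coef_f patchE mem_set//; split => //=; rewrite in_itv. Qed.

Lemma measurable_coef_u i : measurable_fun setT (coef_u i).
Proof. exact: ((measurable_restrictT _ mE).1 (mild_measurable hu i)). Qed.

Lemma measurable_coef_f i : measurable_fun setT (coef_f i).
Proof.
apply: (measurable_restrictT _ mE).1.
apply: (measurable_nonlin_coef (U := fun p => u p.1 p.2) hphi hf).
- by move=> p [/=]; rewrite in_itv/= => ht _; exact: (mild_inU hu).
- exact: mild_measurable hu.
Qed.

(** The exceptional null set depends on [t] but is common to all [i]. Coordinates of index at least
    N vanish, which is what [nonlin_growth_coefs] asks for. *)
Lemma mild_coef t : 0 <= t <= T -> {ae P, forall w, forall i, ip D (u t w) (phi i) =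
  if (i < N)%N then expR (- (t * lam i `^ alpha)) * ip D (u0 w) (phi i)
    + \int[lebesgue_measure]_(r in `[0, t])
        (expR (- ((t - r) * lam i `^ alpha)) * coef_f i (r, w))
    + sigma i * X i t w else 0}.
Proof.
move=> /[dup] ht /andP[t0 tT]; apply: filterS (mild_eq hu ht) => w h i.
have pU := phiU hphi; have on := phi_on hphi.
pose c1 i := expR (- (t * lam i `^ alpha)) * ip D (u0 w) (phi i).
pose c2 i := \int[lebesgue_measure]_(s in `[0, t])
  ip D (SN D lam phi alpha N (t - s) (f (u s w))) (phi i).
pose c3 i := sigma i * X i t w.
have cU c : inU D (comb phi N c) by exact: inU_comb.
have -> : ip D (u t w) (phi i) =
    ip D ((comb phi N c1 \+ comb phi N c2) \+ comb phi N c3) (phi i).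
  have rU := inUD (inUD (cU c1) (cU c2)) (cU c3).
  exact: (ip_ae_eql (mild_inU hu w ht) rU (pU i) h).
rewrite !ipDl ?inUD// !(ip_comb pU on); case: ifP => iN; last by rewrite !addr0.
congr (_ + _ + _); apply: eq_Rintegral => r; rewrite inE/= in_itv/= => /andP[r0 rt].
rewrite coef_fE; last by rewrite r0 (le_trans rt).
rewrite (ip_comb pU on N (fun i => expR (- ((t - r) * lam i `^ alpha)) * ip D (f (u r w)) (phi i))).
by rewrite iN.
Qed.

(** A mild solution comes with an integrable U-norm of its path; linear growth transfers this to the
    coordinates of f(u). *)
Lemma mild_coef_integrable : {ae P, forall w, forall i,
  (\int[lebesgue_measure]_(r in `[0%R, T]) `|coef_f i (r, w)|%:E < +oo)%E}.
Proof.
have [K K0 KP] := nonlin_coef_le hphi hf.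
apply: filterS (mild_integrable hu) => w hw i.
have uU (r : R) : `[0, T]%classic r -> inU D (u r w).
  by rewrite /= in_itv/=; exact: (mild_inU hu).
have mu j : measurable_fun `[0, T] (fun r : R => ip D (u r w) (phi j)).
  apply: (@eq_measurable_fun _ _ _ _ _ (fun r : R => coef_u j (r, w))).
    by move=> r /set_mem/=; rewrite in_itv/= => hr; rewrite coef_uE.
  by apply: measurable_funTS; exact: (measurable_fun_pair1 w (measurable_coef_u j)).
have mn : measurable_fun `[0, T] (fun r : R => (normU D (u r w))%:E).
  apply/measurable_EFinP.
  have := measurable_normUB hphi uU mu (inU0 hphi).
  rewrite (_ : (fun r : R => normU D (u r w \- cst 0)) = (fun r : R => normU D (u r w)))//.
  by apply/funext => r; congr normU; apply/funext => z /=; rewrite subr0.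
apply: (@le_lt_trans _ _ (\int[lebesgue_measure]_(r in `[0%R, T])
   (K%:E * (cst 1%E r + (normU D (u r w))%:E)))%E).
  apply: ge0_le_integral => //.
  - apply/measurable_EFinP; apply: measurable_funTS; apply: measurableT_comp => //.
    exact: (measurable_fun_pair1 w (measurable_coef_f i)).
  - by apply: emeasurable_funM => //; exact: emeasurable_funD.
  - move=> r /=; rewrite in_itv/= => hr; rewrite -EFinD -EFinM lee_fin coef_fE//.
    by apply: KP; apply: uU; rewrite /= in_itv.
rewrite ge0_integralZl//; last 3 first.
- exact: emeasurable_funD.
- by move=> r _; rewrite adde_ge0// lee_fin normU_ge0.
- by rewrite lee_fin ltW.
rewrite ge0_integralD//; last by move=> r _; rewrite lee_fin normU_ge0.
rewrite integral_cst//= mul1e lebesgue_measure_itv/= lte_fin.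
apply: lte_mul_pinfty => //; first by rewrite lee_fin ltW.
by rewrite lte_add_pinfty//; case: ifP => // _; rewrite -EFinB ltry.
Qed.

End mild_coordinates.

(** * Second moments of the nonlinearity, uniform in time *)

Section nonlinearity_moment.
Context {R : realType}.
Variables (D : set (R * R)) (T alpha H mu rho : R) (lam : nat -> R).
Variable phi : nat -> R * R -> R.
Variable f : (R * R -> R) -> (R * R -> R).
Hypotheses (hD : bounded_domain D) (T0 : 0 < T) (halpha : 0 < alpha < 1).
Hypotheses (H0 : 0 < H) (H2 : H <> 2^-1) (mu0 : 0 < mu).
Hypothesis hphi : dirichlet_eigenbasis D lam phi.
Hypothesis hf : nonlinearity D lam phi f.
Local Notation m := (Num.min H 1).

(** A bound free of eps, which keeps the constants depending on gamma uniform. *)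
Lemma gamma_le (eps gamma : R) : 0 < eps < 2 ->
  gamma = 2 * rho - 1 + (2 - eps) * alpha * m -> gamma <= 2 * rho + 2 * alpha.
Proof.
have /andP[alpha0 _] := halpha.
have m0 : 0 < m by rewrite lt_min H0 ltr01.
have m1 : m <= 1 by rewrite ge_min lexx orbT.
move=> /andP[e0 e2] ->.
have : alpha * m <= alpha by rewrite ler_piMr// ltW.
have : 0 <= eps * (alpha * m) by rewrite mulr_ge0 ?mulr_ge0// ltW.
lra.
Qed.

Lemma nonlinearity_moment : exists2 C : R, 0 < C &
  forall (d : measure_display) (Omega : measurableType d) (P : probability Omega R)
    (sigma : nat -> R) (beta B X : nat -> R -> Omega -> R)
    (u0 : Omega -> R * R -> R) (eps gamma : R) (N : nat) (u : R -> Omega -> R * R -> R),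
  noise_data P H mu rho lam sigma beta B ->
  convolution_coefs P lam alpha H mu T beta X ->
  random_U D phi u0 -> 0 < eps < 2 ->
  mild_solution P D lam phi alpha T f sigma X u0 N u ->
  gamma = 2 * rho - 1 + (2 - eps) * alpha * m -> 0 < gamma ->
  (L2dotnorm P D lam phi (gamma + alpha) u0 < +oo)%E ->
  forall r, 0 <= r <= T ->
  (\int[P]_w (\sum_(i < N) lam i `^ delta_of alpha gamma *
      coef_f D phi T f u i (r, w) ^+ 2)%:E <=
   (C * ((gap_of alpha m gamma)^-1 +
      fine (L2dotnorm P D lam phi (gamma + alpha) u0)) ^+ 2)%:E)%E.
Proof.
have /andP[alpha0 alpha1] := halpha.
have mD : measurable (D : set (measurableTypeR R * measurableTypeR R)).
  by have [oD _ _ _] := hD; exact: open_measurable_plane.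
have [b hb bl] := eigen_lower_bound hD hphi.
have /andP[b0 b1] := hb.
have [K K0 KP] := nonlin_growth_coefs mD hphi hf.
have [Cn Cn0 CnP] := noise_moment rho hD T0 halpha H0 H2 mu0 hphi.
have m0 : 0 < m by rewrite lt_min H0 ltr01.
have m1 : m <= 1 by rewrite ge_min lexx orbT.
(* At least gamma + alpha - delta, so the initial value is controlled in [dotU delta] by its norm in
   [dotU (gamma + alpha)]. *)
pose p := 2 * rho + 3 * alpha.
pose E := expR (2 * (3 * T * K) * T).
pose Q := 3 * b `^ (- p) + 3 * Cn + 3 * T * K * T.
have Q0 : 0 < Q.
  rewrite ltr_pwDr ?mulr_gt0// addr_ge0 ?mulr_ge0 ?powR_ge0// ltW//.
have E0 : 0 < E by exact: expR_gt0.
exists (K + K * (2 * Q * E)); first by rewrite addr_gt0// !mulr_gt0.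
move=> d Omega P sigma beta B X u0 eps gamma N u hn hX hu0 heps hu gE gamma0 hL.
have gle := gamma_le heps gE.
have g0 := gap_gt0 alpha0 m0 gamma0.
have gm := gap_le alpha m gamma.
have dg := delta_le_gamma alpha0 m0 m1 gamma0.
have de0 := delta_ge0 alpha gamma.
set g := gap_of alpha m gamma in g0 gm *.
set de := delta_of alpha gamma in dg de0 *.
set L := fine _.
have L0 : 0 <= L by apply: fine_ge0; exact: Lnorm_ge0.
have g1 : g <= 1.
  have : alpha * m <= 1 by rewrite mulr_ile1// ltW.
  by lra.
have lam0 i : 0 < lam i by apply: lt_le_trans (bl i); rewrite mulr_gt0.
have bi i : b <= lam i by apply: le_trans (bl i); rewrite ler_peMr ?(ltW b0)// ler1n.
pose U := coef_u D phi T u; pose F := coef_f D phi T f u.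
have mU i : measurable_fun setT (U i) by exact: (measurable_coef_u hu).
have mF i : measurable_fun setT (F i) by exact: (measurable_coef_f hphi hf hu).
have c0 i : 0 <= lam i `^ de by exact: powR_ge0.
have growth r : 0 <= r <= T -> {ae P, forall w,
    \sum_(i < N) lam i `^ de * F i (r, w) ^+ 2 <=
    K * (1 + \sum_(i < N) lam i `^ de * U i (r, w) ^+ 2)}.
  move=> hr; apply: filterS (mild_coef hphi hu hr) => w h.
  rewrite /F /U; under eq_bigr do rewrite coef_fE//.
  under [in leRHS]eq_bigr do rewrite coef_uE//.
  apply: KP => //; first exact: (mild_inU hu).
  by move=> i Ni; rewrite h ltnNge Ni.
have moment t (ht : 0 <= t <= T) :=
  @moment_bound _ _ _ P N T K (b `^ (- p) * L ^+ 2) (Cn / g ^+ 2)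
  (fun i => lam i `^ de) (fun i => lam i `^ alpha) U F
  (fun i w => ip D (u0 w) (phi i)) (fun i t w => sigma i * X i t w)
  T0 K0 _ _ c0 (fun i => powR_ge0 _ _) mU mF _ _ _ growth _ _ _ t ht.
move=> r hr.
have hU : (\int[P]_w (\sum_(i < N) lam i `^ de * U i (r, w) ^+ 2)%:E <=
   (2 * (3 * (b `^ (- p) * L ^+ 2 + Cn / g ^+ 2) + 3 * T * K * T) * E)%:E)%E.
  apply: moment hr.
  - by rewrite mulr_ge0 ?powR_ge0 ?sqr_ge0.
  - by rewrite divr_ge0 ?sqr_ge0// ltW.
  - by move=> i; exact: hu0.2.
  - move=> i t ht; apply: measurable_funM => //.
    by apply: Lfun2_measurable; have [] := CnP _ _ P _ _ _ _ _ _ t N hn hX heps gE gamma0 ht.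
  - move=> t ht; apply: filterS (mild_coef hphi hu ht) => w h i iN.
    by rewrite /U coef_uE// h iN.
  - by apply: filterS (mild_coef_integrable hphi hf hu) => w h i _; exact: h.
  - apply: (@le_trans _ _ (\int[P]_w ((b `^ (- p))%:E *
      (\sum_(i < N) lam i `^ (gamma + alpha) * ip D (u0 w) (phi i) ^+ 2)%:E))%E).
      apply: ge0_le_integral => //.
      + by move=> w _; rewrite lee_fin sumr_ge0// => i _; rewrite mulr_ge0 ?sqr_ge0.
      + apply/measurable_EFinP; apply: measurable_sum => i; apply: measurable_funM => //.
        by apply: measurable_funX; exact: hu0.2.
      + apply: emeasurable_funM => //; apply/measurable_EFinP; apply: measurable_sum => i.
        by apply: measurable_funM => //; apply: measurable_funX; exact: hu0.2.
      + move=> w _; rewrite -EFinM lee_fin mulr_sumr; apply: ler_sum => i _.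
        rewrite [leRHS]mulrA ler_wpM2r ?sqr_ge0//; apply: powR_le_shift => //.
        by rewrite /p; apply/andP; split; lra.
    rewrite ge0_integralZl//; last 3 first.
    + apply/measurable_EFinP; apply: measurable_sum => i; apply: measurable_funM => //.
      by apply: measurable_funX; exact: hu0.2.
    + by move=> w _; rewrite lee_fin sumr_ge0// => i _; rewrite mulr_ge0 ?powR_ge0 ?sqr_ge0.
    + by rewrite lee_fin powR_ge0.
    by rewrite EFinM lee_wpmul2l ?lee_fin ?powR_ge0//; exact: L2dotnorm_coefs.
  - by move=> t ht; have [] := CnP _ _ P _ _ _ _ _ _ t N hn hX heps gE gamma0 ht.
have mUr : measurable_fun setT (fun w => (\sum_(i < N) lam i `^ de * U i (r, w) ^+ 2)%:E).
  apply/measurable_EFinP; apply: measurable_sum => i; apply: measurable_funM => //.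
  by apply: measurable_funX; exact: (measurable_fun_pair2 r (mU i)).
have U0 w : (0 <= (\sum_(i < N) lam i `^ de * U i (r, w) ^+ 2)%:E)%E.
  by rewrite lee_fin sumr_ge0// => i _; rewrite mulr_ge0 ?sqr_ge0.
apply: (@le_trans _ _ (\int[P]_w (K%:E * (cst 1%E w +
    (\sum_(i < N) lam i `^ de * U i (r, w) ^+ 2)%:E)))%E).
  apply: ae_ge0_le_integral => //.
  - by move=> w _; rewrite lee_fin sumr_ge0// => i _; rewrite mulr_ge0 ?sqr_ge0.
  - apply/measurable_EFinP; apply: measurable_sum => i; apply: measurable_funM => //.
    by apply: measurable_funX; exact: (measurable_fun_pair2 r (mF i)).
  - by move=> w _; rewrite mule_ge0 ?adde_ge0// lee_fin ltW.
  - by apply: emeasurable_funM => //; exact: emeasurable_funD.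
  - by apply: filterS (growth r hr) => w h _; rewrite -EFinD -EFinM lee_fin.
rewrite ge0_integralZl//; last 3 first.
- exact: emeasurable_funD.
- by move=> w _; rewrite adde_ge0.
- by rewrite lee_fin ltW.
rewrite ge0_integralD// integral_cst// mul1e.
rewrite [X in (_ * (X + _))%E](_ : _ = 1%E); last exact: probability_setT.
apply: (@le_trans _ _ (K%:E * (1 + (2 * (3 * (b `^ (- p) * L ^+ 2 + Cn / g ^+ 2)
    + 3 * T * K * T) * E)%:E))%E).
  by rewrite lee_wpmul2l ?lee_fin ?(ltW K0)// leeD2l.
rewrite -EFinD -EFinM lee_fin.
(* As g <= 1, additive constants can be absorbed into multiples of g^(-2). *)
have gi1 : 1 <= (g^-1) ^+ 2 by rewrite expr_ge1 ?invr_ge0 ?(ltW g0)// invf_ge1.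
have gi0 : 0 <= g^-1 by rewrite invr_ge0 ltW.
set G := g^-1 in gi1 gi0 *.
have -> : Cn / g ^+ 2 = Cn * G ^+ 2 by rewrite /G exprVn.
have S1 : G ^+ 2 <= (G + L) ^+ 2 by rewrite ler_sqr ?nnegrE ?addr_ge0// lerDl.
have S2 : L ^+ 2 <= (G + L) ^+ 2 by rewrite ler_sqr ?nnegrE ?addr_ge0// lerDr.
have S3 := le_trans gi1 S1.
have h1 : b `^ (- p) * L ^+ 2 <= b `^ (- p) * (G + L) ^+ 2 by rewrite ler_wpM2l ?powR_ge0.
have h2 : Cn * G ^+ 2 <= Cn * (G + L) ^+ 2 by rewrite ler_wpM2l ?(ltW Cn0).
have h3 : 3 * T * K * T <= 3 * T * K * T * (G + L) ^+ 2.
  by rewrite ler_peMr// !mulr_ge0// ltW.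
have h4 : 3 * (b `^ (- p) * L ^+ 2 + Cn * G ^+ 2) + 3 * T * K * T <= Q * (G + L) ^+ 2.
  by rewrite /Q; lra.
rewrite [leLHS]mulrDr mulr1 [leRHS]mulrDl; apply: lerD; first by rewrite ler_peMr// ltW.
rewrite -[leRHS]mulrA ler_wpM2l ?(ltW K0)//.
rewrite [leRHS](_ : _ = 2 * (Q * (G + L) ^+ 2) * E); last by ring.
by rewrite ler_wpM2r ?(ltW E0)// ler_wpM2l.
Qed.

End nonlinearity_moment.

(** * Time increments *)

Lemma powR_le_add1 {R : realType} (x r T : R) : 0 <= x <= T -> 0 <= r <= 1 -> x `^ r <= T + 1.
Proof.
move=> /andP[x0 xT] /andP[r0 r1].
have [x1|x1] := leP x 1.
  apply: (@le_trans _ _ 1); last by rewrite lerDr (le_trans x0).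
  apply: (@le_trans _ _ (1 `^ r)); last by rewrite powR1.
  by apply: ge0_ler_powR; rewrite ?nnegrE.
apply: (@le_trans _ _ x); last by rewrite (le_trans xT)// lerDl.
by apply: ler1_powR => //; exact: ltW.
Qed.

(** The smoothing estimate of an analytic semigroup, in one coordinate. *)
Lemma powR_expR_le {R : realType} (a x q : R) : 0 < a -> 0 < x -> 0 <= q <= 1 ->
  a `^ q * expR (- (x * a)) <= x `^ (- q).
Proof.
move=> a0 x0 hq; have z0 : 0 < x * a by rewrite mulr_gt0.
have h : expR (- (x * a)) <= 1 * (x * a) `^ (- q).
  apply: powR_le_expr => //; first by rewrite -[leRHS]expR0 ler_expR oppr_le0 ltW.
  rewrite expRN mulrC ler_pdivrMr ?expR_gt0// mul1r.
  by apply: le_trans (expR_ge1Dx _); rewrite lerDr.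
apply: (le_trans (ler_wpM2l (powR_ge0 _ _) h)).
rewrite mul1r powRM ?(ltW a0) ?(ltW x0)// mulrCA -powRD ?subrr ?powRr0 ?mulr1//.
by rewrite (gt_eqF a0) implybT.
Qed.

(** The difference is at most 1 and at most z; [powR_le_expr] interpolates between these bounds when
    applied at z^(-1). *)
Lemma one_sub_expR_le {R : realType} (z q : R) : 0 < z -> 0 <= q <= 1 ->
  0 <= 1 - expR (- z) <= z `^ q.
Proof.
move=> z0 hq; rewrite subr_ge0 -[X in _ <= X]expR0 ler_expR oppr_le0 (ltW z0)/=.
have : 1 - expR (- z) <= 1 * z^-1 `^ (- q).
  apply: powR_le_expr => //; first by rewrite invr_gt0.
  rewrite ler_pdivrMr// mul1r lerBlDr -lerBlDl.
  by have := expR_ge1Dx (- z); lra.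
by rewrite mul1r -[z^-1]powR_inv1 ?(ltW z0)// -powRrM mulN1r opprK.
Qed.

(** * The kernel of a time increment *)

Section increment_kernel.
Context {R : realType}.
Local Notation leb := (@lebesgue_measure R).
Variables (alpha gamma T b s t : R).
Hypotheses (halpha : 0 < alpha < 1) (gamma0 : 0 < gamma) (hb : 0 < b <= 1).
Hypotheses (s0 : 0 <= s) (st : s < t) (tT : t <= T).
Local Notation theta := (theta_of alpha gamma).
Local Notation delta := (delta_of alpha gamma).

(** The indicator merges the convolution integrals up to [t] and up to [s] into a single integral
    over ]0, t[. *)
Definition increment (a r : R) : R :=
  expR (- ((t - r) * a)) - expR (- ((s - r) * a)) * \1_(`]-oo, s[) r.

(** For r >= s no factor (t - s)^theta is extracted pointwise, so only alpha (3 / 4 - theta) of the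
    power remains to be absorbed; the maximum keeps the exponent nonnegative. *)
Let p := Num.max (3 / 4 - theta) 0.

(* [lam ^ (3 / 4 * alpha) * exp (- x * lam ^ alpha) <= x ^ (- 3 / 4)], and the
   choice of [delta] is such that no larger power of [lam] remains once the factor
   [(t - s) ^ theta] is extracted. *)
Definition increment_majorant (r : R) : R :=
  b `^ (- 2) * ((t - s) `^ theta * ((s - r) `^ (- (3 / 4)) * \1_(`]-oo, s[) r)
                + (t - r) `^ (- p) * \1_(`[s, +oo[) r).

Let alpha0 : 0 < alpha. Proof. by case/andP: halpha. Qed.
Let th0 : 0 <= theta. Proof. exact: theta_ge0. Qed.
Let th1 : theta <= 1. Proof. exact: theta_le1. Qed.
Let ts0 : 0 < t - s. Proof. by rewrite subr_gt0. Qed.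
Let p0 : 0 <= p. Proof. by rewrite le_max lexx orbT. Qed.
Let p34 : p <= 3 / 4.
Proof. by rewrite ge_max; apply/andP; split; [rewrite gerBl|rewrite divr_ge0]. Qed.
Let pth : 3 / 4 - theta <= p. Proof. by rewrite le_max lexx. Qed.
Let p1th : p + theta <= 1.
Proof. by rewrite -lerBrDr ge_max; apply/andP; split; have := th1; lra. Qed.

Lemma increment_majorant_ge0 r : 0 <= increment_majorant r.
Proof. by rewrite mulr_ge0 ?powR_ge0// addr_ge0 ?mulr_ge0 ?powR_ge0// indicE. Qed.

Lemma measurable_increment_majorant : measurable_fun setT increment_majorant.
Proof.
apply: measurable_funM => //; apply: measurable_funD.
  apply: measurable_funM => //; apply: measurable_funM; last exact: measurable_indic.
  exact: measurable_powR_reflect.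
by apply: measurable_funM; [exact: measurable_powR_reflect|exact: measurable_indic].
Qed.

Lemma measurable_increment a : measurable_fun setT (increment a).
Proof.
have ml c : measurable_fun setT (fun r : R => expR (- ((c - r) * a))).
  by under eq_fun do rewrite mulrC; exact: measurable_expR_line.
by apply: measurable_funB => //; apply: measurable_funM => //; exact: measurable_indic.
Qed.

Lemma increment_le l r : b <= l -> 0 < r < t ->
  `|l `^ ((alpha - delta) / 2) * increment (l `^ alpha) r| <= increment_majorant r.
Proof.
move=> bl /andP[r0 rt]; have /andP[b0 b1] := hb; have /andP[_ alpha1] := halpha.
have l0 : 0 < l by exact: lt_le_trans bl.
have a0 : 0 < l `^ alpha by exact: powR_gt0.
have d1 := delta_theta gamma alpha0; have d2 := delta_theta_le alpha0 gamma0.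
have d0 := delta_ge0 alpha gamma.
have ath : 0 <= alpha * theta <= alpha by rewrite mulr_ge0 ?(ltW alpha0)//= ler_piMr// ltW.
rewrite /increment /increment_majorant !indicE !mem_setE !in_itv/= andbT.
have [rs|sr] := ltP r s.
  rewrite !mulr1 mulr0 addr0 normrM ger0_norm ?powR_ge0//.
  have sr0 : 0 < s - r by rewrite subr_gt0.
  have -> : - ((t - r) * l `^ alpha) =
      - ((s - r) * l `^ alpha) + - ((t - s) * l `^ alpha) by ring.
  rewrite expRD -[X in `|_ - X|]mulr1 -mulrBr normrM ger0_norm ?expR_ge0// distrC.
  have z0 : 0 < (t - s) * l `^ alpha by rewrite mulr_gt0.
  have hth : 0 <= theta <= 1 by rewrite th0.
  have /andP[e0 e1] := one_sub_expR_le z0 hth.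
  rewrite ger0_norm//.
  apply: (@le_trans _ _ (l `^ ((alpha - delta) / 2) * (expR (- ((s - r) * l `^ alpha)) *
      ((t - s) * l `^ alpha) `^ theta))).
    by rewrite !ler_wpM2l ?powR_ge0 ?expR_ge0.
  rewrite powRM ?(ltW ts0) ?(ltW a0)// -powRrM.
  rewrite [leLHS](_ : _ = (t - s) `^ theta * (l `^ ((alpha - delta) / 2) * l `^ (alpha * theta)
      * expR (- ((s - r) * l `^ alpha)))); last by ring.
  rewrite [leRHS]mulrCA ler_wpM2l ?powR_ge0// -powRD ?(gt_eqF l0) ?implybT//.
  apply: (@le_trans _ _ (b `^ (- 2) * l `^ (alpha * (3 / 4)) * expR (- ((s - r) * l `^ alpha)))).
    rewrite ler_wpM2r ?expR_ge0//; apply: powR_le_shift => //.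
    by apply/andP; split; lra.
  rewrite -mulrA ler_wpM2l ?powR_ge0// powRrM.
  by apply: powR_expR_le => //; apply/andP; split; lra.
rewrite !mulr0 subr0 add0r mulr1 ger0_norm ?mulr_ge0 ?powR_ge0 ?expR_ge0//.
have tr0 : 0 < t - r by rewrite subr_gt0.
have ap : alpha * (3 / 4 - theta) <= alpha * p by rewrite ler_wpM2l ?(ltW alpha0).
have p1 : p <= 1 by apply: (le_trans p34); rewrite ler_pdivrMr// mul1r ler_nat.
have ap2 : alpha * p <= 1 by rewrite mulr_ile1 ?(ltW alpha0) ?(ltW alpha1).
have ap0 : 0 <= alpha * p by rewrite mulr_ge0 ?(ltW alpha0).
have p_ge0 := p0.
clearbody p.
apply: (@le_trans _ _ (b `^ (- 2) * l `^ (alpha * p) * expR (- ((t - r) * l `^ alpha)))).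
  rewrite ler_wpM2r ?expR_ge0//; apply: powR_le_shift => //.
  by apply/andP; split; lra.
rewrite -mulrA ler_wpM2l ?powR_ge0// powRrM.
by apply: powR_expR_le => //; apply/andP; split; lra.
Qed.

(** Before s the factor (t - s)^theta is already present; after s it comes from the integral (t -
    s)^(1 - p) / (1 - p), since p + theta <= 1. Each part contributes a 4, from the integrals of
    singularities of order at most 3/4. *)
Lemma integral_increment_majorant :
  (\int[leb]_(r in `]0%R, t[) (increment_majorant r)%:E <=
   (b `^ (- 2) * (8 * (T + 1)) * (t - s) `^ theta)%:E)%E.
Proof.
have T1 : 0 <= T + 1 by have := le_trans s0 (ltW (lt_le_trans st tT)); lra.
have tau0 : 0 <= (t - s) `^ theta by exact: powR_ge0.
apply: (@le_trans _ _ ((b `^ (- 2) * (t - s) `^ theta) * (4 * (T + 1))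
   + b `^ (- 2) * (4 * ((T + 1) * (t - s) `^ theta)))%:E); last first.
  by rewrite lee_fin le_eqVlt; apply/orP; left; apply/eqP; ring.
have sub (A B : set R) (g : R -> R) (M : \bar R) : measurable A -> measurable B ->
    (forall r, 0 <= g r) -> measurable_fun setT g ->
    (\int[leb]_(r in B) (g r)%:E <= M)%E ->
    (\int[leb]_(r in A) (g r * \1_B r)%:E <= M)%E.
  move=> mA mB g0 mg; apply: le_trans; rewrite [leRHS]integral_mkindic.
  apply: ge0_subset_integral => //.
  - by apply/measurable_EFinP; apply: measurable_funM => //; exact: measurable_indic.
  - by move=> r _; rewrite lee_fin mulr_ge0// indicE.
apply: (@integral_le_comb2 _ _ _ (fun r => (s - r) `^ (- (3 / 4)) * \1_(`]0, s[) r)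
  (fun r => (t - r) `^ (- p) * \1_(`[s, t[) r)).
- exact: measurable_itv.
- exact: measurable_increment_majorant.
- by apply: measurable_funM; [exact: measurable_powR_reflect|exact: measurable_indic].
- by apply: measurable_funM; [exact: measurable_powR_reflect|exact: measurable_indic].
- by rewrite mulr_ge0 ?powR_ge0.
- exact: powR_ge0.
- by move=> r _; exact: increment_majorant_ge0.
- by move=> r _; rewrite mulr_ge0 ?powR_ge0// indicE.
- by move=> r _; rewrite mulr_ge0 ?powR_ge0// indicE.
- move=> r /=; rewrite in_itv/= => /andP[r0 rt].
  rewrite /increment_majorant !indicE !mem_setE !in_itv/= r0 rt /= !andbT.
  by rewrite mulrDr mulrA.
- apply: sub => //.
  + by move=> r; exact: powR_ge0.
  + exact: measurable_powR_reflect.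
  have q0 : 0 < (1 / 4 : R) by rewrite divr_gt0.
  have := integral_powR_reflect s0 q0.
  rewrite (_ : 1 / 4 - 1 = - (3 / 4)); last by field.
  move=> /le_trans; apply; rewrite lee_fin subr0.
  rewrite (_ : _ / (1 / 4) = 4 * s `^ (1 / 4)); last by field.
  rewrite ler_wpM2l// powR_le_add1//; first by rewrite s0; have := st; have := tT; lra.
  by apply/andP; split; lra.
- apply: sub => //.
  + by move=> r; exact: powR_ge0.
  + exact: measurable_powR_reflect.
  rewrite -integral_itv_obnd_cbnd; last first.
    by apply/measurable_EFinP; apply: measurable_funTS; exact: measurable_powR_reflect.
  have q0 : 0 < 1 - p by have := p34; lra.
  have := integral_powR_reflect (ltW st) q0.
  rewrite (_ : 1 - p - 1 = - p); last by ring.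
  move=> /le_trans; apply; rewrite lee_fin ler_pdivrMr//.
  apply: (@le_trans _ _ ((T + 1) * (t - s) `^ theta)).
    rewrite (_ : 1 - p = (1 - p - theta) + theta); last by ring.
    rewrite powRD ?(gt_eqF ts0) ?implybT// ler_wpM2r//.
    apply: powR_le_add1; first by rewrite ltW//=; have := tT; have := s0; lra.
    by apply/andP; split; have := p1th; have := p0; have := th0; lra.
  have : 0 <= (T + 1) * (t - s) `^ theta by rewrite mulr_ge0.
  have := p34; nra.
Qed.

(** Path integrability of [F] allows the two integrals to be subtracted; the open interval avoids
    the singular ends of the majorant. *)
Lemma Rintegral_increment (a : R) (F : R -> R) : 0 <= a -> measurable_fun setT F ->
  (\int[leb]_(r in `[0%R, T]) `|F r|%:E < +oo)%E ->
  leb.-integrable `]0, t[ (fun r => (increment a r * F r)%:E) /\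
  \int[leb]_(r in `[0, t]) (expR (- ((t - r) * a)) * F r) -
  \int[leb]_(r in `[0, s]) (expR (- ((s - r) * a)) * F r) =
  \int[leb]_(r in `]0, t[) (increment a r * F r).
Proof.
move=> a0 mF Ffin.
have ml c : measurable_fun setT (fun r : R => expR (- ((c - r) * a))).
  by under eq_fun do rewrite mulrC; exact: measurable_expR_line.
have iF : leb.-integrable `[0, T] (EFin \o F).
  by apply/integrableP; split => //; apply/measurable_EFinP; exact: measurable_funTS.
have int c (A : set R) : measurable A -> A `<=` `[0, c] -> c <= T ->
    leb.-integrable A (EFin \o (fun r => expR (- ((c - r) * a)) * F r)).
  move=> mA Ac cT.
  have AT : A `<=` `[0, T].
    by move=> r /Ac/=; rewrite !in_itv/= => /andP[-> /=] /le_trans; apply.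
  apply: (@le_integrable _ _ _ leb A mA _ (EFin \o F)).
  - by apply/measurable_EFinP; apply: measurable_funTS; exact: (measurable_funM (ml c) mF).
  - move=> r /Ac/=; rewrite in_itv/= => /andP[r0 rc].
    rewrite lee_fin normrM ler_piMl// ger0_norm ?expR_ge0//.
    by rewrite -[leRHS]expR0 ler_expR oppr_le0 mulr_ge0// subr_ge0.
  - exact: integrableS iF.
have closed c : c <= T -> \int[leb]_(r in `[0, c]) (expR (- ((c - r) * a)) * F r) =
    \int[leb]_(r in `]0, c[) (expR (- ((c - r) * a)) * F r).
  move=> cT; rewrite -Rintegral_itv_obnd_cbnd; last first.
    by apply: int => // r /=; rewrite !in_itv/= => /andP[/ltW -> ->].
  rewrite Rintegral_itv_bndo_bndc//.
  by apply: int => // r /=; rewrite !in_itv/= => /andP[/ltW -> /ltW ->].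
have sT : s <= T by rewrite (le_trans (ltW st)).
have i1 : leb.-integrable `]0, t[ (EFin \o (fun r => expR (- ((t - r) * a)) * F r)).
  by apply: int => // r /=; rewrite !in_itv/= => /andP[/ltW -> /ltW ->].
pose G r := expR (- ((s - r) * a)) * F r.
have seq0 : `]0, s[%classic = `]0, t[ `&` `]-oo, s[ :> set R.
  apply/seteqP; split => r /=; rewrite !in_itv/=.
    by move=> /andP[-> rs]; rewrite rs (lt_trans rs).
  by move=> [/andP[-> _]].
have i2 : leb.-integrable `]0, t[ (EFin \o (G \_ `]-oo, s[)).
  apply: (@le_integrable _ _ _ leb `]0, t[ _ _ (EFin \o F)) => //.
  - apply/measurable_EFinP; apply: measurable_funTS.
    apply: (measurable_restrictT _ _).1 => //; apply: measurable_funTS.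
    exact: (measurable_funM (ml s) mF).
  - move=> r _; rewrite lee_fin patchE; case: ifPn => [/set_mem/=|_]; last by rewrite normr0.
    rewrite in_itv/= => rs; rewrite /G normrM ler_piMl// ger0_norm ?expR_ge0//.
    by rewrite -[leRHS]expR0 ler_expR oppr_le0 mulr_ge0// subr_ge0 ltW.
  - apply: integrableS iF => // r /=; rewrite !in_itv/= => /andP[/ltW -> /ltW rt].
    exact: le_trans rt tT.
have e r : increment a r * F r = expR (- ((t - r) * a)) * F r - (G \_ `]-oo, s[) r.
  rewrite /increment /G patchE indicE; case: ifPn => _; first by rewrite mulr1 mulrBl.
  by rewrite mulr0 !subr0.
split.
  rewrite (_ : (fun r => _) = (fun r : R => ((expR (- ((t - r) * a)) * F r)%:E
    - ((G \_ `]-oo, s[) r)%:E)%E)); first exact: integrableB.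
  by apply/funext => r; rewrite e EFinB.
rewrite !closed// seq0 Rintegral_mkcondr -RintegralB//.
by apply: eq_Rintegral => r _; rewrite e.
Qed.

End increment_kernel.

Lemma sqr_add2_le {R : realType} (x y : R) : (x + y) ^+ 2 <= 2 * x ^+ 2 + 2 * y ^+ 2.
Proof. by rewrite -subr_ge0 (_ : _ - _ = (x - y) ^+ 2) ?sqr_ge0//; ring. Qed.

(** * Mean-square increments *)

Section increment_moment.
Context {R : realType}.
Local Notation leb := (@lebesgue_measure R).
Variables (D : set (R * R)) (T alpha H mu rho : R) (lam : nat -> R).
Variable phi : nat -> R * R -> R.
Variable f : (R * R -> R) -> (R * R -> R).
Hypotheses (hD : bounded_domain D) (T0 : 0 < T) (halpha : 0 < alpha < 1).
Hypotheses (H0 : 0 < H) (H2 : H <> 2^-1) (mu0 : 0 < mu).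
Hypothesis hphi : dirichlet_eigenbasis D lam phi.
Hypothesis hf : nonlinearity D lam phi f.
Local Notation m := (Num.min H 1).

Lemma increment_moment : exists2 C : R, 0 < C &
  forall (d : measure_display) (Omega : measurableType d) (P : probability Omega R)
    (sigma : nat -> R) (beta B X : nat -> R -> Omega -> R)
    (u0 : Omega -> R * R -> R) (eps gamma : R) (N : nat) (u : R -> Omega -> R * R -> R),
  noise_data P H mu rho lam sigma beta B ->
  convolution_coefs P lam alpha H mu T beta X ->
  random_U D phi u0 -> 0 < eps < 2 ->
  mild_solution P D lam phi alpha T f sigma X u0 N u ->
  gamma = 2 * rho - 1 + (2 - eps) * alpha * m -> 0 < gamma ->
  (L2dotnorm P D lam phi (gamma + alpha) u0 < +oo)%E ->
  forall s t, 0 <= s -> s < t -> t <= T ->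
  (\int[P]_w (\sum_(i < N) lam i `^ alpha *
      ip D (zN phi sigma X N u t w \- zN phi sigma X N u s w) (phi i) ^+ 2)%:E <=
   (C * ((t - s) `^ theta_of alpha gamma * ((gap_of alpha m gamma)^-1 +
      fine (L2dotnorm P D lam phi (gamma + alpha) u0))) ^+ 2)%:E)%E.
Proof.
have /andP[alpha0 alpha1] := halpha.
have mD : measurable (D : set (measurableTypeR R * measurableTypeR R)).
  by have [oD _ _ _] := hD; exact: open_measurable_plane.
have [b hb bl] := eigen_lower_bound hD hphi.
have /andP[b0 b1] := hb.
have [C1 C10 C1P] := nonlinearity_moment rho hD T0 halpha H0 H2 mu0 hphi hf.
have [Cn Cn0 CnP] := noise_moment rho hD T0 halpha H0 H2 mu0 hphi.
(* An upper bound for gamma, hence for the distance from alpha + 2 alpha theta up to the regularity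
   gamma + alpha of the initial value. *)
pose p := 2 * rho + 2 * alpha.
pose Kc := b `^ (- 2) * (8 * (T + 1)).
have bp : 0 < b `^ (- p) by exact: powR_gt0.
have Kc0 : 0 < Kc by rewrite mulr_gt0 ?powR_gt0// mulr_gt0// addr_gt0.
exists (2 * b `^ (- p) + 2 * Kc ^+ 2 * C1).
  apply: addr_gt0; first exact: mulr_gt0.
  by apply: mulr_gt0 => //; apply: mulr_gt0 => //; exact: exprn_gt0.
move=> d Omega P sigma beta B X u0 eps gamma N u hn hX hu0 heps hu gE gamma0 hL s t s0 st tT.
have gle := gamma_le halpha H0 heps gE.
have m0 : 0 < m by rewrite lt_min H0 ltr01.
have g0 := gap_gt0 alpha0 m0 gamma0.
have M0 := C1P _ _ P _ _ _ _ _ _ _ N u hn hX hu0 heps hu gE gamma0 hL.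
have th0 := theta_ge0 alpha0 gamma0.
have th1 := theta_le1 alpha gamma.
have tha := theta_alpha_le gamma alpha0.
set L := fine _ in M0 *; set g := gap_of _ _ _ in g0 M0 *.
set theta := theta_of _ _ in th0 th1 tha *; set de := delta_of _ _ in M0.
have L0 : 0 <= L by apply: fine_ge0; exact: Lnorm_ge0.
have lam0 i : 0 < lam i by apply: lt_le_trans (bl i); rewrite mulr_gt0.
have bi i : b <= lam i by apply: le_trans (bl i); rewrite ler_peMr ?(ltW b0)// ler1n.
have a0 i : 0 <= lam i `^ alpha by exact: powR_ge0.
have pU := phiU hphi; have on := phi_on hphi.
have hs : 0 <= s <= T by rewrite s0 (le_trans (ltW st)).
have ht : 0 <= t <= T by rewrite tT (le_trans s0 (ltW st)).
have ts0 : 0 < t - s by rewrite subr_gt0.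
pose tau := (t - s) `^ theta.
have tau0 : 0 <= tau by exact: powR_ge0.
pose F := coef_f D phi T f u.
pose x i w := ip D (u0 w) (phi i).
have mF i : measurable_fun setT (F i) by exact: (measurable_coef_f hphi hf hu).
pose dz i w := ip D (zN phi sigma X N u t w \- zN phi sigma X N u s w) (phi i).
have cU c : inU D (comb phi N c) by exact: inU_comb.
have dzE i w : dz i w = ip D (u t w) (phi i) - ip D (u s w) (phi i) -
    (if (i < N)%N then sigma i * X i t w - sigma i * X i s w else 0).
  have uU := mild_inU hu w ht; have uU' := mild_inU hu w hs.
  have zU := inUB uU (cU (fun i => sigma i * X i t w)).
  have zU' := inUB uU' (cU (fun i => sigma i * X i s w)).
  rewrite /dz (ipBl zU zU' (pU i)) (ipBl uU (cU _) (pU i)) (ipBl uU' (cU _) (pU i)).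
  by rewrite !(ip_comb pU on); case: ifP => _; ring.
have mX i r : 0 <= r <= T -> measurable_fun setT (X i r).
  move=> hr; apply: Lfun2_measurable.
  by have [] := CnP _ _ P _ _ _ _ _ _ r N hn hX heps gE gamma0 hr.
have mu' i r : 0 <= r <= T -> measurable_fun setT (fun w => ip D (u r w) (phi i)).
  move=> hr; have := measurable_fun_pair2 r (measurable_coef_u hu i).
  by rewrite (_ : (fun w => coef_u D phi T u i (r, w)) = (fun w => ip D (u r w) (phi i)))//;
    apply/funext => w; rewrite coef_uE.
have mdz i : measurable_fun setT (dz i).
  rewrite (funext (dzE i)).
  apply: measurable_funB; first by apply: measurable_funB; exact: mu'.
  case: (i < N)%N => //.
  by apply: measurable_funB; apply: measurable_funM => //; exact: mX.
pose h i := increment s t (lam i `^ alpha).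
(* The weight lam^alpha of the norm equals lam^delta times the square of this factor, which is moved
   into the kernel. *)
pose ci i := lam i `^ ((alpha - de) / 2).
pose k := increment_majorant alpha gamma b s t.
have mk : measurable_fun setT k by exact: measurable_increment_majorant.
have k0 r : 0 <= k r by exact: increment_majorant_ge0.
have mh i : measurable_fun setT (h i) by exact: measurable_increment.
have kI : (\int[leb]_(r in `]0%R, t[) (k r)%:E <= (Kc * tau)%:E)%E.
  exact: integral_increment_majorant.
have kap0 : 0 < Kc * tau by rewrite mulr_gt0// powR_gt0.
have mFw i w : measurable_fun setT (fun r : R => F i (r, w)).
  exact: (measurable_fun_pair1 w (mF i)).
pose Sf (q : measurableTypeR R * Omega) := \sum_(i < N) lam i `^ de * F i q ^+ 2.
have mSf : measurable_fun setT Sf.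
  apply: measurable_sum => i; apply: measurable_funM => //; exact: measurable_funX.
have Sf0 q : 0 <= Sf q.
  by apply: sumr_ge0 => i _; rewrite mulr_ge0 ?powR_ge0 ?sqr_ge0.
pose Q w := (\int[leb]_(r in `]0%R, t[) (k r * Sf (r, w))%:E)%E.
have Q0 w : (0 <= Q w)%E.
  by apply: integral_ge0 => r _; rewrite lee_fin mulr_ge0.
have mQ : measurable_fun setT Q by apply: (measurable_kernel_integral (Phi := Sf)).
pose Sx w := \sum_(i < N) lam i `^ (gamma + alpha) * x i w ^+ 2.
have Sx0 w : 0 <= Sx w.
  by apply: sumr_ge0 => i _; rewrite mulr_ge0 ?powR_ge0 ?sqr_ge0.
have mSx : measurable_fun setT Sx.
  apply: measurable_sum => i; apply: measurable_funM => //.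
  by apply: measurable_funX; exact: hu0.2.
have kx0 : 0 <= 2 * b `^ (- p) * tau ^+ 2 by rewrite mulr_ge0 ?sqr_ge0// mulr_ge0// ltW.
have kq0 : 0 <= 2 * (Kc * tau) by rewrite mulr_ge0// ltW.
have path : {ae P, forall w, ((\sum_(i < N) lam i `^ alpha * dz i w ^+ 2)%:E <=
    (2 * b `^ (- p) * tau ^+ 2 * Sx w)%:E + (2 * (Kc * tau))%:E * Q w)%E}.
  apply: filterS3 (mild_coef hphi hu ht) (mild_coef hphi hu hs)
    (mild_coef_integrable hphi hf hu) => w Et Es Ffin.
  pose J i := \int[leb]_(r in `]0, t[) (ci i * h i r * F i (r, w)).
  have term i : (i < N)%N -> lam i `^ alpha * dz i w ^+ 2 <=
      2 * b `^ (- p) * tau ^+ 2 * (lam i `^ (gamma + alpha) * x i w ^+ 2)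
      + 2 * (lam i `^ de * J i ^+ 2).
    move=> iN.
    have [iH JE] := Rintegral_increment st tT (a0 i) (mFw i w) (Ffin i).
    pose y := \int[leb]_(r in `]0, t[) (h i r * F i (r, w)).
    pose De := expR (- (t * lam i `^ alpha)) - expR (- (s * lam i `^ alpha)).
    have dzy : dz i w = De * x i w + y.
      have Et' : ip D (u t w) (phi i) = expR (- (t * lam i `^ alpha)) * x i w
          + \int[leb]_(r in `[0, t]) (expR (- ((t - r) * lam i `^ alpha)) * F i (r, w))
          + sigma i * X i t w by rewrite Et iN.
      have Es' : ip D (u s w) (phi i) = expR (- (s * lam i `^ alpha)) * x i w
          + \int[leb]_(r in `[0, s]) (expR (- ((s - r) * lam i `^ alpha)) * F i (r, w))
          + sigma i * X i s w by rewrite Es iN.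
      rewrite dzE Et' Es' iN /y -JE /De.
      move: (\int[leb]_(r in _) _) (\int[leb]_(r in _) _) => y1 y2; ring.
    have Jy : J i = ci i * y.
      rewrite /J /y -RintegralZl//; apply: eq_Rintegral => r _; by rewrite mulrA.
    have lamde : lam i `^ alpha = lam i `^ de * ci i ^+ 2.
      rewrite /ci -powR_mulrn ?powR_ge0// -powRrM -powRD ?(gt_eqF (lam0 i)) ?implybT//.
      by congr (_ `^ _); field.
    (* Hoelder continuity of the semigroup: the initial term pays for (t - s)^theta with lam^(alpha
       theta), which fits because 2 alpha theta <= gamma. *)
    have De2 : De ^+ 2 <= tau ^+ 2 * lam i `^ (2 * alpha * theta).
      have z0 : 0 < (t - s) * lam i `^ alpha by rewrite mulr_gt0 ?powR_gt0.
      have hth : 0 <= theta <= 1 by rewrite th0.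
      have /andP[e0 e1] := one_sub_expR_le z0 hth.
      have DeE : De = - (expR (- (s * lam i `^ alpha)) * (1 - expR (- ((t - s) * lam i `^ alpha)))).
        rewrite mulrBr mulr1 -expRD opprB /De; congr (expR _ - _); ring.
      rewrite DeE sqrrN exprMn.
      rewrite [leRHS](_ : _ = 1 * (((t - s) * lam i `^ alpha) `^ theta) ^+ 2); last first.
        rewrite powRM ?(ltW ts0)// exprMn mul1r; congr (_ * _).
        by rewrite -powRrM -powR_mulrn ?powR_ge0// -powRrM; congr (_ `^ _); ring.
      apply: ler_pM; rewrite ?sqr_ge0//.
        rewrite expr_le1 ?expR_ge0// -[leRHS]expR0 ler_expR oppr_le0 mulr_ge0//.
      by rewrite ler_sqr ?nnegrE ?powR_ge0.
    have lamle : lam i `^ alpha * lam i `^ (2 * alpha * theta) <= b `^ (- p) * lam i `^ (gamma + alpha).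
      rewrite -powRD ?(gt_eqF (lam0 i)) ?implybT//; apply: powR_le_shift => //.
      have : 0 <= 2 * alpha * theta by rewrite !mulr_ge0// ltW.
      by rewrite /p; move=> ?; apply/andP; split; lra.
    have sq2 := sqr_add2_le (De * x i w) y.
    rewrite dzy; apply: (le_trans (ler_wpM2l (a0 i) sq2)).
    rewrite mulrDr; apply: lerD; last first.
      by rewrite Jy exprMn lamde le_eqVlt; apply/orP; left; apply/eqP; ring.
    rewrite exprMn [leLHS](_ : _ = 2 * x i w ^+ 2 * (lam i `^ alpha * De ^+ 2)); last by ring.
    rewrite [leRHS](_ : _ = 2 * x i w ^+ 2 *
      (tau ^+ 2 * (b `^ (- p) * lam i `^ (gamma + alpha)))); last by ring.
    apply: ler_wpM2l; first by rewrite mulr_ge0 ?sqr_ge0.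
    apply: (@le_trans _ _ (tau ^+ 2 * (lam i `^ alpha * lam i `^ (2 * alpha * theta)))).
      by rewrite [leRHS]mulrCA; apply: ler_wpM2l.
    by apply: ler_wpM2l => //; exact: sqr_ge0.
  apply: (@le_trans _ _ ((2 * b `^ (- p) * tau ^+ 2 * Sx w)%:E +
      2%:E * (\sum_(i < N) lam i `^ de * J i ^+ 2)%:E)%E).
    rewrite -EFinM -EFinD lee_fin /Sx !mulr_sumr -big_split/=.
    by apply: ler_sum => i _; exact: term.
  rewrite leeD2l// EFinM -muleA lee_wpmul2l//.
  apply: (@sum_Rintegral_kernel_sqr_le _ _ N (fun i => lam i `^ de)
    (fun i r => ci i * h i r) (fun i r => F i (r, w)) k) => //.
  - by move=> i; exact: powR_ge0.
  - by move=> i; exact: measurable_funM.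
  - move=> i r _; rewrite /= in_itv/= => hr.
    exact: (increment_le halpha gamma0 hb st).
apply: (@le_trans _ _ (\int[P]_w ((2 * b `^ (- p) * tau ^+ 2)%:E * (Sx w)%:E
    + (2 * (Kc * tau))%:E * Q w))%E).
  apply: ae_ge0_le_integral => //.
  - by move=> w _; rewrite lee_fin sumr_ge0// => i _; rewrite mulr_ge0 ?powR_ge0 ?sqr_ge0.
  - apply/measurable_EFinP; apply: measurable_sum => i; apply: measurable_funM => //.
    by apply: measurable_funX; exact: mdz.
  - by move=> w _; rewrite adde_ge0// mule_ge0// lee_fin.
  - apply: emeasurable_funD; apply: emeasurable_funM => //; exact/measurable_EFinP.
  - by apply: filterS path => w hw _; rewrite -EFinM.
rewrite ge0_integralD//; try by [move=> w _; rewrite mule_ge0// lee_fin |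
  apply: emeasurable_funM => //; exact/measurable_EFinP].
rewrite !ge0_integralZl//; try by [move=> w _; rewrite lee_fin | rewrite lee_fin | exact/measurable_EFinP].
have hS : (\int[P]_w (Sx w)%:E <= (L ^+ 2)%:E)%E by exact: L2dotnorm_coefs.
(* The mass of the kernel enters twice, through Cauchy-Schwarz in [path] and through Tonelli here;
   this produces the square of (t - s)^theta. *)
have hQ : (\int[P]_w Q w <= (Kc * tau * (C1 * (g^-1 + L) ^+ 2))%:E)%E.
  apply: (expectation_kernel_integral_le (Phi := Sf)) => //.
  - by rewrite mulr_ge0 ?sqr_ge0 ?(ltW C10).
  - move=> r; rewrite /= in_itv/= => /andP[r0 rt]; apply: M0.
    by rewrite (ltW r0) (le_trans (ltW rt)).
apply: (@le_trans _ _ ((2 * b `^ (- p) * tau ^+ 2)%:E * (L ^+ 2)%:E +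
   (2 * (Kc * tau))%:E * (Kc * tau * (C1 * (g^-1 + L) ^+ 2))%:E)%E).
  by apply: leeD; apply: lee_wpmul2l; rewrite ?lee_fin.
rewrite -!EFinM -EFinD lee_fin -/tau.
have gi0 : 0 <= g^-1 by rewrite invr_ge0 ltW.
have L2 : L ^+ 2 <= (g^-1 + L) ^+ 2 by rewrite ler_sqr ?nnegrE ?addr_ge0// lerDr.
rewrite [leRHS](_ : _ = 2 * b `^ (- p) * tau ^+ 2 * (g^-1 + L) ^+ 2 +
  2 * (Kc * tau) * (Kc * tau * (C1 * (g^-1 + L) ^+ 2))); last by ring.
by rewrite lerD2r ler_wpM2l.
Qed.

End increment_moment.

(** * From second moments to the stated norms *)

Lemma ereal_sqr_le {R : realType} (x : \bar R) (c q : R) : (0 <= x)%E -> 0 <= c -> 0 <= q ->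
  (x `^ 2 <= (c * q ^+ 2)%:E)%E -> (x <= (Num.sqrt c * q)%:E)%E.
Proof.
case: x => [r| |]//; last by rewrite poweRyr.
rewrite poweR_EFin !lee_fin => r0 c0 q0; rewrite powR_mulrn// => rcq.
by rewrite -ler_sqr ?nnegrE ?mulr_ge0 ?sqrtr_ge0// exprMn sqr_sqrtr.
Qed.

(** The minimum is at most gamma^2, and gamma <= G: gamma^2 <= G gamma where the gap is gamma, and
    gamma^2 <= G^2 where it is the constant alpha m / 2. *)
Lemma gap_inv_le {R : realType} (alpha m gamma G x : R) : 0 < alpha -> 0 < m ->
  0 < gamma -> gamma <= G -> 0 < x ->
  (gap_of alpha m gamma)^-1 <= (G + 2 * G ^+ 2 / (alpha * m)) * (Num.min x (gamma ^+ 2))^-1.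
Proof.
move=> alpha0 m0 gamma0 gG x0.
have am0 : 0 < alpha * m by exact: mulr_gt0.
have G0 : 0 < G by exact: lt_le_trans gG.
have mn0 : 0 < Num.min x (gamma ^+ 2) by rewrite lt_min x0 exprn_gt0.
have mn : Num.min x (gamma ^+ 2) <= gamma ^+ 2 by rewrite ge_min lexx orbT.
rewrite ler_pdivlMr// mulrC ler_pdivrMr ?gap_gt0//; apply: (le_trans mn).
have G2 : 0 <= 2 * G ^+ 2 / (alpha * m).
  by apply: divr_ge0; [rewrite mulr_ge0 ?sqr_ge0|exact: ltW].
rewrite /gap_of minEle; case: ifP => _.
  by rewrite expr2 ler_wpM2r ?(ltW gamma0)// (le_trans gG)// lerDl.
apply: (@le_trans _ _ (2 * G ^+ 2 / (alpha * m) * (alpha * m / 2))).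
  rewrite [leRHS](_ : _ = G ^+ 2); last by field; rewrite !gt_eqF.
  by rewrite ler_sqr ?nnegrE// ltW.
by rewrite ler_wpM2r ?divr_ge0 ?(ltW am0)// lerDr ltW.
Qed.

Theorem theorem7 (R : realType) (D : set (R * R)) (T alpha H mu rho : R)
    (lam : nat -> R) (phi : nat -> R * R -> R)
    (f : (R * R -> R) -> (R * R -> R))
    (hD : bounded_domain D) (hT : 0 < T) (halpha : 0 < alpha < 1)
    (hH : 0 < H) (hH2 : H <> 2^-1) (hmu : 0 < mu) (hrho : 0 <= rho)
    (hphi : dirichlet_eigenbasis D lam phi)
    (hf : nonlinearity D lam phi f) :
  exists2 C : R, 0 < C &
    forall (d : measure_display) (Omega : measurableType d)
      (P : probability Omega R)
      (sigma : nat -> R) (beta B : nat -> R -> Omega -> R)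
      (X : nat -> R -> Omega -> R)
      (u0 : Omega -> R * R -> R) (eps : R) (N : nat)
      (uN : R -> Omega -> R * R -> R),
    noise_data P H mu rho lam sigma beta B ->
    convolution_coefs P lam alpha H mu T beta X ->
    random_U D phi u0 ->
    0 < eps < 2 ->
    (0 < N)%N ->
    mild_solution P D lam phi alpha T f sigma X u0 N uN ->
    let gamma := 2 * rho - 1 + (2 - eps) * alpha * Num.min H 1 in
    2^-1 - (2 - eps) / 2 * alpha * Num.min H 1 < rho ->
    (L2dotnorm P D lam phi (gamma + alpha) u0 < +oo)%E ->
    forall s t : R, 0 <= s -> s < t -> t <= T ->
    (L2Unorm P D
       (fun w => ApowN D lam phi N (alpha / 2)
                   (zN phi sigma X N uN t w \- zN phi sigma X N uN s w)%R)
     <= C%:E * ((t - s) `^ Num.min (gamma / (2 * alpha)) 1)%:E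
        * ((Num.min (gamma * alpha * H) (gamma ^+ 2))^-1%:E
           + L2dotnorm P D lam phi (gamma + alpha) u0))%E.
Proof.
have /andP[alpha0 alpha1] := halpha.
have mD : measurable (D : set (measurableTypeR R * measurableTypeR R)).
  by have [oD _ _ _] := hD; exact: open_measurable_plane.
have [C0 C00 C0P] := increment_moment rho hD hT halpha hH hH2 hmu hphi hf.
(* The bound of [gamma_le], chosen before eps is introduced. *)
pose G := 2 * rho + 2 * alpha.
have G0 : 0 < G by rewrite ltr_wpDl ?mulr_ge0// mulr_gt0.
pose m := Num.min H 1.
have m0 : 0 < m by rewrite lt_min hH ltr01.
pose Cg := G + 2 * G ^+ 2 / (alpha * m).
have Cg0 : 0 < Cg.
  apply: ltr_wpDr => //; apply: divr_ge0; first by rewrite mulr_ge0 ?sqr_ge0.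
  by rewrite mulr_ge0 ?ltW.
exists (Num.sqrt C0 * (Cg + 1)); first by rewrite mulr_gt0 ?sqrtr_gt0// addr_gt0.
move=> d Omega P sigma beta B X u0 eps N uN hn hX hu0 heps _ hu gamma hgamma hL s t s0 st tT.
(* The lower bound assumed on rho is exactly the positivity of gamma. *)
have gamma0 : 0 < gamma by rewrite /gamma; move: hgamma; lra.
have gG : gamma <= G by exact: (gamma_le halpha hH heps).
have main := C0P _ _ P _ _ _ _ _ _ _ N uN hn hX hu0 heps hu erefl gamma0 hL s t s0 st tT.
have hs : 0 <= s <= T by rewrite s0 (le_trans (ltW st)).
have ht : 0 <= t <= T by rewrite tT (le_trans s0 (ltW st)).
rewrite -/m in main *.
set L2 := L2dotnorm _ _ _ _ _ _ in hL main *.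
have L20 : (0 <= L2)%E by exact: Lnorm_ge0.
have L2f : L2 \is a fin_num by rewrite ge0_fin_numE.
have L0 : 0 <= fine L2 by exact: fine_ge0.
have g0 := gap_gt0 alpha0 m0 gamma0.
have gi0 : 0 <= (gap_of alpha m gamma)^-1 by rewrite invr_ge0 ltW.
have tau0 : 0 <= (t - s) `^ theta_of alpha gamma by exact: powR_ge0.
have q0 : 0 <= (t - s) `^ theta_of alpha gamma * ((gap_of alpha m gamma)^-1 + fine L2).
  by rewrite mulr_ge0// addr_ge0.
set v := fun w => ApowN _ _ _ _ _ _.
have bound : (L2Unorm P D v <= (Num.sqrt C0 *
    ((t - s) `^ theta_of alpha gamma * ((gap_of alpha m gamma)^-1 + fine L2)))%:E)%E.
  apply: ereal_sqr_le (Lnorm_ge0 _ _ _) (ltW C00) q0 _.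
  rewrite /L2Unorm Lnorm2_sqr; apply: le_trans main.
  rewrite le_eqVlt; apply/orP; left; apply/eqP; apply: eq_integral => w _.
  rewrite gee0_abs ?lee_fin ?normU_ge0// poweR_EFin powR_mulrn ?normU_ge0//.
  rewrite /v (ApowN_norm mD hphi)//.
  have zU r : 0 <= r <= T -> inU D (zN phi sigma X N uN r w).
    move=> hr; apply: inUB (mild_inU hu w hr) _.
    exact: (inU_comb (phiU hphi) N (fun i => sigma i * X i r w)).
  by apply: inUB; exact: zU.
apply: (le_trans bound).
rewrite -[in leRHS](fineK L2f) -EFinD -!EFinM lee_fin -/(theta_of alpha gamma).
rewrite -!mulrA ler_wpM2l ?sqrtr_ge0// mulrCA ler_wpM2l//.
have x0 : 0 < gamma * alpha * H by rewrite !mulr_gt0.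
have gi := gap_inv_le alpha0 m0 gamma0 gG x0.
rewrite -/Cg in gi.
rewrite !mulrA.
set mn := (Num.min (gamma * alpha * H) (gamma ^+ 2))^-1 in gi *.
have mn0 : 0 <= mn by rewrite invr_ge0 le_min (ltW x0) sqr_ge0.
apply: (@le_trans _ _ (Cg * mn + fine L2)); first by rewrite lerD2r.
rewrite mulrDr; apply: lerD; first by rewrite ler_wpM2r// lerDl.
by rewrite ler_peMl// lerDr ltW.
Qed.
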